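(* Assume $R>1$. For $i\in\mathcal I$ let $$\mathcal L_i^+(r,z)=\sum_{x\in V_i^\times}L_i\bigl(o_i,x|\xi_i(z)\bigr)\,L_i(o_i,x|\xi_i)^r,\qquad g(r,z)=1-\sum_{i\in\mathcal I}\frac{\mathcal L_i^+(r,z)}{1+\mathcal L_i^+(r,z)},$$ and substitute $z=e^{-s}$. Then the asymptotic entropy $h=\lim_{n\to\infty}\frac1n\mathbb{E}[-\log\pi_n(X_n)]$ of the random walk $(X_n)_{n\ge0}$ on the free product of the $V_i$, $i\in\mathcal I$, can be written as $$h=\frac{\frac{\partial g}{\partial r}\big|_{r=0,\,z=1}}{\frac{\partial g}{\partial s}\big|_{r=0,\,z=1}},$$ where $\frac{\partial g}{\partial s}$ denotes the derivative of $s\mapsto g(r,e^{-s})$ (so $z=1$ corresponds to $s=0$).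
   Context: Free product. Let $\mathcal I=\{1,\dots,N\}$ with $N\ge2$ be a finite index set (the letter $r$ is used in the claim for a real or complex variable near $0$). For $i\in\mathcal I$ let $V_i$ be a finite or countable set with distinguished root $o_i\in V_i$ (the $V_i$ pairwise disjoint) and let $P_i=(p_i(x,y))_{x,y\in V_i}$ be a stochastic transition matrix, with $n$-step probabilities $p_i^{(n)}(x,y)$. The case $N=2=|V_1|=|V_2|$ is excluded. Standing assumptions: for every $x\in V_i$ there is $n\in\mathbb N$ with $p_i^{(n)}(o_i,x)>0$; $p_i(x,x)=0$ for all $x\in V_i$; uniform irreducibility: there are $\varepsilon_0^{(i)}>0$, $K_i\in\mathbb N$ such that for all $x,y\in V_i$ with $p_i(x,y)>0$ one has $p_i^{(k)}(x,y)\ge\varepsilon_0^{(i)}$ for some $k\le K_i$. Put $V_i^\times=V_i\setminus\{o_i\}$, $V_\ast^\times=\bigcup_i V_i^\times$. The free product $V$ of the $V_i$ is the set of all finite words $x_1\dots x_n$ with letters in $V_\ast^\times$, no two consecutive letters from the same $V_i$, together with the empty word $o$. Each $o_i$ is identified with $o$, so $V_i\subseteq V$, and $xo_i:=x$. The type of $u=u_1\dots u_m\in V$ is $\tau(u)=i$ if $u_m\in V_i^\times$; $\tau(o)=0$. Random walk. For $x\in V$ with $\tau(x)\ne i$ and $v,w\in V_i$ put $\bar p_i(xv,xw)=p_i(v,w)$, and $\bar p_i=0$ otherwise. Fix $\alpha_i>0$ ($i\in\mathcal I$) with $\sum_i\alpha_i=1$ and let $P=\sum_i\alpha_i\bar P_i$,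 with $n$-step probabilities $p^{(n)}(x,y)$. $(X_n)_{n\ge0}$ is the Markov chain on $V$ with $X_0=o$ and transition matrix $P$; $\pi_n$ is the distribution of $X_n$. $R$ denotes the radius of convergence of the Green functions $G(x,y|z)=\sum_{n\ge0}p^{(n)}(x,y)z^n$ (the infimum over $x,y\in V$ of the radii of convergence). Generating functions. With $T_o=\inf\{m\ge1: X_m=o\}$, $\overline H_i(z)=\sum_{n\ge1}\mathbb P[T_o=n,\,X_1\notin V_i^\times]z^n$, $\xi_i(z)=\alpha_iz/(1-\overline H_i(z))$, $\xi_i=\xi_i(1)$ (known: $0<\xi_i<1$, and $\xi_i(z)$ has radius of convergence bigger than $1$). Last visit functions: $L_i(x,y|z)=\sum_{n\ge0}\mathbb P[Y^{(i)}_n=y,\ Y^{(i)}_m\neq x\ \forall 1\le m\le n\mid Y^{(i)}_0=x]z^n$ for the chain $Y^{(i)}$ on $V_i$ governed by $P_i$. *)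

(* Defs.v *)
From HB Require Import structures.
From mathcomp Require Import all_boot all_order all_algebra.
From mathcomp Require Import all_classical all_reals all_analysis.

Set Implicit Arguments.
Unset Strict Implicit.
Unset Printing Implicit Defensive.

Import Order.TTheory GRing.Theory Num.Theory.
Import numFieldNormedType.Exports.

Local Open Scope classical_set_scope.
Local Open Scope ring_scope.

Definition stochastic (R : realType) (S : countType) (p : S -> S -> R) : Prop :=
  (forall x y, 0 <= p x y) /\
  (forall x, \esum_(y in [set: S]) (p x y)%:E = 1%E).

(* All sums occurring below have nonnegative terms: they are taken in the
   extended reals, and [fine] brings the finite ones back to [R]. *)
Fixpoint nstep (R : realType) (S : countType) (p : S -> S -> R) (n : nat)
    (x y : S) : R :=
  if n is m.+1 then fine (\esum_(z in [set: S]) (p x z * nstep p m z y)%:E)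
  else (x == y)%:R.

Definition uniformly_irreducible (R : realType) (S : countType)
    (p : S -> S -> R) : Prop :=
  exists (eps : R) (K : nat), 0 < eps /\
    forall x y, 0 < p x y -> exists2 k : nat, (k <= K)%N & eps <= nstep p k x y.

Fixpoint path_weight (R : realType) (S : countType) (p : S -> S -> R) (x : S)
    (s : seq S) : R :=
  if s is y :: s' then p x y * path_weight p y s' else 1.

(* P[Y_n = y, Y_m <> x for 1 <= m <= n | Y_0 = x]: total weight of the
   trajectories w = (Y_1, ..., Y_n) issued from x that realise this event. *)
Definition last_visit_prob (R : realType) (S : countType) (p : S -> S -> R)
    (x y : S) (n : nat) : R :=
  fine (\esum_(w in [set w : n.-tuple S | last x w = y /\ x \notin w])
          (path_weight p x w)%:E).

Definition last_visit (R : realType) (S : countType) (p : S -> S -> R)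
    (x y : S) (z : R) : R :=
  limn (pseries (last_visit_prob p x y) z).

Definition cv_radius (R : realType) (a : nat -> R) : \bar R :=
  ereal_sup [set z%:E | z in
    [set z : R | 0 <= z /\ cvgn (pseries (fun n => `|a n|) z)]].

Definition green_radius (R : realType) (S : countType) (p : S -> S -> R) :
    \bar R :=
  ereal_inf [set cv_radius (fun n => nstep p n xy.1 xy.2) |
    xy in [set: S * S]].

(* Tagging letters with their index makes the sets [V i] disjoint. *)
Definition reduced (N : nat) (V : 'I_N -> countType) (o : forall i, V i)
    (w : seq {i : 'I_N & V i}) : bool :=
  all (fun a : {i : 'I_N & V i} => tagged a != o (tag a)) w &&
  sorted (fun a b : {i : 'I_N & V i} => tag a != tag b) w.

Definition free_product (N : nat) (V : 'I_N -> countType)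
    (o : forall i, V i) : countType :=
  {w : seq {i : 'I_N & V i} | reduced o w}.

Definition fp_word (N : nat) (V : 'I_N -> countType) (o : forall i, V i)
    (x : free_product o) : seq {i : 'I_N & V i} := sval x.

Definition fp_root (N : nat) (V : 'I_N -> countType) (o : forall i, V i) :
    free_product o :=
  exist _ [::] (erefl : reduced o [::]).

Definition word_type (N : nat) (V : 'I_N -> countType)
    (w : seq {i : 'I_N & V i}) : option 'I_N :=
  omap tag (ohead (rev w)).

(* [None] is the type of the empty word. *)
Definition fp_type (N : nat) (V : 'I_N -> countType) (o : forall i, V i)
    (x : free_product o) : option 'I_N := word_type (fp_word x).

Definition word_app (N : nat) (V : 'I_N -> countType) (o : forall i, V i)
    (w : seq {i : 'I_N & V i}) (i : 'I_N) (v : V i) : seq {i : 'I_N & V i} :=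
  if v == o i then w else rcons w (Tagged (fun i => V i : Type) v).

(* The element xv of the free product; only meaningful when the type of x is
   not i, the value in the other case being x. *)
Definition fp_app (N : nat) (V : 'I_N -> countType) (o : forall i, V i)
    (x : free_product o) (i : 'I_N) (v : V i) : free_product o :=
  insubd x (word_app o (fp_word x) v).

Definition fp_cross (N : nat) (V : 'I_N -> countType) (o : forall i, V i)
    (i : 'I_N) : set (free_product o) :=
  [set fp_app (fp_root o) v | v in [set v : V i | v != o i]].
Arguments fp_cross {N V} o i.

(* Every word is uniquely of the form xv with v in V_i and x of type other
   than i; [word_stem] computes x and [word_coord] computes v. *)
Definition word_stem (N : nat) (V : 'I_N -> countType) (i : 'I_N)
    (w : seq {i : 'I_N & V i}) : seq {i : 'I_N & V i} :=
  if word_type w == Some i then take (size w).-1 w else w.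

Definition word_coord (N : nat) (V : 'I_N -> countType) (o : forall i, V i)
    (i : 'I_N) (w : seq {i : 'I_N & V i}) : V i :=
  if ohead (rev w) is Some a then untag (o i) id a else o i.

(* The lifted kernel; [fp_lift_app] and [fp_lift_eq0] below are its defining
   properties. *)
Definition fp_lift (R : realType) (N : nat) (V : 'I_N -> countType)
    (o : forall i, V i) (p : forall i, V i -> V i -> R) (i : 'I_N)
    (y y' : free_product o) : R :=
  if word_stem i (fp_word y) == word_stem i (fp_word y') then
    p i (word_coord o i (fp_word y)) (word_coord o i (fp_word y'))
  else 0.

Definition fp_trans (R : realType) (N : nat) (V : 'I_N -> countType)
    (o : forall i, V i) (p : forall i, V i -> V i -> R) (alpha : 'I_N -> R)
    (y y' : free_product o) : R :=
  \sum_(i < N) alpha i * fp_lift p i y y'.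

Section FreeProductFacts.
Context (R : realType) (N : nat) (V : 'I_N -> countType) (o : forall i, V i).
Context (p : forall i, V i -> V i -> R).
Implicit Types (x y : free_product o) (i : 'I_N).

Lemma word_type_rcons (w : seq {i : 'I_N & V i}) a :
  word_type (rcons w a) = Some (tag a).
Proof. by rewrite /word_type rev_rcons. Qed.

Lemma reduced_rcons (w : seq {i : 'I_N & V i}) a :
  reduced o (rcons w a) =
  [&& reduced o w, tagged a != o (tag a) & word_type w != Some (tag a)].
Proof.
rewrite /reduced all_rcons; case/lastP: w => [|w b]; first by rewrite /= !andbT.
rewrite word_type_rcons (inj_eq Some_inj).
have -> : sorted (fun a b : {i : 'I_N & V i} => tag a != tag b)
    (rcons (rcons w b) a) =
  sorted (fun a b : {i : 'I_N & V i} => tag a != tag b) (rcons w b) &&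
    (tag b != tag a).
  by case: w => [|c w] /=; rewrite ?andbT // rcons_path last_rcons.
by rewrite -!andbA; do !bool_congr.
Qed.

Lemma fp_word_inj : injective (@fp_word N V o).
Proof. exact: val_inj. Qed.

Lemma fp_word_app x i (v : V i) : fp_type x != Some i ->
  fp_word (fp_app x v) = word_app o (fp_word x) v.
Proof.
move=> xi; have red : reduced o (word_app o (fp_word x) v).
  rewrite /word_app; case: eqP => [_|/eqP vo]; first exact: (svalP x).
  by rewrite reduced_rcons (svalP x) vo.
exact: (insubdK x red).
Qed.

Lemma word_stem_app (w : seq {i : 'I_N & V i}) i (v : V i) :
  word_type w != Some i -> word_stem i (word_app o w v) = w.
Proof.
move=> wi; rewrite /word_app; case: (v =P o i) => [_|_].
  by rewrite /word_stem ifN.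
by rewrite /word_stem word_type_rcons eqxx size_rcons /= -cats1 take_size_cat.
Qed.

Lemma word_coord_app (w : seq {i : 'I_N & V i}) i (v : V i) :
  word_type w != Some i -> word_coord o i (word_app o w v) = v.
Proof.
move=> wi; rewrite /word_app /word_coord; case: (v =P o i) => [->|_].
  move: wi; rewrite /word_type; case: (ohead _) => //= a ai.
  by rewrite untag_dflt //; apply: contraNneq ai => ->.
rewrite rev_rcons /=; pose u : {i : 'I_N & V i} := Tagged (fun i => V i : Type) v.
exact: (@untagE _ (fun i => V i : Type) _ _ _ _ u erefl).
Qed.

Lemma fp_lift_app x i (v w : V i) : fp_type x != Some i ->
  fp_lift p i (fp_app x v) (fp_app x w) = p v w.
Proof.
move=> xi; rewrite /fp_lift !fp_word_app // !word_stem_app // eqxx.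
by rewrite !word_coord_app.
Qed.

Lemma fp_decomp y i : exists x (v : V i),
  [/\ fp_type x != Some i, y = fp_app x v & fp_word x = word_stem i (fp_word y)].
Proof.
have [yi|yi] := boolP (fp_type y == Some i); last first.
  exists y, (o i); split=> //; last by rewrite /word_stem -/(fp_type y) (negbTE yi).
  by apply: fp_word_inj; rewrite fp_word_app // /word_app eqxx.
have := svalP y; rewrite -/(fp_word y).
case/lastP E : (fp_word y) => [|w [j v]]; first by move: yi; rewrite /fp_type E.
move: yi; rewrite /fp_type E word_type_rcons /= (inj_eq Some_inj) => /eqP ji.
case: _ / ji in v E *; rewrite reduced_rcons /= => /and3P[wr vo wj].
exists (exist _ w wr), v; split=> //.
  apply: fp_word_inj; rewrite fp_word_app //.
  by rewrite E /word_app (negbTE vo).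
by rewrite /word_stem word_type_rcons eqxx size_rcons -cats1 take_size_cat.
Qed.

Lemma fp_lift_eq0 i y y' :
  (forall x (v w : V i), fp_type x != Some i ->
     ~ (y = fp_app x v /\ y' = fp_app x w)) ->
  fp_lift p i y y' = 0.
Proof.
move=> H; rewrite /fp_lift; case: eqP => // e.
have [x [v [xi yE xE]]] := fp_decomp y i.
have [x' [w [x'i y'E x'E]]] := fp_decomp y' i.
have xx' : x = x' by apply: fp_word_inj; rewrite xE e -x'E.
by case: (H x v w xi); split=> //; rewrite xx'.
Qed.

End FreeProductFacts.

Definition markov_chain (R : realType) (d : measure_display)
    (Omega : measurableType d) (Pr : probability Omega R) (S : countType)
    (p : S -> S -> R) (x0 : S) (X : nat -> Omega -> S) : Prop :=
  [/\ forall n x, measurable [set omega | X n omega = x],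
      Pr [set omega | X 0 omega = x0] = 1%E
    & forall (n : nat) (x : nat -> S),
        Pr [set omega | forall k, (k <= n.+1)%N -> X k omega = x k] =
        (Pr [set omega | forall k, (k <= n)%N -> X k omega = x k] *
         (p (x n) (x n.+1))%:E)%E].

Definition law (R : realType) (d : measure_display)
    (Omega : measurableType d) (Pr : probability Omega R) (S : countType)
    (X : nat -> Omega -> S) (n : nat) (x : S) : R :=
  fine (Pr [set omega | X n omega = x]).

(* The event T_x = n, where T_x = inf {m >= 1 : X_m = x}. *)
Definition first_return_at (Omega : Type) (S : countType)
    (X : nat -> Omega -> S) (x : S) (n : nat) : set Omega :=
  [set omega | [/\ (0 < n)%N, X n omega = x
    & forall m, (0 < m < n)%N -> X m omega <> x]].

Section GeneratingFunctions.
Context (R : realType) (N : nat) (V : 'I_N -> countType) (o : forall i, V i).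
Context (p : forall i, V i -> V i -> R) (alpha : 'I_N -> R).
Context (d : measure_display) (Omega : measurableType d).
Context (Pr : probability Omega R) (X : nat -> Omega -> free_product o).

Definition Hbar (i : 'I_N) (z : R) : R :=
  limn (pseries (fun n => fine (Pr (first_return_at X (fp_root o) n `&`
    [set omega | ~ fp_cross o i (X 1%N omega)]))) z).

Definition xi (i : 'I_N) (z : R) : R := alpha i * z / (1 - Hbar i z).

Definition Lplus (i : 'I_N) (r z : R) : R :=
  fine (\esum_(x in [set x : V i | x != o i])
    (last_visit (@p i) (o i) x (xi i z) *
     last_visit (@p i) (o i) x (xi i 1) `^ r)%:E).

Definition entropy_g (r z : R) : R :=
  1 - \sum_(i < N) Lplus i r z / (1 + Lplus i r z).

End GeneratingFunctions.

(* Main.v *)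
(* Let L(x) be the generating function at 1 of the trajectories from the empty word
   to x that do not come back to it. It is multiplicative over the letters of x, and
   on the letters of V_i it equals L_i(o_i, x | xi_i): an excursion into the other
   factors only changes the parameter of the generating function. Hence
   pi_n(x) <= G(o,o|1) L(x), while the sum of L over the words with k letters stays
   bounded because g(0,1) = 0 makes 1 the Perron eigenvalue. By Gibbs' inequality the
   entropy of pi_n is E[-log L(X_n)] + O(log n).

   As -log L is additive, its increments only involve the last letter of X_n, and the
   law of the coordinate of X_n in V_i is the convolution of n |-> P[type of X_n <> i]
   with the taboo weights of the letters. Since it has mass 1, a renewal argument gives
   its Cesaro limit L_i(o_i, v | xi_i) / (1 + L_i^+(0,1)), whence the rate
   sum_i (- sum_v L_i log L_i) / (1 + L_i^+(0,1))^2 / G(o,o|1).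

   The numerator is dg/dr at (0,1), and g(0,z) = (1-z) G(o,o|z) near z = 1 gives
   dg/ds = G(o,o|1). *)
Require Import Defs.
From HB Require Import structures.
From mathcomp Require Import all_boot all_order all_algebra.
From mathcomp Require Import all_classical all_reals all_analysis.
From mathcomp Require Import measurable_realfun ring lra.
Set Implicit Arguments.
Unset Strict Implicit.
Unset Printing Implicit Defensive.
Import Order.TTheory GRing.Theory Num.Theory.
Import numFieldNormedType.Exports.
Local Open Scope classical_set_scope.
Local Open Scope ring_scope.

(** * Sums of nonnegative extended reals *)

(* All sums have nonnegative terms and live in [\bar R], where they can be exchanged without
   convergence hypotheses. Identities are therefore written without subtraction, and finiteness is
   settled only where real numbers are needed. For the same reason -log L, whose sign varies since L
   may exceed 1, is treated as a difference of two nonnegative additive functionals. Differentiating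
   in r requires an exponential moment of -log L under L. It comes from uniform irreducibility: a
   letter at distance D from the root has weight at least c^D, so a power L^(1-d) is still dominated
   by a last visit function at some parameter below 1. The assumption R > 1 makes G(o,o|z) finite
   beyond 1; convexity of power series with nonnegative coefficients then gives all the estimates
   near z = 1. Two identities drive the algebra. The inverse of 1 + L_i^+(0,z) is G(o,o|z) (1 -
   Hbar_i(z) - alpha_i z), so the sum in g(0,z) collapses. At z = 1 the same identity turns the
   drift alpha_i (1/xi_i - 1) into 1 / (G(o,o|1) (1 + L_i^+(0,1))), which is where the square in the
   rate comes from. Only expectations are estimated, so no almost sure convergence is involved. *)
Reserved Notation "\Sum_ ( x ) F" (at level 36, F at level 39, x name,
  format "\Sum_ ( x )  F").
Notation "\Sum_ ( x ) F" := (\esum_(x in [set: _]) F)%E : ereal_scope.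

Reserved Notation "\Sum_ ( x : T ) F" (at level 36, F at level 39, x name,
  only parsing).
Notation "\Sum_ ( x : T ) F" := (\esum_(x in [set: T]) F)%E : ereal_scope.

Section Sums.
Context {R : realType}.
Implicit Types T U : choiceType.
Local Open Scope ereal_scope.

Lemma sum_ge0 T (f : T -> \bar R) : (forall x, 0 <= f x) -> 0 <= \Sum_(x) f x.
Proof. by move=> f0; apply: esum_ge0. Qed.

Lemma le_sum T (f g : T -> \bar R) : (forall x, f x <= g x) ->
  \Sum_(x) f x <= \Sum_(x) g x.
Proof. by move=> fg; apply: le_esum. Qed.

Lemma eq_sum T (f g : T -> \bar R) : (forall x, f x = g x) -> \Sum_(x) f x = \Sum_(x) g x.
Proof. by move=> fg; apply: eq_esum => x _. Qed.

Lemma sum0 T (f : T -> \bar R) : (forall x, f x = 0) -> \Sum_(x) f x = 0.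
Proof. by move=> f0; apply: esum1. Qed.

Lemma sumD T (f g : T -> \bar R) : (forall x, 0 <= f x) ->
  (forall x, 0 <= g x) ->
  \Sum_(x) (f x + g x) = \Sum_(x) f x + \Sum_(x) g x.
Proof. by move=> f0 g0; rewrite esumD. Qed.

Lemma sum_ge_term T (f : T -> \bar R) a : (forall x, 0 <= f x) ->
  f a <= \Sum_(x) f x.
Proof.
by move=> f0; apply: esum_ge; exists [set a]; [split|rewrite fsbig_set1].
Qed.

(** The scalar [+oo] is allowed. The inequality [<=] passes through finite subsums; for finite
    positive [c] the reverse one is the same inequality for [c^-1], and for [c = +oo] a single
    nonzero term makes both sides infinite. *)
Lemma sumZl T (c : \bar R) (f : T -> \bar R) : 0 <= c ->
  (forall x, 0 <= f x) -> \Sum_(x) (c * f x) = c * \Sum_(x) f x.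
Proof.
have le_ (c' : \bar R) (g : T -> \bar R) : 0 <= c' -> (forall x, 0 <= g x) ->
    \Sum_(x) (c' * g x) <= c' * \Sum_(x) g x.
  move=> c0 g0; apply: ge_ereal_sup => _ [A [fA AD] <-].
  rewrite -ge0_mule_fsumr//.
  by apply: lee_wpmul2l => //; apply: ereal_sup_ubound; exists A.
move=> c0 f0; apply/le_anti; rewrite le_ //=.
have [f00|/existsNP[a /eqP fa]] := pselect (forall x, f x = 0).
  by rewrite sum0// mule0 sum_ge0// => x; rewrite mule_ge0.
have {}fa : 0 < f a by rewrite lt0e fa f0.
case: c c0 => // [c c0|_]; last first.
  apply: (@le_trans _ _ (+oo * f a)); last first.
    by apply: (@sum_ge_term _ (fun x => +oo * f x)) => x; rewrite mule_ge0.
  by rewrite (gt0_mulye fa) leey.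
have [->|cn0] := eqVneq c 0%R.
  by rewrite mul0e sum_ge0// => x; rewrite mul0e.
have {c0 cn0}c0 : (0 < c)%R by rewrite lt0r cn0 -lee_fin.
rewrite -lee_pdivlMl//.
apply: (@le_trans _ _ (\Sum_(x) (c^-1%:E * (c%:E * f x)))).
  by apply: le_sum => x; rewrite muleA -EFinM mulVf ?gt_eqF// mul1e.
by apply: le_ => // [|x]; [rewrite lee_fin invr_ge0 ltW|rewrite mule_ge0// lee_fin ltW].
Qed.

Lemma sumZr T (c : \bar R) (f : T -> \bar R) : 0 <= c ->
  (forall x, 0 <= f x) -> \Sum_(x) (f x * c) = (\Sum_(x) f x) * c.
Proof. by move=> c0 f0; rewrite muleC -sumZl//; apply: eq_sum => x; rewrite muleC. Qed.

Lemma sum_exchange T U (f : T -> U -> \bar R) : (forall x y, 0 <= f x y) ->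
  \Sum_(x) \Sum_(y) f x y = \Sum_(y) \Sum_(x) f x y.
Proof.
move=> f0; rewrite !esum_esum//.
rewrite (reindex_esum ([set: U] `*`` (fun=> [set: T])) _ (fun x => (x.2, x.1)))//.
split=> //=.
  by move=> [i1 i2] [j1 j2] /= _ _ [] -> ->.
by move=> [i1 i2] _; exists (i2, i1).
Qed.

Lemma sum_big T (I : choiceType) (r : seq I) (P : pred I) (f : I -> T -> \bar R) :
  (forall i x, 0 <= f i x) ->
  \Sum_(x) \sum_(i <- r | P i) f i x = \sum_(i <- r | P i) \Sum_(x) f i x.
Proof. by move=> f0; rewrite esum_sum. Qed.

Lemma sum_inj T U (e : T -> U) (f : U -> \bar R) : injective e ->
  (forall y, (forall x, y <> e x) -> f y = 0) ->
  \Sum_(y) f y = \Sum_(x) f (e x).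
Proof.
move=> ei f0; rewrite -(@esum_image _ _ _ setT e f); last by move=> ? ? _ _; exact: ei.
rewrite [RHS]esum_mkcond; apply: eq_sum => y; case: ifPn => // /negP yi.
by apply: f0 => x yx; apply: yi; rewrite inE; exists x.
Qed.

Lemma sum_delta T (a : T) (f : T -> \bar R) : 0 <= f a ->
  (forall x, x != a -> f x = 0) -> \Sum_(x) f x = f a.
Proof.
move=> fa f0; rewrite -[RHS](esum_set1 fa) [RHS]esum_mkcond.
apply: eq_sum => x; case: ifPn => // /negP xa.
by apply: f0; apply/eqP => xa'; apply: xa; rewrite inE.
Qed.

Lemma sum_natE (a : nat -> \bar R) : (forall n, 0 <= a n) ->
  \Sum_(n) a n = \sum_(n <oo) a n.
Proof. by move=> a0; rewrite nneseries_esumT. Qed.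

Lemma sum_nat_le (a : nat -> \bar R) b : (forall n, 0 <= a n) ->
  (forall n, \sum_(i < n) a i <= b) -> \Sum_(n) a n <= b.
Proof.
move=> a0 ab; rewrite sum_natE//; apply: lime_le.
  by apply: is_cvg_nneseries.
by apply: nearW => n; rewrite big_mkord.
Qed.

Lemma sum_nat_ge (a : nat -> \bar R) n : (forall n, 0 <= a n) ->
  \sum_(i < n) a i <= \Sum_(n) a n.
Proof.
move=> a0; rewrite sum_natE// -(big_mkord xpredT a).
exact: nneseries_lim_ge.
Qed.

Lemma sum_natS (a : nat -> \bar R) : (forall n, 0 <= a n) ->
  \Sum_(n) a n = a 0%N + \Sum_(n) a n.+1.
Proof.
move=> a0.
transitivity (\Sum_(n) ((if n == 0%N then a 0%N else 0) +
    if n is m.+1 then a m.+1 else 0)).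
  by apply: eq_sum => -[|n] /=; rewrite ?adde0 ?add0e.
rewrite sumD; do ?by [case=> //=|move=> x; case: ifP].
rewrite (@sum_delta _ 0%N)//=; last by move=> x /negbTE ->.
congr (_ + _); rewrite (@sum_inj _ _ succn)//; first by move=> x y [].
by case=> // n /(_ n).
Qed.

Definition econv (a b : nat -> \bar R) n := \sum_(k < n.+1) (a k * b (n - k)%N).

Lemma econv_ge0 a b n : (forall n, 0 <= a n) -> (forall n, 0 <= b n) ->
  0 <= econv a b n.
Proof. by move=> a0 b0; apply: sume_ge0 => k _; rewrite mule_ge0. Qed.

Lemma sum_econv (a b : nat -> \bar R) : (forall n, 0 <= a n) ->
  (forall n, 0 <= b n) -> \Sum_(n) econv a b n = (\Sum_(n) a n) * \Sum_(n) b n.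
Proof.
move=> a0 b0.
pose c (k n : nat) := if (k <= n)%N then a k * b (n - k)%N else 0.
have c0 k n : 0 <= c k n by rewrite /c; case: ifP => // _; rewrite mule_ge0.
transitivity (\Sum_(n) \Sum_(k) c k n).
  apply: eq_sum => n; rewrite [RHS]sum_natE//.
  rewrite (nneseries_split 0 n.+1)// add0n big_mkord.
  rewrite [X in _ = _ + X]eseries0 ?adde0; last first.
    by move=> k nk _; rewrite /c leqNgt nk.
  by apply: eq_bigr => k _; rewrite /c -ltnS ltn_ord.
rewrite sum_exchange// -sumZr//; last exact: sum_ge0.
apply: eq_sum => k; rewrite -sumZl//.
rewrite (@sum_inj _ _ (addn k)) => [|x y /addnI//|n nk].
  by apply: eq_sum => m; rewrite /c leq_addr addKn.
by rewrite /c; case: ifPn => // kn; case: (nk (n - k)%N); rewrite subnKC.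
Qed.

Lemma econv_Z (a b : nat -> \bar R) (z : R) n : (forall n, 0 <= a n) ->
  (forall n, 0 <= b n) ->
  econv a b n * (z ^+ n)%:E =
  econv (fun n => a n * (z ^+ n)%:E) (fun n => b n * (z ^+ n)%:E) n.
Proof.
move=> a0 b0; rewrite /econv ge0_sume_distrl; last by move=> k _; rewrite mule_ge0.
apply: eq_bigr => k _; rewrite muleACA -EFinM -exprD subnKC//.
by rewrite -ltnS.
Qed.

(** Generating function with values in [\bar R]: for [z >= 0] it always makes sense, so identities
    between power series hold irrespective of radii of convergence. *)
Definition egf (a : nat -> \bar R) (z : R) := \Sum_(n) (a n * (z ^+ n)%:E).

Lemma eq_egf a b z : (forall n, a n = b n) -> egf a z = egf b z.
Proof. by move=> ab; apply: eq_esum => n _; rewrite ab. Qed.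

Lemma egf_ge0 a z : (forall n, 0 <= a n) -> (0 <= z)%R -> 0 <= egf a z.
Proof. by move=> a0 z0; apply: sum_ge0 => n; rewrite mule_ge0// lee_fin exprn_ge0. Qed.

Lemma egf_econv a b z : (forall n, 0 <= a n) -> (forall n, 0 <= b n) ->
  (0 <= z)%R -> egf (econv a b) z = egf a z * egf b z.
Proof.
move=> a0 b0 z0; rewrite -sum_econv; first by apply: eq_sum => n; rewrite econv_Z.
  by move=> n; rewrite mule_ge0// lee_fin exprn_ge0.
by move=> n; rewrite mule_ge0// lee_fin exprn_ge0.
Qed.

Lemma egfS a z : (forall n, 0 <= a n) -> (0 <= z)%R ->
  egf a z = a 0%N + z%:E * egf (fun n => a n.+1) z.
Proof.
move=> a0 z0; have az n b : 0 <= b -> 0 <= b * (z ^+ n)%:E.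
  by move=> b0; rewrite mule_ge0// lee_fin exprn_ge0.
rewrite /egf sum_natS => [|n]; last by rewrite az.
rewrite expr0 mule1 -sumZl => [||n]; rewrite ?lee_fin ?az//.
by congr (_ + _); apply: eq_sum => n; rewrite exprS EFinM muleCA.
Qed.

Lemma egf_sum T (a : T -> nat -> \bar R) z : (forall x n, 0 <= a x n) ->
  (0 <= z)%R -> egf (fun n => \Sum_(x) a x n) z = \Sum_(x) egf (a x) z.
Proof.
move=> a0 z0; have zn n : 0 <= (z ^+ n)%:E by rewrite lee_fin exprn_ge0.
rewrite sum_exchange => [|x n]; last by rewrite mule_ge0.
by apply: eq_sum => n; rewrite sumZr.
Qed.

Lemma egf_big (I : choiceType) (r : seq I) P (a : I -> nat -> \bar R) z :
  (forall x n, 0 <= a x n) -> (0 <= z)%R ->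
  egf (fun n => \sum_(i <- r | P i) a i n) z = \sum_(i <- r | P i) egf (a i) z.
Proof.
move=> a0 z0; have zn n : 0 <= (z ^+ n)%:E by rewrite lee_fin exprn_ge0.
rewrite -sum_big => [|x n]; last by rewrite mule_ge0.
by apply: eq_sum => n; rewrite ge0_sume_distrl.
Qed.

Lemma egfZ (c : \bar R) a z : 0 <= c -> (forall n, 0 <= a n) -> (0 <= z)%R ->
  egf (fun n => c * a n) z = c * egf a z.
Proof.
move=> c0 a0 z0; have zn n : 0 <= (z ^+ n)%:E by rewrite lee_fin exprn_ge0.
rewrite -sumZl => [||n]//; last by rewrite mule_ge0.
by apply: eq_sum => n; rewrite muleA.
Qed.

Lemma egfZr (c : \bar R) a z : 0 <= c -> (forall n, 0 <= a n) -> (0 <= z)%R ->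
  egf (fun n => a n * c) z = egf a z * c.
Proof.
by move=> c0 a0 z0; rewrite muleC -egfZ//; apply: eq_sum => n; rewrite (muleC c).
Qed.

Lemma egfD a b z : (forall n, 0 <= a n) -> (forall n, 0 <= b n) ->
  (0 <= z)%R -> egf (fun n => a n + b n) z = egf a z + egf b z.
Proof.
move=> a0 b0 z0; have zn n : 0 <= (z ^+ n)%:E by rewrite lee_fin exprn_ge0.
rewrite /egf -sumD => [|n|n]; do ?by rewrite mule_ge0.
by apply: eq_sum => n; rewrite ge0_muleDl.
Qed.

Lemma egf1 a : egf a 1 = \Sum_(n) a n.
Proof. by apply: eq_sum => n; rewrite expr1n mule1. Qed.

Lemma egf_le a b z w : (forall n, 0 <= a n) -> (forall n, a n <= b n) ->
  (0 <= z <= w)%R -> egf a z <= egf b w.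
Proof.
move=> a0 ab /andP[z0 zw]; apply: le_sum => n; apply: lee_pmul => //.
  by rewrite lee_fin exprn_ge0.
by rewrite lee_fin lerXn2r// nnegrE// (le_trans z0).
Qed.

Lemma egf_term a z n : (forall n, 0 <= a n) -> (0 <= z)%R ->
  a n * (z ^+ n)%:E <= egf a z.
Proof.
move=> a0 z0; apply: (@sum_ge_term _ (fun n => a n * (z ^+ n)%:E)) => m.
by rewrite mule_ge0// lee_fin exprn_ge0.
Qed.

Lemma sum_fin_cvg (a : nat -> R) : (forall n, 0 <= a n)%R ->
  \Sum_(n) (a n)%:E < +oo ->
  cvgn (series a) /\ \Sum_(n) (a n)%:E = (limn (series a))%:E.
Proof.
move=> a0 aoo.
have sa : summable xpredT (EFin \o a).
  rewrite /summable; apply: le_lt_trans aoo; rewrite [leLHS]esum_mkcond.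
  by apply: le_sum => n /=; case: ifP => _; rewrite lee_fin// ger0_norm.
have a0' i : true -> 0 <= (EFin \o a) i by move=> _; rewrite lee_fin.
split.
  have := summable_cvg a0' sa; apply: cvg_trans.
  by apply: near_eq_cvg; apply: nearW => n.
by rewrite sum_natE// (summable_nneseries_lim a0' sa).
Qed.

Lemma cvg_sum_fin (a : nat -> R) : (forall n, 0 <= a n)%R ->
  cvgn (series a) -> \Sum_(n) (a n)%:E = (limn (series a))%:E.
Proof.
move=> a0 ca; suff /(sum_fin_cvg a0)[] : \Sum_(n) (a n)%:E < +oo by [].
apply: (@le_lt_trans _ _ (limn (series a))%:E); last exact: ltry.
apply: sum_nat_le => n; rewrite ?lee_fin// sumEFin lee_fin.
rewrite -(big_mkord xpredT a); apply: nondecreasing_cvgn_le => //.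
by apply: nondecreasing_series => k _ _.
Qed.

(** Bridge to [last_visit] and [Hbar], which are defined as limits of real partial sums: these
    limits are meaningful once the extended sum is finite. *)
Lemma egf_pseries (a : nat -> R) (z : R) : (forall n, 0 <= a n)%R ->
  (0 <= z)%R -> egf (EFin \o a) z < +oo ->
  egf (EFin \o a) z = (limn (pseries a z))%:E.
Proof.
move=> a0 z0 foo.
by have [|//|_ <-] := @sum_fin_cvg (fun n => a n * z ^+ n)%R;
  first by move=> n; rewrite mulr_ge0// exprn_ge0.
Qed.

End Sums.

(** * Last visits of one Markov chain *)

Section Kernel.
Context {R : realType} {S : countType} (p : S -> S -> R).
Hypothesis hp : stochastic p.
Local Open Scope ereal_scope.

Lemma kernel_ge0 x y : 0 <= (p x y)%:E.
Proof. by rewrite lee_fin hp.1. Qed.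
Local Hint Resolve kernel_ge0 : core.

Lemma kernel_sum x : \Sum_(y) (p x y)%:E = 1.
Proof. exact: hp.2. Qed.

Lemma kernel_sumZ x c : 0 <= c -> \Sum_(y) (c * (p x y)%:E) = c.
Proof. by move=> c0; rewrite sumZl// kernel_sum mule1. Qed.

Lemma nstep_ge0 n x y : (0 <= nstep p n x y)%R.
Proof.
elim: n x y => [|n IH] x y /=; rewrite ?ler0n// fine_ge0// esum_ge0// => z _.
by rewrite lee_fin mulr_ge0 ?hp.1.
Qed.

(** The two claims depend on each other: the [fine] in [nstep] is harmless only if the inner sum is
    finite, which follows from the row sums of the previous power, and the recursion in turn gives
    the next row sums. *)
Lemma nstep_sum n x : \Sum_(y) (nstep p n x y)%:E = 1 /\
  forall y, (nstep p n.+1 x y)%:E = \Sum_(z) ((p x z)%:E * (nstep p n z y)%:E).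
Proof.
have rec m : (forall z, \Sum_(y) (nstep p m z y)%:E = 1) -> forall z y,
    (nstep p m.+1 z y)%:E = \Sum_(u) ((p z u)%:E * (nstep p m u y)%:E).
  move=> m1 z y; rewrite /= fineK; first by apply: eq_sum => u; rewrite EFinM.
  rewrite ge0_fin_numE; last first.
    by apply: sum_ge0 => u; rewrite lee_fin mulr_ge0 ?nstep_ge0 ?hp.1.
  rewrite (@le_lt_trans _ _ 1) ?ltry// -[leRHS](kernel_sum z); apply: le_sum => u.
  rewrite lee_fin ler_piMr ?hp.1// -lee_fin -(m1 u).
  by apply: (@sum_ge_term _ _ (fun y => (nstep p m u y)%:E)) => v; rewrite lee_fin nstep_ge0.
have s1 : forall m z, \Sum_(y) (nstep p m z y)%:E = 1.
  elim=> [|m IH] z.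
    rewrite (@sum_delta _ _ z)/= ?eqxx// ?lee_fin// => y yx.
    by rewrite eq_sym (negbTE yx).
  under eq_sum do rewrite rec//.
  rewrite sum_exchange => [|y u]; last by rewrite mule_ge0// lee_fin nstep_ge0.
  rewrite -[RHS](kernel_sum z); apply: eq_sum => u.
  by rewrite sumZl// ?IH ?mule1// => y; rewrite lee_fin nstep_ge0.
by split => [|y]; [exact: s1|apply: rec].
Qed.

Lemma nstepE n x y :
  (nstep p n.+1 x y)%:E = \Sum_(z) ((p x z)%:E * (nstep p n z y)%:E).
Proof. exact: (nstep_sum n x).2. Qed.

Lemma nstep0E x y : (nstep p 0 x y)%:E = (x == y)%:R%:E.
Proof. by []. Qed.

Lemma nstep_ge0E n x y : 0 <= (nstep p n x y)%:E.
Proof. by rewrite lee_fin nstep_ge0. Qed.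
Local Hint Resolve nstep_ge0E : core.

Lemma nstep_lastE n x y :
  (nstep p n.+1 x y)%:E = \Sum_(z) ((nstep p n x z)%:E * (p z y)%:E).
Proof.
elim: n x => [|n IH] x.
  rewrite nstepE (@sum_delta _ _ y) ?(@sum_delta _ _ x)/= ?eqxx ?mule1 ?mul1e//.
  - by move=> z zx; rewrite eq_sym (negbTE zx) mul0e.
  - by move=> z zy; rewrite (negbTE zy) mule0.
transitivity (\Sum_(z) \Sum_(u) ((p x z)%:E * ((nstep p n z u)%:E * (p u y)%:E))).
  by rewrite nstepE; apply: eq_sum => z; rewrite IH sumZl// => u; rewrite mule_ge0.
rewrite sum_exchange => [|z u]; last by rewrite !mule_ge0.
apply: eq_sum => z; rewrite nstepE -sumZr// => [|u]; last by rewrite mule_ge0.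
by apply: eq_sum => u; rewrite muleA.
Qed.

Variable o : S.

(** The coefficients of the last visit functions, computed by their last step; [last_visit_probE]
    identifies them with the sums over trajectories. *)
Fixpoint taboo n (y : S) : \bar R :=
  if n is m.+1 then
    if y == o then 0 else \Sum_(z) (taboo m z * (p z y)%:E)
  else (y == o)%:R%:E.

Lemma taboo_ge0 n y : 0 <= taboo n y.
Proof.
elim: n y => [|n IH] y /=; first by rewrite lee_fin ler0n.
by case: ifP => // _; apply: sum_ge0 => z; rewrite mule_ge0.
Qed.
Local Hint Resolve taboo_ge0 : core.

(** The index is shifted by one: this is the probability that the first return takes place at time
    [n.+1]. *)
Definition first_return n := \Sum_(z) (taboo n z * (p z o)%:E).

Lemma first_return_ge0 n : 0 <= first_return n.
Proof. by apply: sum_ge0 => z; rewrite mule_ge0. Qed.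
Local Hint Resolve first_return_ge0 : core.

Lemma taboo_sum0 : \Sum_(y) taboo 0 y = 1.
Proof. by rewrite (@sum_delta _ _ o)/= ?eqxx ?lee_fin// => z /negbTE ->. Qed.

(** One step conserves mass: what the taboo weights lose has just come back to the root. *)
Lemma taboo_sumS n :
  \Sum_(y) taboo n.+1 y + first_return n = \Sum_(y) taboo n y.
Proof.
transitivity (\Sum_(y) \Sum_(z) (taboo n z * (p z y)%:E)).
  have -> : first_return n =
      \Sum_(y) if y == o then \Sum_(z) (taboo n z * (p z y)%:E) else 0.
    rewrite (@sum_delta _ _ o) ?eqxx// => [|y /negbTE ->//].
    exact: first_return_ge0.
  rewrite -sumD => [|y|y]; first last.
  - by case: ifP => // _; apply: sum_ge0 => z; rewrite mule_ge0.
  - exact: taboo_ge0.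
  by apply: eq_sum => y /=; case: ifP => _; rewrite ?add0e ?adde0.
rewrite sum_exchange => [|z y]; last by rewrite mule_ge0.
by apply: eq_sum => z; rewrite kernel_sumZ.
Qed.

Lemma taboo_sum_le1 n : \Sum_(y) taboo n y <= 1.
Proof.
elim: n => [|n]; first by rewrite taboo_sum0.
by apply: le_trans; rewrite -[leRHS]taboo_sumS leeDl.
Qed.

Lemma taboo_le1 n y : taboo n y <= 1.
Proof. exact: le_trans (sum_ge_term _ (taboo_ge0 n)) (taboo_sum_le1 n). Qed.

Lemma taboo_fin n y : taboo n y \is a fin_num.
Proof. by rewrite ge0_fin_numE// (le_lt_trans (taboo_le1 _ _))// ltry. Qed.

Lemma taboo_le_nstep n y : taboo n y <= (nstep p n o y)%:E.
Proof.
elim: n y => [|n IH] y; first by rewrite /= lee_fin eq_sym.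
rewrite nstep_lastE /=; case: ifP => _; first by apply: sum_ge0 => z; rewrite mule_ge0.
by apply: le_sum => z; apply: lee_wpmul2r.
Qed.

Lemma first_return_sum : \Sum_(n) first_return n <= 1.
Proof.
apply: sum_nat_le => // n.
(* Adding the mass that has not yet returned makes the partial sums telescope to [taboo_sum0]. *)
apply: (@le_trans _ _ (\sum_(i < n) first_return i + \Sum_(y) taboo n y)).
  by rewrite leeDl//; apply: sum_ge0.
rewrite -taboo_sum0; elim: n => [|n IH]; first by rewrite big_ord0 add0e.
by apply: le_trans IH; rewrite big_ord_recr/= -addeA (addeC (first_return n)) taboo_sumS.
Qed.

Lemma path_weight_ge0 x (s : seq S) : (0 <= path_weight p x s)%R.
Proof. by elim: s x => //= y s IH x; rewrite mulr_ge0// hp.1. Qed.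

Lemma path_weight_rcons x (s : seq S) y :
  path_weight p x (rcons s y) = (path_weight p x s * p (last x s) y)%R.
Proof. by elim: s x => [|z s IH] x /=; rewrite ?mulr1 ?mul1r// IH mulrA. Qed.

Lemma sum_tuple_rcons n (F : seq S -> \bar R) : (forall s, 0 <= F s) ->
  \esum_(w in [set: n.+1.-tuple S]) F w =
  \esum_(w in [set: n.-tuple S]) \Sum_(z) F (rcons w z).
Proof.
move=> F0; rewrite esum_esum//=.
rewrite (reindex_esum ([set: n.-tuple S] `*`` (fun=> [set: S])) _
  (fun wz => [tuple of rcons wz.1 wz.2]))//.
split => // [[w z] [w' z'] _ _ /(congr1 val) /= /rcons_inj[/val_inj -> ->]//|w _].
case/tupleP: w => x w; exists ([tuple of belast x w], last x w) => //.
by apply: val_inj; rewrite /= -lastI.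
Qed.

(** The condition on trajectories is moved into the summand, so that the sum runs over all tuples
    and can be peeled at the last entry. *)
Lemma last_visit_probE n y : (last_visit_prob p o y n)%:E = taboo n y.
Proof.
pose c (s : seq S) z := (last o s == z) && (o \notin s).
pose W m z := \esum_(w in [set: m.-tuple S])
  (if c w z then (path_weight p o w)%:E else 0).
have w0 (s : seq S) : 0 <= (path_weight p o s)%:E by rewrite lee_fin path_weight_ge0.
have WE m z : W m z = taboo m z.
  elim: m z => [|m IH] z.
    rewrite /W (@sum_delta _ _ [tuple])/=.
    - by rewrite /c/= andbT eq_sym; case: (z == o).
    - by case: ifP.
    - by move=> w; rewrite tuple0.
  rewrite /W (@sum_tuple_rcons _ (fun w => if c w z then (path_weight p o w)%:E else 0)).
    transitivity (\esum_(w in [set: m.-tuple S])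
        if c (rcons w z) z then (path_weight p o (rcons w z))%:E else 0).
      apply: eq_sum => w; rewrite (@sum_delta _ _ z)//; first by case: ifP.
      by move=> u uz; rewrite /c last_rcons (negbTE uz).
    rewrite /=; have [->|zo] := eqVneq z o.
      by apply: sum0 => w; rewrite /c mem_rcons in_cons eqxx andbF.
    transitivity (\Sum_(u) \esum_(w in [set: m.-tuple S])
        ((if c w u then (path_weight p o w)%:E else 0) * (p u z)%:E)).
      rewrite sum_exchange => [|u w]; last by rewrite mule_ge0//; case: ifP.
      apply: eq_sum => w; rewrite (@sum_delta _ _ (last o w)).
      - rewrite /c last_rcons eqxx mem_rcons in_cons eq_sym (negbTE zo) eqxx /=.
        by case: ifP => _; rewrite ?mul0e// path_weight_rcons EFinM.
      - by rewrite mule_ge0//; case: ifP.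
      - by move=> u; rewrite eq_sym => /negbTE uw; rewrite /c uw mul0e.
    apply: eq_sum => u; rewrite sumZr// -?IH// => w.
    by case: ifP.
  by move=> s; case: ifP.
rewrite -WE /last_visit_prob.
suff -> : \esum_(w in [set w : n.-tuple S | last o w = y /\ o \notin w])
  (path_weight p o w)%:E = W n y by rewrite fineK// WE taboo_fin.
rewrite esum_mkcond; apply: eq_sum => w; congr (if _ then _ else _).
apply/idP/idP => [|/andP[/eqP ? ?]]; rewrite inE//.
by rewrite /c => -[-> ->]; rewrite eqxx.
Qed.

End Kernel.

(** * Last visit generating functions: recursion, minimality, decay *)

Section LastVisit.
Context {R : realType} {S : countType} (p : S -> S -> R).
Hypothesis hp : stochastic p.
Variable o : S.
Local Open Scope ereal_scope.
Implicit Types (t : R).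
Local Notation taboo := (taboo p o).
Local Notation first_return := (first_return p o).

Let p0 x y : 0 <= (p x y)%:E. Proof. exact: kernel_ge0. Qed.
Let t0 n x : 0 <= taboo n x. Proof. exact: taboo_ge0. Qed.
Local Hint Resolve p0 t0 : core.

Definition last_visit_gf (y : S) (t : R) := egf (taboo ^~ y) t.

Lemma last_visit_gf_ge0 y t : (0 <= t)%R -> 0 <= last_visit_gf y t.
Proof. by move=> ?; apply: egf_ge0 => // n; exact: t0. Qed.
Local Hint Resolve last_visit_gf_ge0 : core.

Lemma last_visit_gf_root t : (0 <= t)%R -> last_visit_gf o t = 1.
Proof.
move=> t_ge0; rewrite /last_visit_gf /egf (@sum_delta _ _ 0%N)//= ?eqxx ?mule1 ?lee_fin//.
by case=> //= n _; rewrite eqxx mul0e.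
Qed.

Lemma last_visit_gf_eq y t : (0 <= t)%R -> y != o ->
  last_visit_gf y t = t%:E * \Sum_(z) (last_visit_gf z t * (p z y)%:E).
Proof.
move=> t_ge0 yo; rewrite /last_visit_gf egfS//= (negbTE yo) add0e; congr (_ * _).
rewrite egf_sum// => [|z n]; last by rewrite mule_ge0.
by apply: eq_sum => z; rewrite egfZr//.
Qed.

Lemma first_return_gf t : (0 <= t)%R ->
  egf first_return t = \Sum_(z) (last_visit_gf z t * (p z o)%:E).
Proof.
move=> t_ge0; rewrite egf_sum// => [|z n]; last by rewrite mule_ge0.
by apply: eq_sum => z; rewrite egfZr.
Qed.

(** The last visit functions are the least nonnegative supersolution of their own recursion: the
    partial sums start from 0 and stay below [M] by induction. Minimality replaces uniqueness, which
    may fail for infinite values. *)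
Lemma last_visit_gf_min (M : S -> \bar R) t : (0 <= t)%R -> (forall y, 0 <= M y) ->
  1 <= M o -> (forall y, y != o -> (t%:E * \Sum_(z) (M z * (p z y)%:E) <= M y)%E) ->
  forall y, last_visit_gf y t <= M y.
Proof.
move=> t_ge0 M0 Mo Mr y; apply: sum_nat_le => [n|n].
  by rewrite mule_ge0// lee_fin exprn_ge0.
have tt m z : 0 <= taboo m z * (t ^+ m)%:E by rewrite mule_ge0// lee_fin exprn_ge0.
elim: n y => [|n IH] y; first by rewrite big_ord0.
rewrite big_ord_recl /= expr0 mule1; have [->|yo] := eqVneq y o.
  by rewrite big1 ?adde0 => [|i _]; rewrite ?eqxx ?mul0e.
rewrite add0e; apply: le_trans (Mr y yo).
rewrite (eq_bigr (fun i : 'I_n => t%:E * \Sum_(z) ((taboo i z * (t ^+ i)%:E) * (p z y)%:E))).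
  rewrite -ge0_sume_distrr => [|i _]; last by apply: sum_ge0 => z; rewrite mule_ge0.
  apply: lee_wpmul2l => //; rewrite -sum_big => [|i z]; last by rewrite mule_ge0.
  by apply: le_sum => z; rewrite -ge0_sume_distrl//; apply: lee_wpmul2r.
move=> i _; rewrite exprS EFinM muleCA; congr (_ * _).
rewrite -sumZr ?lee_fin ?exprn_ge0// => [|z]; last by rewrite mule_ge0.
by apply: eq_sum => z; rewrite muleAC.
Qed.

Lemma geometric_sum_le (s : R) : (0 <= s < 1)%R ->
  \Sum_(n) (s ^+ n)%:E <= ((1 - s)^-1)%:E.
Proof.
move=> /andP[s0 s1]; apply: sum_nat_le => n; first by rewrite lee_fin exprn_ge0.
rewrite sumEFin lee_fin -[leRHS]mul1r ler_pdivlMr ?subr_gt0//.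
by rewrite mulrC -opprB mulNr -subrX1 opprB gerBl exprn_ge0.
Qed.

Lemma last_visit_gf_sumE t : (0 <= t)%R ->
  \Sum_(y) last_visit_gf y t = egf (fun n => \Sum_(y) taboo n y) t.
Proof. by move=> t_ge0; rewrite egf_sum// => x n; exact: t0. Qed.

Lemma last_visit_gf_sum_le t : (0 <= t < 1)%R -> \Sum_(y) last_visit_gf y t <= ((1 - t)^-1)%:E.
Proof.
move=> /[dup] tt /andP[t_ge0 t1]; rewrite last_visit_gf_sumE//.
apply: le_trans (geometric_sum_le tt); apply: le_sum => n.
by rewrite -[leRHS]mul1e lee_wpmul2r ?lee_fin ?exprn_ge0// taboo_sum_le1.
Qed.

Lemma last_visit_gf_le t y : (0 <= t < 1)%R -> last_visit_gf y t <= ((1 - t)^-1)%:E.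
Proof.
move=> /[dup] tt /andP[t_ge0 t1]; apply: le_trans (last_visit_gf_sum_le tt).
by apply: (@sum_ge_term _ _ (last_visit_gf ^~ t)) => z; exact: last_visit_gf_ge0.
Qed.

Lemma last_visit_gf_fin t y : (0 <= t < 1)%R -> last_visit_gf y t \is a fin_num.
Proof.
move=> /[dup] tt /andP[t_ge0 t1]; rewrite ge0_fin_numE ?last_visit_gf_ge0//.
by rewrite (le_lt_trans (last_visit_gf_le _ tt))// ltry.
Qed.

Lemma last_visitE t y : (0 <= t < 1)%R -> (last_visit p o y t)%:E = last_visit_gf y t.
Proof.
move=> /[dup] tt /andP[t_ge0 t1].
have e : last_visit_gf y t = egf (EFin \o last_visit_prob p o y) t.
  by apply: eq_sum => n /=; rewrite last_visit_probE.
rewrite e egf_pseries// -?e.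
  by move=> n; rewrite -lee_fin last_visit_probE.
by have := last_visit_gf_fin y tt; rewrite ge0_fin_numE// last_visit_gf_ge0.
Qed.

(** The generating function of the mass balance [taboo_sumS], kept free of subtractions. *)
Lemma last_visit_gf_sum_eq t : (0 <= t)%R ->
  \Sum_(y) last_visit_gf y t + t%:E * egf first_return t = 1 + t%:E * \Sum_(y) last_visit_gf y t.
Proof.
move=> t_ge0; rewrite last_visit_gf_sumE//.
have s0 n : 0 <= \Sum_(y) taboo n y by apply: sum_ge0.
rewrite [in LHS]egfS// taboo_sum0// -addeA; congr (_ + _).
rewrite -ge0_muleDr; last 2 first.
- by apply: egf_ge0 => // n; apply: sum_ge0 => y; exact: t0.
- by apply: egf_ge0 => // n; apply: first_return_ge0.
congr (_ * _).
transitivity (egf (fun n => \Sum_(y) taboo n.+1 y + first_return n) t).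
  by rewrite egfD// => n; apply: first_return_ge0.
by apply: eq_egf => n; rewrite taboo_sumS.
Qed.

(** Without a loop at the root a return takes at least two steps. The second factor [t] gained in
    this way is what excludes the value 1 of [xir] in [xir1_lt1]. *)
Lemma first_return_gf_le t : (0 <= t <= 1)%R -> p o o = 0%R ->
  t%:E * egf first_return t <= (t ^+ 2)%:E.
Proof.
move=> /andP[t_ge0 t1] poo; rewrite expr2 EFinM lee_wpmul2l ?lee_fin//.
have f0 n : 0 <= first_return n by apply: first_return_ge0.
rewrite egfS// (_ : first_return 0 = 0) ?add0e; last first.
  apply: sum0 => z /=; have [->|_] := eqVneq z o; first by rewrite poo mule0.
  by rewrite mul0e.
rewrite -[leRHS]mule1 lee_wpmul2l ?lee_fin//.
apply: (le_trans _ (first_return_sum hp o)).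
rewrite [leRHS]sum_natS//; apply: (@le_trans _ _ (\Sum_(n) first_return n.+1)).
  by rewrite -egf1; apply: egf_le => //; rewrite t_ge0.
by rewrite leeDr.
Qed.

Lemma first_return_gf_le1 t : (0 <= t <= 1)%R -> t%:E * egf first_return t <= 1.
Proof.
move=> /andP[t_ge0 t1]; have f0 n : 0 <= first_return n by apply: first_return_ge0.
rewrite -[leRHS]mule1; apply: lee_pmul; rewrite ?lee_fin ?egf_ge0//.
apply: (le_trans _ (first_return_sum hp o)).
by rewrite -egf1; apply: egf_le => //; rewrite t_ge0.
Qed.

(** As a measure, [last_visit_gf] is invariant under one step weighted by [t] outside the root, and
    at the root it can only lose mass, because the return generating function is at most 1 there. *)
Lemma last_visit_gf_excessive t k x : (0 <= t <= 1)%R ->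
  \Sum_(y) (last_visit_gf y t * ((t ^+ k)%:E * (nstep p k y x)%:E)) <= last_visit_gf x t.
Proof.
move=> tt; have /andP[t_ge0 t1] := tt.
have n0 m a b : 0 <= (nstep p m a b)%:E by apply: nstep_ge0E.
have tk m : 0 <= (t ^+ m)%:E by rewrite lee_fin exprn_ge0.
elim: k x => [|k IH] x.
  rewrite (@sum_delta _ _ x)/= ?eqxx ?expr0 ?mule1 ?last_visit_gf_ge0// => y /negbTE ->.
  by rewrite !mule0.
apply: le_trans (IH x).
have -> : \Sum_(y) (last_visit_gf y t * ((t ^+ k.+1)%:E * (nstep p k.+1 y x)%:E)) =
    \Sum_(z) (t%:E * \Sum_(y) (last_visit_gf y t * (p y z)%:E) *
      ((t ^+ k)%:E * (nstep p k z x)%:E)).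
  transitivity (\Sum_(y) \Sum_(z) (t%:E * (last_visit_gf y t * (p y z)%:E) *
      ((t ^+ k)%:E * (nstep p k z x)%:E))).
    apply: eq_sum => y; rewrite nstepE// -!sumZl ?mule_ge0 ?last_visit_gf_ge0//.
    - apply: eq_sum => z; rewrite exprS EFinM.
      by rewrite !muleA; congr (_ * _); rewrite -!muleA muleCA; congr (_ * _);
        congr (_ * _); rewrite muleC.
    - by move=> z; rewrite !mule_ge0.
    - by move=> z; rewrite mule_ge0.
  rewrite sum_exchange => [|y z]; last by rewrite !mule_ge0// last_visit_gf_ge0.
  apply: eq_sum => z; rewrite sumZr ?mule_ge0//; last first.
    by move=> y; rewrite !mule_ge0// last_visit_gf_ge0.
  by rewrite sumZl// => y; rewrite mule_ge0// last_visit_gf_ge0.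
apply: le_sum => z; apply: lee_wpmul2r; first by rewrite mule_ge0.
have [->|zo] := eqVneq z o; last by rewrite -last_visit_gf_eq.
by rewrite -first_return_gf// last_visit_gf_root// first_return_gf_le1.
Qed.

Lemma last_visit_gf_step t k x y : (0 <= t <= 1)%R ->
  last_visit_gf y t * ((t ^+ k)%:E * (nstep p k y x)%:E) <= last_visit_gf x t.
Proof.
move=> tt; apply: le_trans (last_visit_gf_excessive k x tt).
apply: (@sum_ge_term _ _ (fun y => last_visit_gf y t * ((t ^+ k)%:E * (nstep p k y x)%:E))) => z.
have /andP[t_ge0 _] := tt.
by rewrite !mule_ge0 ?last_visit_gf_ge0// ?lee_fin ?exprn_ge0// nstep_ge0.
Qed.

(** A Harnack inequality: along an edge of positive probability the last visit function drops at
    most by a fixed factor, so it is at least exponential in the length of a path from the root. *)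
Lemma last_visit_gf_lower_bound t : (0 < t < 1)%R -> uniformly_irreducible p ->
  exists c : R, (0 < c <= 1)%R /\
    forall n x, (0 < nstep p n o x)%R -> (c ^+ n)%:E <= last_visit_gf x t.
Proof.
move=> /andP[t_gt0 t1] [eps [K [eps0 irr]]].
have t_ge0 := ltW t_gt0; have tt : (0 <= t <= 1)%R by rewrite t_ge0 ltW.
(* An edge can be replaced by [k <= K] steps of probability at least [eps], with weight
   [t ^+ k >= t ^+ K]. The minimum with 1 makes [ln c] nonpositive in the next lemma. *)
pose c : R := (Num.min 1 (eps * t ^+ K))%R.
have c0 : (0 < c)%R by rewrite lt_min ltr01 mulr_gt0// exprn_gt0.
exists c; split; first by rewrite c0 ge_min lexx.
have stp x y : (0 < p x y)%R -> (c%:E * last_visit_gf x t <= last_visit_gf y t)%E.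
  move=> /irr[k kK pk]; apply: le_trans (last_visit_gf_step k y x tt).
  rewrite muleC; apply: lee_wpmul2l; first exact: last_visit_gf_ge0.
  rewrite -EFinM lee_fin (@le_trans _ _ (eps * t ^+ K)%R) ?ge_min ?lexx ?orbT//.
  rewrite mulrC ler_pM ?exprn_ge0 ?(ltW eps0)//.
  by rewrite ler_wiXn2l// ltW.
suff H n x y : (0 < nstep p n x y)%R -> ((c ^+ n)%:E * last_visit_gf x t <= last_visit_gf y t)%E.
  by move=> n x /H; rewrite last_visit_gf_root// mule1.
elim: n x y => [|n IH] x y /=.
  by have [->|_] := eqVneq x y; rewrite ?ltxx// expr0 mul1e.
rewrite -/(nstep p n.+1 x y) => sp.
have {sp} : 0 < (nstep p n.+1 x y)%:E by rewrite lte_fin.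
rewrite nstepE// => sp.
have [z] : exists z, 0 < (p x z)%:E * (nstep p n z y)%:E.
  apply: contrapT => /forallNP nz; move: sp; rewrite sum0 ?ltxx// => z.
  apply/eqP; apply/negPn/negP => pz; apply: (nz z).
  by rewrite lt0e pz mule_ge0// nstep_ge0E.
rewrite -EFinM lte_fin => pz.
have pxz : (0 < p x z)%R.
  by rewrite lt0r hp.1 andbT; apply: contraTneq pz => ->; rewrite mul0r ltxx.
have nz : (0 < nstep p n z y)%R.
  by rewrite lt0r nstep_ge0// andbT; apply: contraTneq pz => ->; rewrite mulr0 ltxx.
apply: le_trans (IH _ _ nz); rewrite exprSr EFinM -muleA lee_wpmul2l ?stp//.
by rewrite lee_fin exprn_ge0// ltW.
Qed.

(* The weights decay exponentially in the distance [D] to the root, while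
   [last_visit_gf] is at least exponential in [-D]: this leaves room for a power. *)
Lemma last_visit_gf_power_summable t : (0 < t < 1)%R -> uniformly_irreducible p ->
  (forall x, exists n, 0 < nstep p n o x)%R ->
  exists d s : R, [/\ (0 < d)%R, (0 <= s < 1)%R &
    forall x, (last_visit p o x t `^ (1 - d))%:E <= last_visit_gf x s] /\
    (forall x, (0 < last_visit p o x t)%R).
Proof.
move=> /[dup] tt /andP[t_gt0 t1] irr reach.
have t_ge0 := ltW t_gt0; have tt' : (0 <= t < 1)%R by rewrite t_ge0.
have [c [/andP[c0 c1] Hc]] := last_visit_gf_lower_bound tt irr.
have lnc : (ln c <= 0)%R by rewrite ln_le0.
have lnt : (ln t < 0)%R by rewrite ln_lt0// t_gt0.
have lp x : (0 < last_visit p o x t)%R.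
  have [n /Hc] := reach x; rewrite -last_visitE// lee_fin; apply: lt_le_trans.
  by rewrite exprn_gt0.
(* With [b] equal to [c] to the power [- d], this choice gives [ln (b * t) = ln t / (1 - ln c)],
   which is negative. *)
pose d : R := (- ln t / (1 - ln c))%R.
have d0 : (0 < d)%R by rewrite divr_gt0 ?oppr_gt0// ltr_wpDr// oppr_ge0.
pose b : R := expR (- d * ln c).
have b1 : (1 <= b)%R by rewrite -expR0 ler_expR mulNr oppr_ge0 mulr_ge0_le0// ltW.
have bt : (b * t < 1)%R.
  rewrite -[t]lnK ?posrE// -expRD -expR0 ltr_expR /d.
  have -> : (- (- ln t / (1 - ln c)) * ln c + ln t = ln t / (1 - ln c))%R.
    by field; rewrite subr_eq0 gt_eqF// (le_lt_trans lnc).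
  by rewrite pmulr_llt0// invr_gt0 ltr_wpDr// oppr_ge0.
exists d, (b * t)%R; split => //; split => //.
  by rewrite bt andbT mulr_ge0// expR_ge0.
(* [D] is the distance from the root to [x]. The lower bound [c ^+ D] turns the factor [L ^ (- d)]
   into at most [b ^+ D]; as the coefficients of [last_visit_gf x] vanish below [D], this is at most
   [b ^+ n] in each remaining term, which changes [t] into [b * t]. *)
move=> x; case: (ex_minnP (reach x)) => D xD minD.
rewrite /powR gt_eqF ?lp// mulrBl mul1r expRD lnK ?posrE ?lp//.
rewrite EFinM last_visitE//.
apply: (@le_trans _ _ (last_visit_gf x t * (b ^+ D)%:E)).
  apply: lee_wpmul2l; first exact: last_visit_gf_ge0.
  rewrite lee_fin -expRM_natl ler_expR mulrCA.
  have h : (ln (c ^+ D) <= ln (last_visit p o x t))%R.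
    rewrite ler_ln ?posrE ?exprn_gt0 ?lp//.
    by have := Hc _ _ xD; rewrite -last_visitE// lee_fin.
  rewrite lnXn// in h.
  by rewrite mulNr lerN2 ler_wpM2l ?(ltW d0)// mulr_natl.
rewrite -egfZr ?lee_fin ?exprn_ge0 ?expR_ge0//.
apply: le_sum => n; rewrite -muleA -EFinM.
have [->|tn] := eqVneq (taboo n x) 0; first by rewrite !mul0e.
apply: lee_wpmul2l => //; rewrite lee_fin exprMn ler_wpM2r ?exprn_ge0//.
rewrite ler_weXn2l//; apply: minD.
rewrite -lte_fin; apply: lt_le_trans (taboo_le_nstep hp o n x).
by rewrite lt0e tn t0.
Qed.

End LastVisit.

(** * Weights of words in the free product *)

Section Words.
Context {R : realType} {N : nat} {V : 'I_N -> countType} (o : forall i, V i).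
Context (p : forall i, V i -> V i -> R) (alpha : 'I_N -> R).
Hypothesis hp : forall i, stochastic (@p i).
Hypothesis ha : forall i, 0 < alpha i.
Local Open Scope ereal_scope.
Local Notation W := (seq {i : 'I_N & V i}).
Implicit Types (w x y : W) (f : W -> \bar R) (i k : 'I_N) (z : R).

Let p0 i (x y : V i) : 0 <= (p x y)%:E. Proof. exact: kernel_ge0. Qed.
Let a0 i : 0 <= (alpha i)%:E. Proof. by rewrite lee_fin ltW. Qed.
Local Hint Resolve p0 a0 : core.

Lemma word_stem_cat k w y : y != [::] ->
  word_stem k (w ++ y) = w ++ word_stem k y.
Proof.
case/lastP: y => // y a _; rewrite -rcons_cat /word_stem !word_type_rcons.
case: ifP => _; last by rewrite rcons_cat.
by rewrite !size_rcons /= -!cats1 !take_size_cat.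
Qed.

Lemma word_coord_cat k w y : y != [::] ->
  word_coord o k (w ++ y) = word_coord o k y.
Proof.
by case/lastP: y => // y a _; rewrite -rcons_cat /word_coord !rev_rcons.
Qed.

Lemma word_app_cat w y k (u : V k) :
  word_app o (w ++ y) u = w ++ word_app o y u.
Proof. by rewrite /word_app; case: ifP => // _; rewrite rcons_cat. Qed.

(** The measure [f] after one step of the walk, evaluated at [x]: a predecessor through factor [k]
    differs from [x] only in its coordinate in [V k]. It is defined on raw sequences, so that no
    proof of reducedness is carried along; [fp_pred] makes the link with [fp_trans]. *)
Definition pred_sum f x := \sum_(k < N) ((alpha k)%:E *
  \Sum_(u) (f (word_app o (word_stem k x) u) * (p u (word_coord o k x))%:E)).

Lemma pred_sum_ge0 f x : (forall y, 0 <= f y) -> 0 <= pred_sum f x.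
Proof.
move=> f0; apply: sume_ge0 => k _; rewrite mule_ge0//.
by apply: sum_ge0 => u; rewrite mule_ge0.
Qed.

Lemma eq_pred_sum f g x : (forall y, f y = g y) -> pred_sum f x = pred_sum g x.
Proof.
move=> fg; apply: eq_bigr => k _; congr (_ * _).
by apply: eq_sum => u; rewrite fg.
Qed.

(** When [y] is not empty, a step only changes, removes or adds a letter at its end, so the prefix
    [w] is inert. *)
Lemma pred_sum_cat f w y : y != [::] ->
  pred_sum f (w ++ y) = pred_sum (fun y => f (w ++ y)) y.
Proof.
move=> y0; apply: eq_bigr => k _; congr (_ * _); apply: eq_sum => u.
by rewrite word_stem_cat// word_coord_cat// word_app_cat.
Qed.

Lemma pred_sum_lin m (c : 'I_m -> \bar R) (F : 'I_m -> W -> \bar R) x :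
  (forall j, 0 <= c j) -> (forall j y, 0 <= F j y) ->
  pred_sum (fun y => \sum_(j < m) (c j * F j y)) x =
  \sum_(j < m) (c j * pred_sum (F j) x).
Proof.
move=> c0 F0.
under [RHS]eq_bigr => j _.
  rewrite /pred_sum ge0_sume_distrr; last first.
    by move=> k _; rewrite mule_ge0// sum_ge0// => u; rewrite mule_ge0.
  over.
rewrite exchange_big; apply: eq_bigr => k _ /=.
under [RHS]eq_bigr do rewrite muleCA.
rewrite -ge0_sume_distrr; last first.
  by move=> j _; rewrite mule_ge0// sum_ge0// => u; rewrite mule_ge0.
congr (_ * _).
under [RHS]eq_bigr => j _.
  rewrite -sumZl//; last by move=> u; rewrite mule_ge0.
  over.
rewrite -sum_big; last by move=> j u; rewrite !mule_ge0.
apply: eq_sum => u; rewrite ge0_sume_distrl; last by move=> j _; rewrite mule_ge0.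
by apply: eq_bigr => j _; rewrite muleA.
Qed.

(* [walk n x] and [walk_taboo n x] are the weights of the [n]-step trajectories of the
   walk from the empty word to [x], respectively of those that do not come
   back to the empty word; they are only meaningful on reduced words, but
   their recursion makes sense on all of them. *)
Fixpoint walk n x : \bar R :=
  if n is m.+1 then pred_sum (walk m) x else (x == [::])%:R%:E.

Fixpoint walk_taboo n x : \bar R :=
  if n is m.+1 then if x == [::] then 0 else pred_sum (walk_taboo m) x
  else (x == [::])%:R%:E.

Lemma walk_ge0 n x : 0 <= walk n x.
Proof.
by elim: n x => [|n IH] x /=; [rewrite lee_fin ler0n|apply: pred_sum_ge0].
Qed.

Lemma walk_taboo_ge0 n x : 0 <= walk_taboo n x.
Proof.
elim: n x => [|n IH] x /=; first by rewrite lee_fin ler0n.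
by case: ifP => // _; apply: pred_sum_ge0.
Qed.
Local Hint Resolve walk_ge0 walk_taboo_ge0 : core.

Lemma walk_taboo_nil n : walk_taboo n [::] = (n == 0%N)%:R%:E.
Proof. by case: n. Qed.

Lemma econv_walk_taboo_nil (a : nat -> \bar R) n : econv a (walk_taboo ^~ [::]) n = a n.
Proof.
rewrite /econv big_ord_recr/= subnn mule1 big1 ?add0e// => k _.
by rewrite walk_taboo_nil subn_eq0 leqNgt ltn_ord mule0.
Qed.

(** Decomposition at the last visit to [w]: afterwards the trajectory stays in the cone of [w],
    where it is a copy of the walk that does not come back to the empty word. The abstract [Q]
    covers both [walk] and [walk_taboo]. *)
Lemma walk_taboo_factor (Q : nat -> W -> \bar R) w :
  (forall n y, 0 <= Q n y) ->
  (forall y, y != [::] -> Q 0%N (w ++ y) = 0) ->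
  (forall n y, y != [::] -> Q n.+1 (w ++ y) = pred_sum (Q n) (w ++ y)) ->
  forall n y, Q n (w ++ y) = econv (Q ^~ w) (walk_taboo ^~ y) n.
Proof.
move=> Q0 Qz QS; elim=> [|n IH] y.
  have [->|y0] := eqVneq y [::]; first by rewrite cats0 econv_walk_taboo_nil.
  by rewrite Qz// /econv big_ord_recl big_ord0 /= (negbTE y0) mule0 adde0.
have [->|y0] := eqVneq y [::]; first by rewrite cats0 econv_walk_taboo_nil.
rewrite QS// pred_sum_cat// (eq_pred_sum _ IH) /econv.
rewrite (pred_sum_lin (c := fun j : 'I_n.+1 => Q j w) (F := fun (j : 'I_n.+1) y => walk_taboo (n - j) y))//.
rewrite [RHS]big_ord_recr /= subnn /= (negbTE y0) mule0 adde0.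
by apply: eq_bigr => j _; rewrite (subSn (leq_ord j)) /= (negbTE y0).
Qed.

Lemma walk_cat n w y : walk n (w ++ y) = econv (walk ^~ w) (walk_taboo ^~ y) n.
Proof.
apply: walk_taboo_factor => // y' y0 /=.
by case: w => [|a w] //=; rewrite (negbTE y0).
Qed.

Lemma walk_taboo_cat n w y : walk_taboo n (w ++ y) = econv (walk_taboo ^~ w) (walk_taboo ^~ y) n.
Proof.
have nn y' : y' != [::] -> (w ++ y' == [::]) = false.
  by case: w y' => [|a w] [].
by apply: walk_taboo_factor => [//|y' /nn|m y' /nn] /= ->.
Qed.

Definition green_gf z x := egf (walk ^~ x) z.
Definition last_gf z x := egf (walk_taboo ^~ x) z.

Lemma green_gf_ge0 z x : (0 <= z)%R -> 0 <= green_gf z x.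
Proof. by move=> z0; apply: egf_ge0 => // n; exact: walk_ge0. Qed.
Lemma last_gf_ge0 z x : (0 <= z)%R -> 0 <= last_gf z x.
Proof. by move=> z0; apply: egf_ge0 => // n; exact: walk_taboo_ge0. Qed.

Lemma green_gf_cat z w y : (0 <= z)%R -> green_gf z (w ++ y) = green_gf z w * last_gf z y.
Proof.
move=> z0; rewrite -egf_econv//; apply: eq_egf => n; exact: walk_cat.
Qed.

Lemma last_gf_cat z w y : (0 <= z)%R -> last_gf z (w ++ y) = last_gf z w * last_gf z y.
Proof.
move=> z0; rewrite -egf_econv//; apply: eq_egf => n; exact: walk_taboo_cat.
Qed.

Lemma last_gf_nil z : last_gf z [::] = 1.
Proof.
rewrite /last_gf /egf (@sum_delta _ _ 0%N)/= ?mule1 ?lee_fin//.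
by case=> // n _; rewrite /= mul0e.
Qed.

Lemma egf_pred_sum (F : nat -> W -> \bar R) x z : (forall n y, 0 <= F n y) ->
  (0 <= z)%R ->
  egf (fun n => pred_sum (F n) x) z = pred_sum (fun y => egf (F ^~ y) z) x.
Proof.
move=> F0 z0; rewrite egf_big//; last first.
  by move=> k n; rewrite mule_ge0// sum_ge0// => u; rewrite mule_ge0.
apply: eq_bigr => k _; rewrite egfZ//; last first.
  by move=> n; rewrite sum_ge0// => u; rewrite mule_ge0.
congr (_ * _); rewrite egf_sum//; last by move=> u n; rewrite mule_ge0.
by apply: eq_sum => u; rewrite egfZr.
Qed.

Lemma green_gf_nil z : (0 <= z)%R -> green_gf z [::] = 1 + z%:E * pred_sum (green_gf z) [::].
Proof.
by move=> z0; rewrite /green_gf egfS//= egf_pred_sum.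
Qed.

Definition letter i (v : V i) : W := word_app o [::] v.

(* Coefficients of the first return through [V k], shifted by one. *)
Definition ret k n := (alpha k)%:E * \Sum_(u) (walk_taboo n (letter u) * (p u (o k))%:E).

(** The factor [z] undoes the shift of [ret]. *)
Definition return_gf k z := z%:E * egf (ret k) z.

Lemma ret_ge0 k n : 0 <= ret k n.
Proof. by rewrite mule_ge0// sum_ge0// => u; rewrite mule_ge0. Qed.
Local Hint Resolve ret_ge0 : core.

Lemma return_gf_ge0 k z : (0 <= z)%R -> 0 <= return_gf k z.
Proof. by move=> z0; rewrite mule_ge0// egf_ge0. Qed.

Lemma return_gf_letter k z : (0 <= z)%R -> return_gf k z =
  z%:E * ((alpha k)%:E * \Sum_(u) (last_gf z (letter u) * (p u (o k))%:E)).
Proof.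
move=> z0; rewrite /return_gf egfZ//; last by move=> n; rewrite sum_ge0// => u; rewrite mule_ge0.
rewrite egf_sum//; last by move=> u n; rewrite mule_ge0.
by congr (_ * (_ * _)); apply: eq_sum => u; rewrite egfZr.
Qed.

Lemma word_stem_nil k : word_stem k [::] = [::] :> W.
Proof. by []. Qed.

Lemma word_coord_nil k : word_coord o k [::] = o k.
Proof. by []. Qed.

Lemma letter_cat w i (v : V i) : word_app o w v = w ++ letter v.
Proof. by rewrite -{1}[w]cats0 word_app_cat. Qed.

Lemma letterE i (v : V i) : v != o i -> letter v = [:: Tagged (fun i => V i : Type) v].
Proof. by move=> vo; rewrite /letter /word_app (negbTE vo). Qed.

Lemma letter_o i : letter (o i) = [::].
Proof. by rewrite /letter /word_app eqxx. Qed.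

(** The last step into the empty word comes from a one-letter word [letter u], or from the empty
    word itself, and [green_gf_cat] splits off the factor [green_gf z [::]]. *)
Lemma green_gf_renewal z : (0 <= z)%R ->
  green_gf z [::] = 1 + green_gf z [::] * \sum_(k < N) return_gf k z.
Proof.
move=> z0; rewrite {1}green_gf_nil//; congr (_ + _).
rewrite [RHS]ge0_sume_distrr; last by move=> k _; exact: return_gf_ge0.
rewrite /pred_sum ge0_sume_distrr; last first.
  by move=> k _; rewrite mule_ge0// sum_ge0// => u; rewrite mule_ge0// green_gf_ge0.
apply: eq_bigr => k _; rewrite return_gf_letter// [RHS]muleCA; congr (_ * _).
rewrite [RHS]muleCA; congr (_ * _); rewrite -sumZl ?green_gf_ge0//; last first.
  by move=> u; rewrite mule_ge0// last_gf_ge0.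
by apply: eq_sum => u; rewrite word_stem_nil word_coord_nil letter_cat green_gf_cat// muleA.
Qed.

Section Letter.
Variables (i : 'I_N) (v : V i).
Hypothesis vo : v != o i.

Lemma pred_sum_letter (f : W -> \bar R) : pred_sum f (letter v) =
  (alpha i)%:E * \Sum_(u : V i) (f (letter u) * (p u v)%:E) +
  \sum_(k < N | k != i) ((alpha k)%:E *
    \Sum_(u : V k) (f (letter v ++ letter u) * (p u (o k))%:E)).
Proof.
rewrite /pred_sum (bigD1 i)//=; congr (_ + _).
  congr (_ * _); apply: eq_sum => u.
  by rewrite word_stem_app// word_coord_app.
apply: eq_bigr => k ki; congr (_ * _); apply: eq_sum => u.
have tk : word_type (letter v) != Some k.
  by rewrite letterE// /word_type /= (inj_eq Some_inj) eq_sym.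
have e : word_app o (letter v) (o k) = letter v by rewrite /word_app eqxx.
by rewrite -{1}e word_stem_app// -{2}e word_coord_app// letter_cat.
Qed.

(** The last step is either made inside [V i] or ends an excursion into another factor;
    [walk_taboo_cat] separates such an excursion from the visit to [letter v] at which it began. *)
Lemma walk_taboo_letterS n : walk_taboo n.+1 (letter v) =
  (alpha i)%:E * \Sum_(u : V i) (walk_taboo n (letter u) * (p u v)%:E) +
  econv (walk_taboo ^~ (letter v)) (fun m => \sum_(k < N | k != i) ret k m) n.
Proof.
rewrite /= ifF; last by rewrite letterE.
rewrite pred_sum_letter; congr (_ + _).
rewrite /econv.
under [RHS]eq_bigr => j _.
  rewrite ge0_sume_distrr; last by move=> k _; exact: ret_ge0.
  over.
rewrite exchange_big /=; apply: eq_bigr => k _.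
under [RHS]eq_bigr do rewrite muleCA.
rewrite -ge0_sume_distrr; last first.
  by move=> j _; rewrite mule_ge0// sum_ge0// => u; rewrite mule_ge0.
congr (_ * _); under [RHS]eq_bigr => j _.
  rewrite -sumZl//; last by move=> u; rewrite mule_ge0.
  over.
rewrite -sum_big; last by move=> j u; rewrite !mule_ge0.
apply: eq_sum => u; rewrite walk_taboo_cat /econv ge0_sume_distrl; last first.
  by move=> j _; rewrite mule_ge0.
by apply: eq_bigr => j _; rewrite muleA.
Qed.

Lemma last_gf_letter z : (0 <= z)%R -> last_gf z (letter v) =
  z%:E * ((alpha i)%:E * \Sum_(u : V i) (last_gf z (letter u) * (p u v)%:E)) +
  last_gf z (letter v) * \sum_(k < N | k != i) return_gf k z.
Proof.
move=> z0; have lv0 : (letter v == [::]) = false by rewrite letterE.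
have e0 m : 0 <= \sum_(k < N | k != i) ret k m by apply: sume_ge0.
have s0 m : 0 <= \Sum_(u : V i) (walk_taboo m (letter u) * (p u v)%:E).
  by apply: sum_ge0 => u; rewrite mule_ge0.
have L0 := last_gf_ge0 (letter v) z0.
have Hs0 : 0 <= egf (fun m => \sum_(k < N | k != i) ret k m) z.
  by apply: egf_ge0.
rewrite {1}/last_gf egfS// [walk_taboo 0 _]/= lv0 add0e (eq_egf _ walk_taboo_letterS) egfD//; first last.
- by move=> n; apply: econv_ge0.
- by move=> n; rewrite mule_ge0.
rewrite ge0_muleDr; first last.
- by apply: egf_ge0 => // n; apply: econv_ge0.
- by apply: egf_ge0 => // n; rewrite mule_ge0.
congr (_ + _).
  rewrite egfZ// egf_sum//; last by move=> u n; rewrite mule_ge0.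
  by congr (_ * (_ * _)); apply: eq_sum => u; rewrite egfZr.
rewrite egf_econv// muleCA; congr (_ * _).
rewrite egf_big// ge0_sume_distrr// => k _.
exact: egf_ge0.
Qed.

End Letter.

Lemma econv_trunc (a b : nat -> \bar R) n : (forall n, 0 <= a n) ->
  (forall n, 0 <= b n) ->
  \sum_(m < n) econv a b m <= (\sum_(m < n) a m) * \Sum_(m) b m.
Proof.
(* Cutting [a] off at [n] does not change the coefficients below [n], which are then bounded by the
   full Cauchy product. *)
move=> an bn; pose a' m := if (m < n)%N then a m else 0.
have a'0 m : 0 <= a' m by rewrite /a'; case: ifP.
have -> : \sum_(m < n) econv a b m = \sum_(m < n) econv a' b m.
  apply: eq_bigr => m _; apply: eq_bigr => k _; rewrite /a' ifT//.
  by rewrite (leq_trans (ltn_ord k)).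
apply: (le_trans (sum_nat_ge n _)); first by move=> m; apply: econv_ge0.
rewrite sum_econv//; apply: lee_wpmul2r; first exact: sum_ge0.
apply: sum_nat_le => // m; rewrite /a' -big_mkcond/=.
rewrite -(big_mkord (fun j => j < n)%N a) -(big_mkord xpredT a).
have [mn|nm] := leqP m n.
  rewrite [leRHS](big_cat_nat (leq0n m) mn)/= [leLHS]big_nat_cond [X in _ <= X + _]big_nat_cond.
  rewrite (eq_bigl (fun j => (0 <= j < m)%N && true)).
    by rewrite leeDl// sume_ge0.
  by move=> j; rewrite andbT /=; case: ltnP => //= jm; rewrite (leq_trans jm).
rewrite [leLHS](big_cat_nat (leq0n n) (ltnW nm))/= [X in _ + X <= _]big1_seq; last first.
  by move=> j /andP[jn]; rewrite mem_index_iota leqNgt jn.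
by rewrite adde0 big_mkcond lee_sum// => j _; case: ifP.
Qed.

(* The letters of the free product seen from one factor: excursions into the
   other factors only change the parameter. *)
Lemma last_gf_last_visit_gf i z (h : R) : (0 <= z)%R ->
  \sum_(k < N | k != i) return_gf k z = h%:E -> (h < 1)%R -> forall v : V i,
  last_gf z (letter v) = last_visit_gf (@p i) (o i) v (alpha i * z / (1 - h)).
Proof.
move=> z0 hE h1 v; set t := (_ / _)%R.
have h0 : (0 <= h)%R by rewrite -lee_fin -hE sume_ge0// => k _; exact: return_gf_ge0.
have t_ge0 : (0 <= t)%R by rewrite divr_ge0 ?mulr_ge0 ?subr_ge0// ltW.
have taz : (t * (1 - h) = alpha i * z)%R by rewrite divfK// subr_eq0 gt_eqF.
have L0 (u : V i) : 0 <= last_gf z (letter u) by apply: last_gf_ge0.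
have LV0 (u : V i) : 0 <= last_visit_gf (@p i) (o i) u t by apply: last_visit_gf_ge0.
(* Both sides satisfy the same linear equation, which alone does not determine them; each inequality
   comes from the minimality of one side, the first from [last_visit_gf_min]. *)
apply/le_anti/andP; split; last first.
  move: v; apply: (last_visit_gf_min (hp i)) => [//|//||v vo]; first by rewrite letter_o last_gf_nil lexx.
  have := last_gf_letter vo z0; rewrite hE.
  set A := \Sum_(u) _; have A0 : 0 <= A by apply: sum_ge0 => u; rewrite mule_ge0.
  have := L0 v; case: (last_gf z (letter v)) => // [l|]; last by move=> *; rewrite leey.
  (* For a finite value [l] an infinite [A] is compatible with the equation only if [z], hence [t],
     is 0. *)
  rewrite lee_fin => l0; case: A A0 => // [a|] A0; last first.
    rewrite gt0_muley ?lte_fin// muleC.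
    have [zz _|zn] := eqVneq z 0%R.
      by rewrite (_ : t = 0%R) ?mul0e ?lee_fin// /t zz mulr0 mul0r.
    by rewrite gt0_mulye ?lte_fin ?lt0r ?zn.
  rewrite -!EFinM -EFinD => -[e]; rewrite lee_fin.
  have -> // : (t * a = l)%R.
  apply: (@mulIf _ (1 - h)%R); first by rewrite subr_eq0 gt_eqF.
  by rewrite mulrAC taz; move: e; lra.
(* Conversely the partial sums of [last_gf] are bounded by induction on their length. *)
apply: sum_nat_le => [n|n]; first by rewrite mule_ge0// lee_fin exprn_ge0.
have zz m w : 0 <= walk_taboo m w * (z ^+ m)%:E by rewrite mule_ge0// lee_fin exprn_ge0.
elim: n v => [|n IH] v; first by rewrite big_ord0.
rewrite big_ord_recl /= expr0 mule1; have [->|vo] := eqVneq v (o i).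
  by rewrite last_visit_gf_root// letter_o big1 ?adde0 => [|j _] /=; rewrite ?mul0e.
rewrite letterE// [_ == _]/= add0e -letterE//.
have s0 m : 0 <= \Sum_(u : V i) (walk_taboo m (letter u) * (p u v)%:E).
  by apply: sum_ge0 => u; rewrite mule_ge0.
have r0 m : 0 <= \sum_(k < N | k != i) ret k m by apply: sume_ge0.
have rz m : 0 <= (\sum_(k < N | k != i) ret k m) * (z ^+ m)%:E.
  by rewrite mule_ge0// lee_fin exprn_ge0.
rewrite (eq_bigr (fun m : 'I_n =>
   z%:E * ((alpha i)%:E * \Sum_(u : V i) ((walk_taboo m (letter u) * (z ^+ m)%:E) * (p u v)%:E)) +
   z%:E * (econv (fun m => walk_taboo m (letter v) * (z ^+ m)%:E)
     (fun m => (\sum_(k < N | k != i) ret k m) * (z ^+ m)%:E) m))); last first.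
  move=> m _; have := walk_taboo_letterS vo m; rewrite letterE//= => ->.
  rewrite -letterE// exprS EFinM muleCA ge0_muleDl ?mule_ge0//; last first.
    by apply: econv_ge0.
  rewrite -econv_Z// ge0_muleDr; first last.
  - by rewrite mule_ge0// ?econv_ge0// lee_fin exprn_ge0.
  - by rewrite !mule_ge0// lee_fin exprn_ge0.
  congr (_ * _ + _); rewrite -muleA; congr (_ * _).
  rewrite -sumZr ?lee_fin ?exprn_ge0// => [|u]; last by rewrite mule_ge0.
  by apply: eq_sum => u; rewrite muleAC.
rewrite big_split/=.
(* The equation of [last_visit_gf] in the shape of [last_gf_letter]: a share [h] of the value is set
   apart for the excursions, and [t * (1 - h) = alpha i * z] rewrites the rest. *)
have tl : (last_visit_gf (@p i) (o i) v t) =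
    z%:E * ((alpha i)%:E * \Sum_(u : V i) (last_visit_gf (@p i) (o i) u t * (p u v)%:E)) +
    last_visit_gf (@p i) (o i) v t * h%:E.
  set l := last_visit_gf _ _ v t; set B := \Sum_(u) _.
  have lE : l = t%:E * B by rewrite /l last_visit_gf_eq.
  rewrite {1}(_ : l = ((1 - h)%:E + h%:E) * l); last by rewrite -EFinD subrK mul1e.
  rewrite ge0_muleDl ?lee_fin ?subr_ge0 ?(ltW h1)// (muleC h%:E); congr (_ + _).
  by rewrite lE !muleA -!EFinM (mulrC _ t) taz (mulrC z).
rewrite tl; apply: leeD.
  rewrite -ge0_sume_distrr => [|m _]; last first.
    by rewrite mule_ge0// sum_ge0// => u; rewrite mule_ge0.
  apply: lee_wpmul2l => //; rewrite -ge0_sume_distrr => [|m _]; last first.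
    by rewrite sum_ge0// => u; rewrite mule_ge0.
  apply: lee_wpmul2l => //; rewrite -sum_big; last by move=> m u; rewrite mule_ge0.
  apply: le_sum => u; rewrite -ge0_sume_distrl//.
  by apply: lee_wpmul2r.
rewrite -ge0_sume_distrr => [|m _]; last by apply: econv_ge0.
apply: (@le_trans _ _ (z%:E * ((\sum_(m < n) (walk_taboo m (letter v) * (z ^+ m)%:E)) *
   egf (fun m => \sum_(k < N | k != i) ret k m) z))).
  by apply: lee_wpmul2l => //; apply: econv_trunc.
rewrite muleCA; apply: lee_pmul; rewrite ?mule_ge0 ?sume_ge0 ?egf_ge0//.
rewrite -hE /return_gf egf_big// ge0_sume_distrr// => k _.
exact: egf_ge0.
Qed.

End Words.

(** * Markov chains *)

Section Markov.
Context {R : realType} (d : measure_display) (Omega : measurableType d).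
Context (Pr : probability Omega R) (S : countType) (P : S -> S -> R) (x0 : S).
Context (X : nat -> Omega -> S).
Hypothesis hX : markov_chain Pr P x0 X.
Hypothesis hP : stochastic P.
Local Open Scope ereal_scope.

Let mX n x : measurable [set w | X n w = x]. Proof. by case: hX. Qed.

(** The partition of [A] by the value of [X n], enumerated by [nat] through [pickle] for countable
    additivity; codes of no state give the empty set. *)
Let slice n (A : set Omega) (k : nat) : set Omega :=
  if pickle_inv k is Some x then A `&` [set w | X n w = x] else set0.

Let slice_bigcup n A : \bigcup_k slice n A k = A.
Proof.
apply/seteqP; split => [w [k _]|w Aw].
  by rewrite /slice; case: pickle_inv => // x [].
by exists (pickle (X n w)) => //; rewrite /slice pickleK_inv.
Qed.

Let slice_measurable n A k : measurable A -> measurable (slice n A k).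
Proof. by move=> mA; rewrite /slice; case: pickle_inv => // x; apply: measurableI. Qed.

Let slice_trivIset n A : trivIset setT (slice n A).
Proof.
move=> j k _ _ [w []]; rewrite /slice.
have := @pickle_invK S j; have := @pickle_invK S k.
case: (pickle_inv j) => // x; case: (pickle_inv k) => // y /= <- <-.
by move=> [_ /= ->] [_ /= ->].
Qed.

Let sum_slice n A (F : set Omega -> \bar R) : F set0 = 0 ->
  (forall B, 0 <= F B) ->
  \sum_(k <oo) F (slice n A k) = \Sum_(x) F (A `&` [set w | X n w = x]).
Proof.
move=> F0 Fge0; rewrite -sum_natE// (@sum_inj _ _ _ (@pickle S)).
- by apply: eq_sum => x; rewrite /slice pickleK_inv.
- exact: pcan_inj pickleK_inv.
- move=> k kx; rewrite /slice; have := @pickle_invK S k.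
  by case: (pickle_inv k) => // x /= xk; case: (kx x).
Qed.

Lemma Pr_partition n A : measurable A ->
  Pr A = \Sum_(x) Pr (A `&` [set w | X n w = x]).
Proof.
move=> mA; rewrite -{1}(slice_bigcup n A) measure_semi_bigcup.
- by rewrite (sum_slice n A).
- by move=> k; apply: slice_measurable.
- exact: slice_trivIset.
- by rewrite slice_bigcup.
Qed.

Lemma measurable_preX n (B : set S) : measurable [set w | B (X n w)].
Proof.
rewrite -(slice_bigcup n [set w | B (X n w)]); apply: bigcup_measurable => k _.
rewrite /slice; case: pickle_inv => // x.
have [Bx|nBx] := pselect (B x).
  rewrite (_ : _ `&` _ = [set w | X n w = x])//.
  by apply/seteqP; split => [w [_]//|w /= e]; split => //=; rewrite e.
rewrite (_ : _ `&` _ = set0)//.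
by apply/seteqP; split => [w /= [b e]|//]; apply: nBx; rewrite -e.
Qed.

Lemma expectation_X n (f : S -> R) : (forall x, 0 <= f x)%R ->
  'E_Pr[(fun w => f (X n w))] =
  \Sum_(x) (Pr [set w | X n w = x] * (f x)%:E).
Proof.
move=> f0; rewrite unlock.
rewrite -(slice_bigcup n setT) ge0_integral_bigcup; first last.
- exact: slice_trivIset.
- by move=> w _; rewrite lee_fin.
- rewrite slice_bigcup; apply/measurable_EFinP => _ B mB; rewrite setTI.
  exact: (measurable_preX n [set x | B (f x)]).
- by move=> k; apply: slice_measurable.
pose F (B : set Omega) := \int[Pr]_(w in B) (f (X n w))%:E.
rewrite -/F (sum_slice n setT (F := F)).
- apply: eq_sum => x; rewrite setTI /F muleC -(integral_cst Pr (mX n x) (f x)%:E).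
  by apply: eq_integral => w; rewrite inE /= => ->.
- by rewrite /F integral_set0.
- by move=> B; apply: integral_ge0 => w _; rewrite lee_fin.
Qed.

Lemma Pr_X0 x : Pr [set w | X 0%N w = x] = (x == x0)%:R%:E.
Proof.
have h1 : Pr [set w | X 0%N w = x0] = 1 by case: hX.
have [->//|xx0] := eqVneq x x0; apply/eqP; rewrite eq_le measure_ge0 andbT.
rewrite [leRHS](_ : _ = Pr (~` [set w | X 0%N w = x0])); last first.
  by rewrite probability_setC// h1 subee.
apply: le_measure; rewrite ?inE//; first exact: measurableC.
by move=> w /= -> /eqP; rewrite (negbTE xx0).
Qed.

(** The constraint depends on time so as to express both a condition on the first step and a return
    imposed at the last one. *)
Definition Ev (D : nat -> set S) n : set Omega :=
  [set w | forall m, (0 < m <= n)%N -> D m (X m w)].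

Lemma measurable_forall (A : nat -> set Omega) : (forall m, measurable (A m)) ->
  measurable [set w | forall m, A m w].
Proof.
move=> mA; have := bigcapT_measurable mA; congr measurable.
by apply/seteqP; split => w Aw; [move=> m; apply: Aw|move=> m _; apply: Aw].
Qed.

Lemma measurable_Ev D n : measurable (Ev D n).
Proof.
apply: (@measurable_forall (fun m => [set w | (0 < m <= n)%N -> D m (X m w)])) => m.
case: (0 < m <= n)%N; first last.
  by rewrite (_ : mkset _ = setT)//; apply/seteqP; split.
rewrite (_ : mkset _ = [set w | D m (X m w)]); first exact: measurable_preX.
by apply/seteqP; split => w /=; [apply|move=> + _].
Qed.

Let Cyl j n (x : nat -> S) : set Omega :=
  [set w | forall k, (j <= k <= n)%N -> X k w = x k].

Let measurable_Cyl j n x : measurable (Cyl j n x).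
Proof.
apply: (@measurable_forall (fun k => [set w | (j <= k <= n)%N -> X k w = x k])) => k.
case: (j <= k <= n)%N; first last.
  by rewrite (_ : mkset _ = setT)//; apply/seteqP; split.
rewrite (_ : mkset _ = [set w | X k w = x k]); first exact: mX.
by apply/seteqP; split => w /=; [apply|move=> + _].
Qed.

(** For [j = 0] this is the definition of the chain. A constraint at time [j.+1] is decided by the
    prescribed value there, and partitioning by the value at time [j] extends the cylinder one step
    downwards. *)
Lemma Markov_property D j n (x : nat -> S) : (j <= n)%N ->
  Pr (Ev D j `&` Cyl j n.+1 x) =
  Pr (Ev D j `&` Cyl j n x) * (P (x n) (x n.+1))%:E.
Proof.
elim: j x => [|j IH] x jn.
  have e : Ev D 0 = setT by apply/seteqP; split => // w _ [|m].
  by rewrite e !setTI /Cyl; case: hX => _ _ /(_ n x).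
have [Dx|nDx] := pselect (D j.+1 (x j.+1)); last first.
  have e m : (j < m)%N -> Ev D j.+1 `&` Cyl j.+1 m x = set0.
    move=> jm; apply/seteqP; split => // w [Ew Cw]; apply: nDx.
    by rewrite -(Cw j.+1) ?leqnn//; apply: Ew; rewrite /= leqnn.
  by rewrite !e ?measure0 ?mul0e// (leq_trans jn).
have e m : (j < m)%N -> Pr (Ev D j.+1 `&` Cyl j.+1 m x) =
    \Sum_(y) Pr (Ev D j `&` Cyl j m (fun k => if k == j then y else x k)).
  move=> jm; rewrite (Pr_partition j); last first.
    by apply: measurableI; [exact: measurable_Ev|exact: measurable_Cyl].
  apply: eq_sum => y; congr (Pr _); apply/seteqP; split => w /=.
    move=> [[Ew Cw] Xj]; split.
      by move=> k /andP[k0 kj]; apply: Ew; rewrite k0 (leq_trans kj).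
    move=> k /andP[jk km]; case: eqVneq => [->//|kj].
    by apply: Cw; rewrite km andbT ltn_neqAle eq_sym kj.
  move=> [Ew Cw]; split; last first.
    by have := Cw j; rewrite leqnn (ltnW jm) eqxx; apply.
  have Cw' : Cyl j.+1 m x w.
    move=> k /andP[jk km]; have := Cw k; rewrite (ltnW jk) km gtn_eqF//; apply.
    by [].
  split => // k /andP[k0]; rewrite leq_eqVlt => /orP[/eqP ->|kj].
    by rewrite Cw'// leqnn.
  by apply: Ew; rewrite k0 -ltnS.
rewrite !e ?(leq_trans jn)// -sumZr//; last by rewrite lee_fin hP.1.
apply: eq_sum => y; rewrite (IH _ (ltnW jn)).
by rewrite (gtn_eqF jn) (gtn_eqF (leqW jn)).
Qed.

Lemma Ev0 D y : Pr (Ev D 0 `&` [set w | X 0%N w = y]) = (y == x0)%:R%:E.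
Proof. by rewrite -Pr_X0; congr (Pr _); apply/seteqP; split => [w []//|w ?]; split => // -[]. Qed.

Lemma EvS D n y : Pr (Ev D n.+1 `&` [set w | X n.+1 w = y]) =
  if `[< D n.+1 y >] then
    \Sum_(z) (Pr (Ev D n `&` [set w | X n w = z]) * (P z y)%:E)
  else 0.
Proof.
case: asboolP => [Dy|nDy]; last first.
  rewrite (_ : _ `&` _ = set0) ?measure0//; apply/seteqP; split => // w [/(_ n.+1)].
  by rewrite /= leqnn => /(_ isT) + e; rewrite e.
rewrite (Pr_partition n); last first.
  by apply: measurableI; [exact: measurable_Ev|].
apply: eq_sum => z.
have := @Markov_property D n n (fun k => if k == n then z else y) (leqnn n).
rewrite eqxx gtn_eqF// => e.
transitivity (Pr (Ev D n `&` Cyl n n.+1 (fun k => if k == n then z else y))).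
  congr (Pr _); apply/seteqP; split => w /=.
    move=> [[Ew Xy] Xz]; split; first by move=> k /andP[k0 kn]; apply: Ew; rewrite k0 ltnW.
    move=> k; rewrite [(k <= _)%N]leq_eqVlt ltnS => /andP[nk /orP[/eqP ->|kn]].
      by rewrite gtn_eqF.
    by have -> : k = n; [apply/eqP; rewrite eqn_leq kn|rewrite eqxx].
  move=> [Ew Cw]; have Xy : X n.+1 w = y.
    by have := Cw n.+1; rewrite leqnn leqnSn gtn_eqF//; apply.
  split; last by have := Cw n; rewrite leqnn leqnSn eqxx; apply.
  split => // k /andP[k0]; rewrite leq_eqVlt ltnS => /orP[/eqP ->|kn]; first by rewrite Xy.
  by apply: Ew; rewrite k0.
rewrite e; congr (Pr _ * _); apply/seteqP; split => w [Ew Cw]; split => //.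
  by have := Cw n; rewrite leqnn eqxx; apply.
move=> k /andP[nk kn]; have -> : k = n by apply/eqP; rewrite eqn_leq kn.
by rewrite eqxx.
Qed.

Lemma Pr_XS n y : Pr [set w | X n.+1 w = y] =
  \Sum_(z) (Pr [set w | X n w = z] * (P z y)%:E).
Proof.
have e m : Ev (fun=> setT) m = setT by apply/seteqP; split.
have := EvS (fun=> setT) n y; rewrite e setTI asboolT// => ->.
by apply: eq_sum => z; rewrite e setTI.
Qed.

End Markov.

(** * The walk on the free product *)

Section FreeProduct.
Context {R : realType} {N : nat} {V : 'I_N -> countType} (o : forall i, V i).
Context (p : forall i, V i -> V i -> R) (alpha : 'I_N -> R).
Hypothesis hp : forall i, stochastic (@p i).
Hypothesis ha : forall i, 0 < alpha i.
Hypothesis ha1 : \sum_(i < N) alpha i = 1.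
Local Open Scope ereal_scope.
Local Notation W := (seq {i : 'I_N & V i}).
Local Notation FP := (free_product o).
Local Notation P := (@fp_trans R N V o p alpha).
Local Notation walk := (walk o p alpha).
Local Notation walk_taboo := (walk_taboo o p alpha).
Implicit Types (x y s : FP) (i k : 'I_N).

Let p0 i (x y : V i) : 0 <= (p x y)%:E. Proof. exact: kernel_ge0. Qed.
Let a0 i : 0 <= (alpha i)%:E. Proof. by rewrite lee_fin ltW. Qed.
Let pw0 n (x : W) : 0 <= walk n x. Proof. exact: walk_ge0. Qed.
Let tw0 n (x : W) : 0 <= walk_taboo n x. Proof. exact: walk_taboo_ge0. Qed.
Local Hint Resolve p0 a0 pw0 tw0 : core.

Lemma fp_app_inj s s' i (v v' : V i) : fp_type s != Some i ->
  fp_type s' != Some i -> fp_app s v = fp_app s' v' -> s = s' /\ v = v'.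
Proof.
move=> si s'i /(congr1 (@fp_word _ _ _)); rewrite !fp_word_app// => e; split.
  apply: fp_word_inj; rewrite -(word_stem_app o v si) -(word_stem_app o v' s'i).
  by rewrite e.
by rewrite -(word_coord_app o v si) -(word_coord_app o v' s'i) e.
Qed.

Lemma sum_fp i (f : FP -> \bar R) : (forall x, 0 <= f x) ->
  \Sum_(y : FP) f y = \Sum_(s : FP)
    (if fp_type s != Some i then \Sum_(v : V i) f (fp_app s v) else 0).
Proof.
move=> f0; pose I := [set s : FP | fp_type s != Some i].
rewrite (@reindex_esum _ _ _ (I `*`` (fun=> [set: V i])) setT
  (fun sv => fp_app sv.1 sv.2)).
  rewrite -(@esum_esum _ _ _ I (fun=> setT) (fun s v => f (fp_app s v)))// esum_mkcond.
  apply: eq_sum => s; case: ifPn => [|/negP sI]; first by rewrite inE /I /= => ->.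
  by rewrite ifF//; apply: contra_notF sI => sI; rewrite inE.
split=> //.
  move=> [s v] [s' v']; rewrite !inE /= => -[si _] [s'i _] e.
  by have [-> ->] := fp_app_inj si s'i e.
by move=> y _; have [s [v [si -> _]]] := fp_decomp y i; exists (s, v).
Qed.

Lemma sum_copy k s (g : FP -> \bar R) : fp_type s != Some k ->
  (forall y, word_stem k (fp_word y) != fp_word s -> g y = 0) ->
  \Sum_(y : FP) g y = \Sum_(u : V k) g (fp_app s u).
Proof.
move=> sk g0; apply: sum_inj => [u u' e|y yu].
  by have [] := fp_app_inj sk sk e.
apply: g0; apply/negP => /eqP e.
have [s' [v [s'k yE s'E]]] := fp_decomp y k; apply: (yu v); rewrite yE.
by have -> : s = s' by apply: fp_word_inj; rewrite s'E.
Qed.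

Lemma fp_lift_ge0 i x y : (0 <= fp_lift p i x y)%R.
Proof. by rewrite /fp_lift; case: ifP => // _; apply: (hp i).1. Qed.

Let l0 i x y : 0 <= (fp_lift p i x y)%:E.
Proof. by rewrite lee_fin fp_lift_ge0. Qed.
Local Hint Resolve l0 : core.

Lemma fp_transE x y :
  (P x y)%:E = \sum_(k < N) ((alpha k)%:E * (fp_lift p k x y)%:E).
Proof. by rewrite /fp_trans -sumEFin; apply: eq_bigr => k _; rewrite EFinM. Qed.

Lemma fp_trans_ge0 x y : 0 <= (P x y)%:E.
Proof. by rewrite fp_transE sume_ge0// => k _; rewrite mule_ge0. Qed.
Local Hint Resolve fp_trans_ge0 : core.

(** Only the copy of [V k] through [x] contributes to the [k]-th part of the kernel, and on that
    copy the kernel is [p k]. *)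
Lemma fp_pred (F : W -> \bar R) x : (forall w, 0 <= F w) ->
  \Sum_(y : FP) (F (fp_word y) * (P y x)%:E) = pred_sum o p alpha F (fp_word x).
Proof.
move=> F0; transitivity (\Sum_(y : FP) \sum_(k < N)
    ((alpha k)%:E * (F (fp_word y) * (fp_lift p k y x)%:E))).
  apply: eq_sum => y; rewrite fp_transE ge0_sume_distrr => [|k _]; last by rewrite mule_ge0.
  by apply: eq_bigr => k _; rewrite muleCA.
rewrite sum_big => [|k y]; last by rewrite !mule_ge0.
apply: eq_bigr => k _; rewrite sumZl// => [|y]; last by rewrite mule_ge0.
congr (_ * _); have [s [v [sk -> sE]]] := fp_decomp x k.
rewrite (sum_copy sk) => [|y ys]; last first.
  rewrite /fp_lift !fp_word_app// word_stem_app// (negbTE ys).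
  by rewrite mule0.
apply: eq_sum => u; rewrite fp_lift_app// !fp_word_app//.
by rewrite word_stem_app// word_coord_app.
Qed.

Lemma fp_succ (F : W -> \bar R) x : (forall w, 0 <= F w) ->
  \Sum_(y : FP) ((P x y)%:E * F (fp_word y)) = \sum_(k < N) ((alpha k)%:E *
    \Sum_(u : V k) ((p (word_coord o k (fp_word x)) u)%:E *
      F (word_app o (word_stem k (fp_word x)) u))).
Proof.
move=> F0; transitivity (\Sum_(y : FP) \sum_(k < N)
    ((alpha k)%:E * ((fp_lift p k x y)%:E * F (fp_word y)))).
  apply: eq_sum => y; rewrite fp_transE ge0_sume_distrl => [|k _]; last by rewrite mule_ge0.
  by apply: eq_bigr => k _; rewrite muleA.
rewrite sum_big => [|k y]; last by rewrite !mule_ge0.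
apply: eq_bigr => k _; rewrite sumZl// => [|y]; last by rewrite mule_ge0.
congr (_ * _); have [s [v [sk -> sE]]] := fp_decomp x k.
rewrite (sum_copy sk) => [|y ys]; last first.
  rewrite /fp_lift !fp_word_app// word_stem_app// eq_sym (negbTE ys).
  by rewrite mul0e.
apply: eq_sum => u; rewrite fp_lift_app// !fp_word_app//.
by rewrite word_stem_app// word_coord_app.
Qed.

Lemma fp_trans_stochastic : stochastic P.
Proof.
split=> [x y|x]; first by rewrite -lee_fin.
transitivity (\Sum_(y : FP) ((P x y)%:E * 1)).
  by apply: eq_sum => y; rewrite mule1.
rewrite (fp_succ (F := fun=> 1))// -[RHS](congr1 EFin ha1) -sumEFin.
apply: eq_bigr => k _; rewrite -[RHS]mule1; congr (_ * _).
by rewrite sumZr// mule1 kernel_sum.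
Qed.

(** A step lengthens a word by at most one letter. This confines the law at time [n] to a ball, as
    needed for the upper bound of the entropy. *)
Lemma walk_neq0_size n (w : W) : walk n w != 0 -> (size w <= n)%N.
Proof.
elim: n w => [|n IH] w /=; first by case: w => //=; rewrite eqxx.
apply: contraR; rewrite -ltnNge => nw; apply/eqP; apply: big1 => k _.
rewrite sum0 ?mule0// => u.
have [->|/IH] := eqVneq (walk n (word_app o (word_stem k w) u)) 0; first by rewrite mul0e.
rewrite leqNgt => /negP[]; rewrite -ltnS; apply: leq_trans nw _.
have le1 : (size w <= (size (word_stem k w)).+1)%N.
  rewrite /word_stem; case: ifP => // _; rewrite size_take.
  by case: (size w) => //= m; rewrite ltnSn.
apply: leq_trans le1 _; rewrite ltnS /word_app; case: ifP => // _.
by rewrite size_rcons.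
Qed.

Lemma fp_word_eq0 x : (fp_word x == [::]) = (x == fp_root o).
Proof.
by apply/eqP/eqP => [e|->//]; apply: fp_word_inj; rewrite e.
Qed.

Section Chain.
Context (d : measure_display) (Omega : measurableType d) (Pr : probability Omega R).
Context (X : nat -> Omega -> FP).
Hypothesis hX : markov_chain Pr P (fp_root o) X.

Lemma law_walk n x : Pr [set w | X n w = x] = walk n (fp_word x).
Proof.
elim: n x => [|n IH] x.
  by rewrite (Pr_X0 hX) /= fp_word_eq0.
rewrite (Pr_XS hX fp_trans_stochastic) /= -fp_pred//.
by apply: eq_sum => y; rewrite IH.
Qed.

Lemma nstep_walk n x : (nstep P n (fp_root o) x)%:E = walk n (fp_word x).
Proof.
elim: n x => [|n IH] x.
  by rewrite nstep0E /= fp_word_eq0 eq_sym.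
rewrite (nstep_lastE fp_trans_stochastic) /= -fp_pred//.
by apply: eq_sum => y; rewrite IH.
Qed.

End Chain.
End FreeProduct.

(** * First returns to the empty word and the functions [Hbar] *)

Section Returns.
Context {R : realType} {N : nat} {V : 'I_N -> countType} (o : forall i, V i).
Context (p : forall i, V i -> V i -> R) (alpha : 'I_N -> R).
Hypothesis hp : forall i, stochastic (@p i).
Hypothesis hloop : forall i (x : V i), p x x = 0.
Hypothesis ha : forall i, 0 < alpha i.
Hypothesis ha1 : \sum_(i < N) alpha i = 1.
Local Open Scope ereal_scope.
Local Notation W := (seq {i : 'I_N & V i}).
Local Notation FP := (free_product o).
Local Notation P := (@fp_trans R N V o p alpha).
Local Notation walk := (walk o p alpha).
Local Notation walk_taboo := (walk_taboo o p alpha).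
Local Notation ret := (ret o p alpha).
Local Notation pred_sum := (pred_sum o p alpha).
Local Notation letter := (letter o).
Implicit Types (x y s : FP) (i k : 'I_N).

Let p0 i (x y : V i) : 0 <= (p x y)%:E. Proof. exact: kernel_ge0. Qed.
Let a0 i : 0 <= (alpha i)%:E. Proof. by rewrite lee_fin ltW. Qed.
Let pw0 n (x : W) : 0 <= walk n x. Proof. exact: walk_ge0. Qed.
Let tw0 n (x : W) : 0 <= walk_taboo n x. Proof. exact: walk_taboo_ge0. Qed.
Let P0 x y : 0 <= (P x y)%:E. Proof. exact: fp_trans_ge0. Qed.
Local Hint Resolve p0 a0 pw0 tw0 P0 : core.

Definition head_avoids i (w : W) := if w is a :: _ then tag a != i else true.

Lemma word_stem_eq0 k (w : W) : w != [::] -> word_stem k w = [::] ->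
  exists2 a, w = [:: a] & tag a = k.
Proof.
case/lastP: w => // w a _; rewrite /word_stem word_type_rcons (inj_eq Some_inj).
case: eqP => [<-|_]; last by case: w.
by rewrite size_rcons /= -cats1 take_size_cat// => ->; exists a.
Qed.

(* The type of the first letter cannot change before the walk is back at the
   empty word. *)
Lemma head_avoids_step i k (w : W) (u : V k) : w != [::] ->
  word_app o (word_stem k w) u != [::] ->
  head_avoids i (word_app o (word_stem k w) u) = head_avoids i w.
Proof.
move=> w0; case E : (word_stem k w) => [|b s].
  have [a -> ak] := word_stem_eq0 w0 E; rewrite /word_app.
  by case: ifP => //= _ _; rewrite ak.
have -> : head_avoids i w = (tag b != i).
  move: E; rewrite /word_stem; case: ifP => [_|_ ->//].
  by case: w w0 => // a w _; case: (size (a :: w)).-1 => //= m [->].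
by rewrite /word_app; case: ifP.
Qed.

Definition walk_taboo_avoid i n (w : W) := if head_avoids i w then walk_taboo n w else 0.

Lemma walk_taboo_avoid_ge0 i n w : 0 <= walk_taboo_avoid i n w.
Proof. by rewrite /walk_taboo_avoid; case: ifP. Qed.
Local Hint Resolve walk_taboo_avoid_ge0 : core.

(** Time 0 is excluded because the empty word avoids every index, yet the walk can enter [V i] from
    it. *)
Lemma walk_taboo_avoidS i n w : (0 < n)%N -> w != [::] ->
  pred_sum (walk_taboo_avoid i n) w = walk_taboo_avoid i n.+1 w.
Proof.
move=> n0 w0; rewrite {2}/walk_taboo_avoid /= (negbTE w0).
transitivity (pred_sum (fun y : W => if head_avoids i w then walk_taboo n y else 0) w).
  apply: eq_bigr => k _; congr (_ * _); apply: eq_sum => u; congr (_ * _).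
  rewrite /walk_taboo_avoid; have [->|an] := eqVneq (word_app o (word_stem k w) u) [::].
    by rewrite walk_taboo_nil gtn_eqF//; case: ifP.
  by rewrite head_avoids_step.
case: ifP => // _; apply: big1 => k _.
by rewrite sum0 ?mule0// => u; rewrite mul0e.
Qed.

Lemma walk_taboo_avoid_root i n : (0 < n)%N ->
  pred_sum (walk_taboo_avoid i n) [::] = \sum_(k < N | k != i) ret k n.
Proof.
move=> n0; rewrite [RHS]big_mkcond; apply: eq_bigr => k _.
rewrite word_stem_nil word_coord_nil.
have e (u : V k) : walk_taboo_avoid i n (letter u) = if k != i then walk_taboo n (letter u) else 0.
  rewrite /walk_taboo_avoid; have [->|uo] := eqVneq u (o k).
    by rewrite letter_o walk_taboo_nil gtn_eqF//=; case: (k == i).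
  by rewrite letterE.
case: ifP e => ki e.
  by congr (_ * _); apply: eq_sum => u; rewrite -[word_app _ _ _]/(letter u) e.
by rewrite sum0 ?mule0// => u; rewrite -[word_app _ _ _]/(letter u) e mul0e.
Qed.

Lemma ret0 k : ret k 0 = 0.
Proof.
rewrite /ret sum0 ?mule0// => u; have [->|uo] := eqVneq u (o k).
  by rewrite hloop mule0.
by rewrite /= letterE// mul0e.
Qed.

Lemma mass1 i : \Sum_(x : FP) (if x == fp_root o then 0 else walk_taboo_avoid i 1 (fp_word x)) =
  (1 - alpha i)%:E.
Proof.
transitivity (\Sum_(x : FP) ((P (fp_root o) x)%:E *
   (if (fp_word x != [::]) && head_avoids i (fp_word x) then 1 else 0))).
  apply: eq_sum => x; rewrite -fp_word_eq0 /walk_taboo_avoid /=.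
  have [->|x0] := eqVneq; first by rewrite mule0.
  case: ifP => _; last by rewrite mule0.
  rewrite -fp_pred//; rewrite mule1 (@sum_delta _ _ (fp_root o)) ?mul1e//.
  by move=> y yo; rewrite /= fp_word_eq0 (negbTE yo) mul0e.
rewrite (fp_succ hp ha (F := fun w => if (w != [::]) && head_avoids i w then 1 else 0));
  last by move=> w; case: ifP.
rewrite (bigD1 i)//= sum0 ?mule0 ?add0e; last first.
  move=> u; rewrite -[word_app _ _ _]/(letter u); have [->|uo] := eqVneq u (o i).
    by rewrite letter_o mule0.
  by rewrite letterE//= eqxx mule0.
have -> : (1 - alpha i = \sum_(k < N | k != i) alpha k)%R.
  by rewrite -ha1 (bigD1 i)//= addrAC subrr add0r.
rewrite -sumEFin; apply: eq_bigr => k ki.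
rewrite -[RHS]mule1; congr (_ * _); rewrite -[RHS](kernel_sum (hp k) (o k)).
apply: eq_sum => u; rewrite -[word_app _ _ _]/(letter u).
have [->|uo] := eqVneq u (o k); first by rewrite letter_o mule0 hloop.
by rewrite letterE//= ki mule1.
Qed.

Lemma massS i n : (0 < n)%N ->
  \Sum_(x : FP) (if x == fp_root o then 0 else walk_taboo_avoid i n.+1 (fp_word x)) +
  \sum_(k < N | k != i) ret k n =
  \Sum_(x : FP) (if x == fp_root o then 0 else walk_taboo_avoid i n (fp_word x)).
Proof.
move=> n0.
transitivity (\Sum_(x : FP) \Sum_(y : FP) (walk_taboo_avoid i n (fp_word y) * (P y x)%:E)).
  rewrite -walk_taboo_avoid_root// -[X in _ + pred_sum _ X]/(fp_word (fp_root o)) -fp_pred//.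
  set S := \Sum_(y : FP) (_ * (P y (fp_root o))%:E).
  have S0 : 0 <= S by apply: sum_ge0 => y; rewrite mule_ge0.
  have -> : S = \Sum_(x : FP) (if x == fp_root o then S else 0).
    by rewrite (@sum_delta _ _ (fp_root o)) ?eqxx// => x /negbTE ->.
  rewrite -sumD; last 2 first.
  - by move=> x; case: ifP.
  - by move=> x; case: ifP.
  apply: eq_sum => x; case: eqVneq => [->|xo]; first by rewrite add0e.
  by rewrite adde0 fp_pred// walk_taboo_avoidS// fp_word_eq0.
rewrite sum_exchange => [|y x]; last by rewrite mule_ge0.
apply: eq_sum => x; rewrite (kernel_sumZ (fp_trans_stochastic o hp ha ha1))//.
case: eqVneq => // ->; rewrite /walk_taboo_avoid/=.
by rewrite walk_taboo_nil gtn_eqF.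
Qed.

(** The walk leaves through the other factors with mass [1 - alpha i] at time 1, and by [massS] the
    returns are drawn from this mass. *)
Lemma ret_sum_le i : \Sum_(n) \sum_(k < N | k != i) ret k n <= (1 - alpha i)%:E.
Proof.
have r0 n : 0 <= \sum_(k < N | k != i) ret k n.
  by apply: sume_ge0 => k _; apply: ret_ge0.
apply: sum_nat_le => // -[|n].
  by rewrite big_ord0 lee_fin subr_ge0 -ha1 (bigD1 i)//= lerDl sumr_ge0// => k _; rewrite ltW.
pose m n := \Sum_(x : FP) (if x == fp_root o then 0 else walk_taboo_avoid i n (fp_word x)).
have m0 j : 0 <= m j by apply: sum_ge0 => x; case: ifP.
apply: (@le_trans _ _ (\sum_(j < n.+1) \sum_(k < N | k != i) ret k j + m n.+1)).
  by rewrite leeDl.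
rewrite -mass1 -/(m 1%N); elim: n => [|n IH].
  by rewrite big_ord_recl big_ord0 big1 ?add0e ?adde0// => k _; rewrite ret0.
apply: le_trans IH; rewrite big_ord_recr/= -addeA leeD2l//.
by rewrite addeC massS.
Qed.

Section Chain.
Context (d : measure_display) (Omega : measurableType d) (Pr : probability Omega R).
Context (X : nat -> Omega -> FP).
Hypothesis hX : markov_chain Pr P (fp_root o) X.
Variable i : 'I_N.

(** One step from the root leads to a word of at most one letter, for which belonging to [V i] is a
    condition on the first letter. *)
Lemma fp_crossE x : P (fp_root o) x != 0%R -> x != fp_root o ->
  fp_cross o i x <-> ~~ head_avoids i (fp_word x).
Proof.
move=> Px x0; have w0 : fp_word x != [::] by rewrite fp_word_eq0.
have [a xE] : exists a, fp_word x = [:: a].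
  apply: contrapT => nx; move/eqP: Px; apply; apply: big1 => k _.
  rewrite /fp_lift; case: eqP => [/esym e|]; last by rewrite mulr0.
  by have [a xE _] := word_stem_eq0 w0 e; case: nx; exists a.
rewrite xE /= negbK; split.
  move=> [v /= vo xv]; move: xE; rewrite -xv fp_word_app// -[word_app _ _ _]/(letter v).
  by rewrite letterE// => /(congr1 (head a)) /= <-; rewrite eqxx.
move=> /eqP ai; case: a ai xE => j v /= ji xE.
case: _ / ji in v xE *; exists v; last first.
  apply: fp_word_inj; rewrite xE fp_word_app// -[word_app _ _ _]/(letter v).
  rewrite letterE//; have := svalP x; rewrite -/(fp_word x) xE.
  by rewrite /reduced /= !andbT.
by have := svalP x; rewrite -/(fp_word x) xE /reduced /= !andbT.
Qed.

Let D m : set FP := if m == 1%N then [set x | x <> fp_root o /\ ~ fp_cross o i x]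
  else [set x | x <> fp_root o].

Lemma Ev_walk_taboo n x : (0 < n)%N ->
  Pr (Ev X D n `&` [set w | X n w = x]) =
  if x == fp_root o then 0 else walk_taboo_avoid i n (fp_word x).
Proof.
case: n => // n _; elim: n x => [|n IH] x.
  rewrite (EvS hX (fp_trans_stochastic o hp ha ha1)).
  have -> : \Sum_(z : FP) (Pr (Ev X D 0 `&` [set w | X 0%N w = z]) * (P z x)%:E) =
      (P (fp_root o) x)%:E.
    rewrite (@sum_delta _ _ (fp_root o)).
    - by rewrite (Ev0 hX) eqxx mul1e.
    - by rewrite (Ev0 hX) eqxx mul1e.
    - by move=> z /negbTE zo; rewrite (Ev0 hX) zo mul0e.
  have tE : walk_taboo 1 (fp_word x) = if x == fp_root o then 0 else (P (fp_root o) x)%:E.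
    rewrite /= fp_word_eq0; case: ifP => // _.
    rewrite -fp_pred// (@sum_delta _ _ (fp_root o)) ?mul1e//.
    by move=> y yo; rewrite /= fp_word_eq0 (negbTE yo) mul0e.
  rewrite /walk_taboo_avoid tE; case: (eqVneq x (fp_root o)) => [->|xo].
    by case: asboolP => //; rewrite /D /= => -[].
  have [->|Px] := eqVneq (P (fp_root o) x) 0%R; first by case: ifP; case: ifP.
  have [h1 h2] := fp_crossE Px xo.
  congr (if _ then _ else _); apply/asboolP/idP; rewrite /D /=.
    by move=> [_ nc]; apply: contrapT => /negP /h2.
  by move=> ha'; split; [apply/eqP|move=> /h1; rewrite ha'].
rewrite (EvS hX (fp_trans_stochastic o hp ha ha1)) /D /=.
case: asboolP => [xo|/contrapT ->]; last by rewrite eqxx.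
have x0 : (x == fp_root o) = false by apply/eqP.
rewrite x0 -walk_taboo_avoidS// ?fp_word_eq0 ?x0// -fp_pred//.
apply: eq_sum => y; rewrite IH; case: eqVneq => // ->.
by rewrite /walk_taboo_avoid /= !mul0e.
Qed.

(** [Hbar] restricts the first step while [ret] sorts by the last one. The two agree because the
    type of the first letter is constant until the return; a return at time 1 has probability 0 for
    lack of loops. *)
Lemma Pr_first_return n :
  Pr (first_return_at X (fp_root o) n.+1 `&` [set w | ~ fp_cross o i (X 1%N w)]) =
  \sum_(k < N | k != i) ret k n.
Proof.
case: n => [|n].
  rewrite big1; last by move=> k _; rewrite ret0.
  apply/eqP; rewrite eq_le measure_ge0 andbT.
  apply: (@le_trans _ _ (Pr [set w | X 1%N w = fp_root o])).
    rewrite (_ : _ `&` _ = [set w | [set x | x = fp_root o /\ ~ fp_cross o i x] (X 1%N w)]).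
      apply: le_measure; rewrite ?inE; last by move=> w [].
      - exact: (measurable_preX hX).
      - by case: hX.
    by apply/seteqP; split => [w [[_ ? _] ?]//|w [? ?]]; split => //; split => // -[|[]].
  rewrite (law_walk hp ha ha1 hX) /= /pred_sum big1// => k _; rewrite sum0 ?mule0// => u.
  rewrite word_coord_nil -[word_app _ _ _]/(letter u).
  have [->|uo] := eqVneq u (o k); first by rewrite hloop mule0.
  by rewrite letterE// mul0e.
(* The constraints of [D], except that the root is imposed at the final time instead of being
   forbidden. *)
pose D' m : set FP := if m == n.+2 then [set fp_root o] else D m.
have -> : first_return_at X (fp_root o) n.+2 `&` [set w | ~ fp_cross o i (X 1%N w)] =
    Ev X D' n.+2 `&` [set w | X n.+2 w = fp_root o].
  apply/seteqP; split => w /=.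
    move=> [[_ Xn Xm] nc]; split => // m /andP[m0 mn]; rewrite /D'.
    have [->//|mn'] := eqVneq; rewrite /D.
    have mm : (0 < m < n.+2)%N by rewrite m0 ltn_neqAle mn' mn.
    by case: eqVneq => [m1|_] /=; [split; [exact: Xm|rewrite m1]|exact: Xm].
  move=> [Ew Xn]; split; first split => //.
    move=> m /andP[m0 mn]; have := Ew m; rewrite m0 (ltnW mn) => /(_ isT).
    by rewrite /D' ltn_eqF// /D; case: eqP => _ // -[].
  by have := Ew 1%N isT; rewrite /D' /D /= => -[].
rewrite (EvS hX (fp_trans_stochastic o hp ha ha1)) asboolT; last by rewrite /D' eqxx.
have e : Ev X D' n.+1 = Ev X D n.+1.
  by apply/seteqP; split => w Ew m /[dup] mm /Ew;
    rewrite /D' ltn_eqF// ltnS; case/andP: mm.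
rewrite e -walk_taboo_avoid_root// -[X in pred_sum _ X]/(fp_word (fp_root o)) -fp_pred//.
apply: eq_sum => y; rewrite Ev_walk_taboo//; case: eqVneq => // ->.
by rewrite /walk_taboo_avoid /= !mul0e.
Qed.
End Chain.
End Returns.

(** * Generating functions near 1 *)

Lemma expr_convex (R : realType) (x y th : R) n : 0 <= x -> 0 <= y -> 0 <= th <= 1 ->
  ((1 - th) * x + th * y) ^+ n <= (1 - th) * x ^+ n + th * y ^+ n.
Proof.
move=> x0 y0 /andP[t0 t1]; set c := _ + _ * y.
have c0 : 0 <= c by rewrite addr_ge0 ?mulr_ge0// subr_ge0.
elim: n => [|n IH]; first by rewrite !expr0; lra.
apply: (@le_trans _ _ (c * ((1 - th) * x ^+ n + th * y ^+ n))).
  by rewrite exprS ler_wpM2l.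
rewrite !exprS -subr_ge0.
(* The defect in the induction step contains a product of two differences of the same sign. *)
have -> : (1 - th) * (x * x ^+ n) + th * (y * y ^+ n) -
    c * ((1 - th) * x ^+ n + th * y ^+ n) =
    (1 - th) * th * ((x - y) * (x ^+ n - y ^+ n)) by rewrite /c; ring.
apply: mulr_ge0; first by rewrite mulr_ge0// subr_ge0.
have [xy|/ltW yx] := leP x y.
  by rewrite mulr_le0// subr_le0// lerXn2r.
by rewrite mulr_ge0// subr_ge0// lerXn2r.
Qed.

(** Convexity replaces the differentiation of power series: it gives the Lipschitz bound for
    [greenr] and carries strict inequalities from 1 to a neighbourhood. *)
Lemma egf_convex (R : realType) (a : nat -> \bar R) (x y th : R) :
  (forall n, (0 <= a n)%E) -> 0 <= x -> 0 <= y -> 0 <= th <= 1 ->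
  (egf a ((1 - th) * x + th * y) <= (1 - th)%:E * egf a x + th%:E * egf a y)%E.
Proof.
move=> a0 x0 y0 /[dup] tt /andP[t0 t1]; have t1' : 0 <= 1 - th by rewrite subr_ge0.
have ax n : (0 <= a n * (x ^+ n)%:E)%E by rewrite mule_ge0// lee_fin exprn_ge0.
have ay n : (0 <= a n * (y ^+ n)%:E)%E by rewrite mule_ge0// lee_fin exprn_ge0.
rewrite /egf -!sumZl ?lee_fin// -sumD; last 2 first.
- by move=> n; rewrite mule_ge0.
- by move=> n; rewrite mule_ge0.
apply: le_sum => n; rewrite !(muleCA _%:E) -ge0_muleDr ?mule_ge0 ?lee_fin ?exprn_ge0//.
by rewrite lee_wpmul2l// -!EFinM -EFinD lee_fin expr_convex.
Qed.

Section Numerics.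
Context {R : realType} {N : nat} {V : 'I_N -> countType} (o : forall i, V i).
Context (p : forall i, V i -> V i -> R) (alpha : 'I_N -> R).
Hypothesis hN : (2 <= N)%N.
Hypothesis hp : forall i, stochastic (@p i).
Hypothesis hloop : forall i (x : V i), p x x = 0.
Hypothesis ha : forall i, 0 < alpha i.
Hypothesis ha1 : \sum_(i < N) alpha i = 1.
Context (d : measure_display) (Omega : measurableType d) (Pr : probability Omega R).
Context (X : nat -> Omega -> free_product o).
Hypothesis hX : markov_chain Pr (fp_trans p alpha) (fp_root o) X.
Hypothesis hR : (1 < green_radius (@fp_trans R N V o p alpha))%E.
Local Notation green_gf := (green_gf o p alpha).
Local Notation last_gf := (last_gf o p alpha).
Local Notation return_gf := (return_gf o p alpha).
Local Notation ret := (ret o p alpha).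
Local Notation walk := (walk o p alpha).
Local Notation letter := (letter o).
Implicit Types (i k : 'I_N) (z : R).

(** The hypothesis on the radius of convergence enters here, through the pair of roots alone. *)
Lemma green_gf_radius : exists2 rho : R, 1 < rho & (green_gf rho [::] < +oo)%E.
Proof.
pose c := cv_radius (fun n => nstep (@fp_trans R N V o p alpha) n (fp_root o) (fp_root o)).
have : (1 < c)%E.
  apply: lt_le_trans hR _; apply: ereal_inf_lbound.
  by exists (fp_root o, fp_root o).
move=> /ereal_sup_gt[_ [z [z0 cz] <-]]; rewrite lte_fin => z1; exists z => //.
have st := fp_trans_stochastic o hp ha ha1.
have e : green_gf z [::] = egf (EFin \o (fun n => `|nstep (@fp_trans R N V o p alpha) n (fp_root o) (fp_root o)|)) z.
  apply: eq_egf => n /=; rewrite -[X in walk n X]/(fp_word (fp_root o)) -nstep_walk//.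
  by rewrite ger0_norm// nstep_ge0.
rewrite e /egf /= -[X in (X < _)%E]/(\Sum_(n) (`|nstep (@fp_trans R N V o p alpha) n (fp_root o) (fp_root o)| * z ^+ n)%:E)%E.
rewrite cvg_sum_fin ?ltry// => n; by rewrite mulr_ge0// exprn_ge0.
Qed.

(* Real values of the generating functions; [xir z i] is the value of the
   paper's xi_i at [z], see [xiE]. *)
Definition greenr z := fine (green_gf z [::]).
Definition returnr k z := fine (return_gf k z).
Definition other_returnr i z := \sum_(k < N | k != i) returnr k z.
Definition total_returnr z := \sum_(k < N) returnr k z.

Section AtZ.
Variable z : R.
Hypothesis z0 : 0 <= z.
Hypothesis Gfin : (green_gf z [::] < +oo)%E.

Let G0 : (0 <= green_gf z [::])%E. Proof. by apply: green_gf_ge0. Qed.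
Let H0 k : (0 <= return_gf k z)%E. Proof. by apply: return_gf_ge0. Qed.
Local Hint Resolve H0 : core.
Let sH0 : (0 <= \sum_(k < N) return_gf k z)%E. Proof. by apply: sume_ge0. Qed.

Lemma green_gfE : green_gf z [::] = (greenr z)%:E.
Proof. by rewrite fineK// ge0_fin_numE. Qed.

Lemma greenr_ge1 : 1 <= greenr z.
Proof. by rewrite -lee_fin -green_gfE green_gf_renewal// leeDl// mule_ge0. Qed.

Lemma return_gfE k : return_gf k z = (returnr k z)%:E.
Proof.
rewrite fineK// ge0_fin_numE//; apply: le_lt_trans Gfin.
apply: (@le_trans _ _ (\sum_(k < N) return_gf k z)%E).
  by rewrite (bigD1 k)//= leeDl// sume_ge0.
rewrite [leRHS]green_gf_renewal//; apply: (@le_trans _ _ (green_gf z [::] * \sum_(k < N) return_gf k z)%E).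
  by rewrite -[leLHS]mul1e lee_wpmul2r// green_gfE lee_fin greenr_ge1.
by rewrite leeDr.
Qed.

Lemma returnr_ge0 k : 0 <= returnr k z.
Proof. by rewrite -lee_fin -return_gfE. Qed.

Lemma greenr_renewal : greenr z * (1 - total_returnr z) = 1.
Proof.
have := green_gf_renewal o hp ha z0; rewrite green_gfE.
under eq_bigr do rewrite return_gfE.
rewrite sumEFin -EFinM -EFinD => -[]; rewrite -/(total_returnr z); lra.
Qed.

Lemma total_returnr_lt1 : total_returnr z < 1.
Proof.
have := greenr_renewal; have := greenr_ge1 => g1 e.
rewrite -subr_gt0 -(pmulr_rgt0 _ (lt_le_trans ltr01 g1)) e; exact: ltr01.
Qed.

Lemma other_returnrE i : other_returnr i z = total_returnr z - returnr i z.
Proof. by rewrite /total_returnr (bigD1 i)//= addrAC subrr add0r. Qed.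

Lemma other_returnr_lt1 i : other_returnr i z < 1.
Proof. by rewrite other_returnrE; have := total_returnr_lt1; have := returnr_ge0 i; lra. Qed.

Lemma other_returnr_ge0 i : 0 <= other_returnr i z.
Proof. by apply: sumr_ge0 => k _; apply: returnr_ge0. Qed.

Lemma other_return_gfE i : (\sum_(k < N | k != i) return_gf k z)%E = (other_returnr i z)%:E.
Proof. by under eq_bigr do rewrite return_gfE; rewrite sumEFin. Qed.

Lemma HbarE i : Hbar Pr X i z = other_returnr i z.
Proof.
set c := fun n => fine (Pr (first_return_at X (fp_root o) n `&`
    [set w | ~ fp_cross o i (X 1%N w)])).
have r0 n : (0 <= \sum_(k < N | k != i) ret k n)%E.
  by apply: sume_ge0 => k _; apply: ret_ge0.
have c0 n : 0 <= c n by rewrite fine_ge0.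
have cE : egf (EFin \o c) z = (other_returnr i z)%:E.
  rewrite egfS//= {1}/c (_ : _ `&` _ = set0); last by apply/seteqP; split => // w [[]].
  rewrite measure0 add0e -other_return_gfE /return_gf -ge0_sume_distrr; last first.
    by move=> k _; apply: egf_ge0 => // n; apply: ret_ge0.
  congr (_ * _)%E; rewrite -egf_big//; last by move=> k n; apply: ret_ge0.
  apply: eq_egf => n; rewrite /c (Pr_first_return hp hloop ha ha1 hX) fineK// ge0_fin_numE//.
  apply: le_lt_trans (ltry (1 - alpha i)).
  apply: le_trans (ret_sum_le o hp hloop ha ha1 i).
  exact: (@sum_ge_term _ _ (fun n => \sum_(k < N | k != i) ret k n)%E).
apply/EFin_inj; rewrite -cE egf_pseries//.
by rewrite cE ltry.
Qed.

Definition xir i := alpha i * z / (1 - other_returnr i z).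

Lemma xiE i : xi alpha Pr X i z = xir i.
Proof. by rewrite /xi HbarE. Qed.

Lemma xir_ge0 i : 0 <= xir i.
Proof. by rewrite divr_ge0 ?mulr_ge0 ?(ltW (ha i))// subr_ge0 ltW// other_returnr_lt1. Qed.

Lemma xirM i : xir i * (1 - other_returnr i z) = alpha i * z.
Proof. by rewrite divfK// subr_eq0 gt_eqF// other_returnr_lt1. Qed.

Lemma last_gfE i (v : V i) : last_gf z (letter v) = last_visit_gf (@p i) (o i) v (xir i).
Proof. by apply: last_gf_last_visit_gf => //; [exact: other_return_gfE|exact: other_returnr_lt1]. Qed.

Local Notation fr i := (egf (first_return (@p i) (o i)) (xir i)).

(** [xir] attaches to every step inside [V i] the excursions into the other factors. A first return
    makes none at the root, which the factor [1 - other_returnr i z] corrects. *)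
Lemma returnr_first_return i : (returnr i z)%:E = ((1 - other_returnr i z)%:E * ((xir i)%:E * fr i))%E.
Proof.
rewrite -return_gfE return_gf_letter// [RHS]muleA -EFinM (mulrC (1 - _)) xirM EFinM -[RHS]muleA [RHS]muleCA.
congr (_ * (_ * _))%E; rewrite first_return_gf ?xir_ge0//.
by apply: eq_sum => u; rewrite last_gfE.
Qed.

Lemma returnr_le i : xir i <= 1 -> returnr i z <= alpha i * z * xir i.
Proof.
move=> t1; rewrite -lee_fin returnr_first_return.
apply: (@le_trans _ _ ((1 - other_returnr i z)%:E * (xir i ^+ 2)%:E)%E).
  rewrite lee_wpmul2l ?lee_fin ?subr_ge0 ?(ltW (other_returnr_lt1 i))//.
  by apply: first_return_gf_le => //; rewrite xir_ge0.
by rewrite -EFinM lee_fin expr2 mulrA [(1 - _) * _]mulrC xirM.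
Qed.

Definition last_sum i := fine (\Sum_(v : V i) last_visit_gf (@p i) (o i) v (xir i))%E.

Lemma last_sumE i : xir i < 1 -> (\Sum_(v : V i) last_visit_gf (@p i) (o i) v (xir i))%E = (last_sum i)%:E.
Proof.
move=> t1; have tt : 0 <= xir i < 1 by rewrite xir_ge0.
rewrite fineK// ge0_fin_numE; last by apply: sum_ge0 => v; apply: last_visit_gf_ge0; rewrite ?xir_ge0.
by rewrite (le_lt_trans (last_visit_gf_sum_le (hp i) _ tt))// ltry.
Qed.

(** The mass balance in [V i] at parameter [xir z i], multiplied by [1 - other_returnr i z].
    Together with [greenr_renewal] it makes the inverse of [last_sum z i] equal to [greenr z * (1 -
    other_returnr i z - alpha i * z)]. *)
Lemma last_sum_eq i : xir i < 1 -> last_sum i * (1 - other_returnr i z - alpha i * z) = 1 - total_returnr z.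
Proof.
move=> t1; have tt : 0 <= xir i < 1 by rewrite xir_ge0.
have [f fE] : exists f : R, ((xir i)%:E * fr i)%E = f%:E.
  exists (fine ((xir i)%:E * fr i)%E); rewrite fineK// ge0_fin_numE; last first.
    by rewrite mule_ge0 ?lee_fin ?xir_ge0// egf_ge0 ?xir_ge0// => n; apply: first_return_ge0.
  by rewrite (@le_lt_trans _ _ 1%E) ?ltry// first_return_gf_le1// xir_ge0 ltW.
have := last_visit_gf_sum_eq (hp i) (o i) (xir_ge0 i); rewrite last_sumE// fE.
rewrite -EFinM -!EFinD => -[e].
have := returnr_first_return i; rewrite fE -EFinM => -[e2].
have := xirM i; have := other_returnrE i => hb e3.
rewrite -e3; have -> : 1 - total_returnr z = (1 - other_returnr i z) * (1 - f).
  by rewrite mulrBr mulr1 -e2 hb; ring.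
have -> : f = 1 + xir i * last_sum i - last_sum i by rewrite -e; ring.
ring.
Qed.

Lemma last_sum_ge1 i : xir i < 1 -> 1 <= last_sum i.
Proof.
move=> t1; rewrite -lee_fin -last_sumE// -(last_visit_gf_root (@p i) (o i) (xir_ge0 i)).
by apply: sum_ge_term => v; apply: last_visit_gf_ge0; rewrite ?xir_ge0.
Qed.

End AtZ.

Lemma green_gf_le z w : 0 <= z <= w -> (green_gf z [::] <= green_gf w [::])%E.
Proof. by move=> zw; apply: egf_le => // n; apply: walk_ge0. Qed.

Lemma green_gf1_fin : (green_gf 1 [::] < +oo)%E.
Proof.
have [rho rho1 fin] := green_gf_radius; apply: le_lt_trans fin.
by apply: green_gf_le; rewrite ler01 ltW.
Qed.
Local Notation fin1 := green_gf1_fin.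

Lemma other_returnr1_le i : other_returnr i 1 <= 1 - alpha i.
Proof.
rewrite -lee_fin -(other_return_gfE ler01 fin1); apply: le_trans (ret_sum_le o hp hloop ha ha1 i).
rewrite sum_big; last by move=> k n; apply: ret_ge0.
by apply: lee_sum => k _; rewrite /return_gf mul1e egf1.
Qed.

Lemma xir1_le1 i : xir 1 i <= 1.
Proof.
have h1 := other_returnr_lt1 ler01 fin1 i.
by rewrite /xir mulr1 ler_pdivrMr ?subr_gt0// mul1r; have := other_returnr1_le i; lra.
Qed.

(* If some [xir 1 i] were 1, then all returns would be certain. *)
Lemma xir1_lt1 i : xir 1 i < 1.
Proof.
rewrite lt_neqAle xir1_le1 andbT; apply/negP => /eqP ti.
have hle k : returnr k 1 <= alpha k * xir 1 k.
  by have := returnr_le ler01 fin1 (xir1_le1 k); rewrite mulr1.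
have hle1 k : returnr k 1 <= alpha k.
  by apply: le_trans (hle k) _; rewrite ler_piMr ?(ltW (ha k))// xir1_le1.
(* If [xir 1 j] is 1, then [other_returnr j 1] equals the sum of the other [alpha k]; as each term
   is bounded by its [alpha k], equality holds termwise. *)
have full j : xir 1 j = 1 -> forall k, k != j -> returnr k 1 = alpha k.
  move=> tj k kj; apply/le_anti; rewrite hle1 /=.
  have := xirM ler01 fin1 j; rewrite tj mul1r mulr1 => e.
  have s : \sum_(l < N | l != j) alpha l = other_returnr j 1.
    by have := ha1; rewrite (bigD1 j)//= -e; lra.
  rewrite /other_returnr (bigD1 k)//= [X in _ = X](bigD1 k)//= in s; move: s.
  have : \sum_(i0 < N | (i0 != j) && (i0 != k)) returnr i0 1 <=
         \sum_(i0 < N | (i0 != j) && (i0 != k)) alpha i0.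
    by apply: ler_sum => l _.
  lra.
have [j ji] : exists j, j != i.
  have [j0 j1] : (0 < N)%N /\ (1 < N)%N by split => //; apply: leq_trans hN.
  have [i0|i0] := eqVneq i (Ordinal j0); last by exists (Ordinal j0); rewrite eq_sym.
  by exists (Ordinal j1); rewrite i0.
(* By [full] at [i], [returnr j 1] attains [alpha j], so the factor [xir 1 j] in [hle] cannot be
   below 1. Then [full] at [j] covers [i] as well, against [total_returnr_lt1]. *)
have tj : xir 1 j = 1.
  have := hle j; rewrite (full i ti j ji) => h; apply/le_anti; rewrite xir1_le1 /=.
  by rewrite -(ler_pM2l (ha j)) mulr1.
have all1 k : returnr k 1 = alpha k.
  have [->|] := eqVneq k i; last exact: full.
  by apply: (full j tj); rewrite eq_sym.
by have := total_returnr_lt1 ler01 fin1; rewrite /total_returnr (eq_bigr alpha) ?ha1 ?ltxx// => k _.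
Qed.

(** [greenr] is monotone and convex on [[0, rho]]; chords ending at [rho] bound its variation,
    whence the constant [greenr rho / (rho - 1)]. *)
Lemma greenr_lipschitz : exists C rho : R, [/\ 1 < rho, (green_gf rho [::] < +oo)%E &
  forall z, 0 <= z <= rho -> `|greenr z - greenr 1| <= C * `|z - 1|].
Proof.
have [rho rho1 fin] := green_gf_radius.
have rho0 : 0 <= rho by lra.
have fz z : 0 <= z <= rho -> (green_gf z [::] < +oo)%E.
  by move=> zz; apply: le_lt_trans fin; apply: green_gf_le.
have cvx (x y th : R) : 0 <= x <= rho -> 0 <= y <= rho -> 0 <= th <= 1 ->
    greenr ((1 - th) * x + th * y) <= (1 - th) * greenr x + th * greenr y.
  move=> xx yy tt.
  have cc : 0 <= (1 - th) * x + th * y <= rho.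
    move/andP: xx => [x0 xr]; move/andP: yy => [y0 yr]; move/andP: tt => [t0 t1].
    by apply/andP; split; nra.
  have x0 : 0 <= x by case/andP: xx.
  have y0 : 0 <= y by case/andP: yy.
  rewrite -lee_fin EFinD !EFinM -!green_gfE ?fz//; last by case/andP: cc.
  by apply: egf_convex => // n; apply: walk_ge0.
have mono (x y : R) : 0 <= x <= y -> y <= rho -> greenr x <= greenr y.
  move=> /andP[x0 xy] yr; have y0 : 0 <= y by lra.
  have xr : x <= rho by lra.
  rewrite -lee_fin -(green_gfE x0) ?fz ?x0// -(green_gfE y0) ?fz ?y0//.
  by apply: green_gf_le; rewrite x0.
have g1 : 1 <= greenr 1 by apply: greenr_ge1 => //; exact: fin1.
exists (greenr rho / (rho - 1)), rho; split => // z /andP[z0 zr].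
have r1 : 0 < rho - 1 by lra.
have gr0 : 0 <= greenr rho by apply: (le_trans ler01); apply: greenr_ge1.
have [z1|z1] := leP z 1.
  have m : greenr z <= greenr 1 by apply: mono; [rewrite z0|lra].
  rewrite ler0_norm; last by lra.
  rewrite (ler0_norm (_ : z - 1 <= 0)); last by lra.
  have rz : 0 < rho - z by lra.
  (* The weight for which 1 is the convex combination of [z] and [rho]. *)
  have th01 : 0 <= (1 - z) / (rho - z) <= 1.
    by rewrite divr_ge0//=; [rewrite ler_pdivrMr//; lra|lra|lra].
  have := @cvx z rho ((1 - z) / (rho - z)); rewrite z0 zr rho0 lexx => /(_ isT isT th01).
  set th := (1 - z) / (rho - z) in th01 *.
  have -> : (1 - th) * z + th * rho = 1 by rewrite /th; field; lra.
  move=> h; have thle : th <= (1 - z) / (rho - 1).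
    rewrite /th ler_wpM2l ?subr_ge0// lef_pV2 ?posrE//; lra.
  have gz0 : 0 <= greenr z.
    by apply: (le_trans ler01); apply: greenr_ge1 => //; apply: fz; rewrite z0.
  have -> : greenr rho / (rho - 1) * - (z - 1) = ((1 - z) / (rho - 1)) * greenr rho by field; lra.
  move/andP: th01 => [th0 _].
  apply: (@le_trans _ _ (th * greenr rho)); last by rewrite ler_wpM2r.
  by nra.
have m : greenr 1 <= greenr z by apply: mono; [rewrite ler01 ltW|].
rewrite ger0_norm; last by lra.
rewrite (ger0_norm (_ : 0 <= z - 1)); last by lra.
have th01 : 0 <= (z - 1) / (rho - 1) <= 1.
  by rewrite divr_ge0//=; [rewrite ler_pdivrMr//; lra|lra|lra].
have := @cvx 1 rho ((z - 1) / (rho - 1)); rewrite ler01 (ltW rho1) rho0 lexx => /(_ isT isT th01).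
set th := (z - 1) / (rho - 1) in th01 *.
have -> : (1 - th) * 1 + th * rho = z by rewrite /th; field; lra.
have -> : greenr rho / (rho - 1) * (z - 1) = th * greenr rho by rewrite /th; field; lra.
move/andP: th01 => [th0 _]; nra.
Qed.

(** [xir z i < 1] means [alpha i * z + other_returnr i z < 1]. This holds with a gap at 1, and by
    convexity the left side grows at most linearly beyond 1. *)
Lemma xir_lt1_near : exists2 e : R, 0 < e & forall z i, 0 <= z < 1 + e ->
  (green_gf z [::] < +oo)%E /\ xir z i < 1.
Proof.
have [rho rho1 fin] := green_gf_radius.
have rho0 : 0 <= rho by lra.
have fz z : 0 <= z <= rho -> (green_gf z [::] < +oo)%E.
  by move=> zz; apply: le_lt_trans fin; apply: green_gf_le.
have trlt z i : 0 <= z <= rho -> (xir z i < 1) = (alpha i * z + other_returnr i z < 1).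
  move=> /[dup] zz /andP[z0 zr]; have h1 := other_returnr_lt1 z0 (fz _ zz) i.
  by rewrite /xir ltr_pdivrMr ?subr_gt0// mul1r ltrBrDr.
pose kap i := 1 - alpha i - other_returnr i 1.
have kap0 i : 0 < kap i.
  by have := xir1_lt1 i; rewrite trlt ?ler01 ?(ltW rho1)// mulr1 /kap; lra.
have [kp kp0 kpl] : exists2 kp : R, 0 < kp & forall i, kp <= kap i.
  exists (\big[Num.min/1]_(i < N) kap i).
    by elim/big_ind: _ => // x y x0 y0; rewrite lt_min x0.
  by move=> i; rewrite (bigD1 i)//= ge_min lexx.
(* With [th = (z - 1) / (rho - 1)], the term [alpha i * z] grows by at most [th * (rho - 1)] and
   [other_returnr] by at most [th]; the choice of [e] keeps [th * (rho + 1)] below the smallest gap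
   [kp]. *)
pose e := Num.min (rho - 1) ((rho - 1) * (kp / (rho + 1))).
have e0 : 0 < e by rewrite lt_min; apply/andP; split; [lra|rewrite mulr_gt0 ?divr_gt0//; lra].
exists e => // z i /andP[z0 ze].
have ler : e <= rho - 1 by rewrite ge_min lexx.
have lek : e * (rho + 1) <= (rho - 1) * kp.
  by rewrite -ler_pdivlMr ?mulrA//; [rewrite ge_min !mulrA lexx orbT|lra].
have zr : z <= rho by lra.
have zz : 0 <= z <= rho by rewrite z0.
split; first exact: fz.
have h0 x : 0 <= x <= rho -> 0 <= other_returnr i x.
  by move=> /[dup] xx /andP[x0 _]; apply: other_returnr_ge0 => //; apply: fz.
have rr : 0 <= rho <= rho by rewrite rho0 lexx.
have hrho := other_returnr_lt1 rho0 fin i.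
rewrite trlt//.
have az : alpha i <= 1 by have := other_returnr1_le i; have := h0 1; rewrite ler01 (ltW rho1) => /(_ isT); lra.
have ai := ha i; have k1 := kpl i; rewrite /kap in k1.
have r1 : 0 < rho - 1 by lra.
have [z1|z1] := leP z 1.
  have : other_returnr i z <= other_returnr i 1.
    rewrite -lee_fin -!other_return_gfE ?fz ?ler01 ?(ltW rho1)//.
    apply: lee_sum => k _; apply: lee_pmul => //.
    - by apply: egf_ge0 => // n; apply: ret_ge0.
    - by apply: egf_le => //; [move=> n; apply: ret_ge0|rewrite z0].
  by nra.
pose th := (z - 1) / (rho - 1).
have th01 : 0 <= th <= 1.
  by rewrite /th divr_ge0//=; [rewrite ler_pdivrMr//; lra|lra|lra].
have zE : (1 - th) * 1 + th * rho = z by rewrite /th; field; lra.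
have hc : other_returnr i z <= (1 - th) * other_returnr i 1 + th * other_returnr i rho.
  have Hcvx k : returnr k z <= (1 - th) * returnr k 1 + th * returnr k rho.
    have rc0 n : (0 <= if n is m.+1 then ret k m else 0)%E by case: n => // n; apply: ret_ge0.
    have HE x : 0 <= x -> return_gf k x = egf (fun n => if n is m.+1 then ret k m else 0)%E x.
      by move=> x0; rewrite egfS//= add0e.
    rewrite -lee_fin EFinD !EFinM -!return_gfE ?fz ?ler01 ?(ltW rho1)//.
    by rewrite !HE ?ler01// -{1}zE; apply: egf_convex.
  by rewrite /other_returnr !mulr_sumr -big_split /=; apply: ler_sum => k _.
have thk : th * (rho + 1) < kp.
  rewrite /th mulrAC ltr_pdivrMr//; apply: lt_le_trans (_ : e * (rho + 1) <= _).
    by rewrite ltr_pM2r; lra.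
  by rewrite [leRHS]mulrC.
move/andP: th01 => [th0 th1].
have hb1 := h0 1; rewrite ler01 (ltW rho1) in hb1; have {}hb1 := hb1 isT.
have : th * other_returnr i rho <= th by rewrite ler_piMr// ltW.
have : (1 - th) * other_returnr i 1 <= other_returnr i 1 by rewrite ler_piMl//; lra.
have : alpha i * z <= alpha i + th * (rho - 1).
  have -> : th * (rho - 1) = z - 1 by rewrite /th divfK//; lra.
  by nra.
nra.
Qed.

End Numerics.

(** * Derivatives of g *)

Section Calculus.
Context {R : realType}.
Implicit Types (u r : R).

Lemma expR_1Bx u : expR u * (1 - u) <= 1.
Proof.
have := expR_ge1Dx (- u); rewrite expRN => h; have e0 := expR_gt0 u.
apply: (@le_trans _ _ (expR u / expR u)); first by rewrite ler_wpM2l// ltW.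
by rewrite divff// gt_eqF.
Qed.

Lemma expR_bound2 u : expR u <= 1 + u + u ^+ 2 * expR `|u|.
Proof.
have h1 := expR_1Bx u.
have h2 := expR_ge1Dx u.
have e1 : 1 <= expR `|u| by rewrite -expR0 ler_expR.
have [u0|u0] := leP 0 u.
  by rewrite ger0_norm// in e1 *; have e0 := expR_gt0 u; nra.
have : u ^+ 2 <= u ^+ 2 * expR `|u| by rewrite ler_peMr// sqr_ge0.
by nra.
Qed.

Lemma expR_bound1 u : `|expR u - 1| <= `|u| * expR `|u|.
Proof.
have h1 := expR_1Bx u.
have h2 := expR_ge1Dx u.
have e1 : 1 <= expR `|u| by rewrite -expR0 ler_expR.
have [u0|u0] := leP 0 u.
  rewrite ger0_norm; last by lra.
  by rewrite (ger0_norm u0); lra.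
have e2 : expR u <= 1 by rewrite -expR0 ler_expR ltW.
rewrite ler0_norm; last by lra.
have : `|u| <= `|u| * expR `|u| by rewrite ler_peMr.
by rewrite {1}ltr0_norm//; lra.
Qed.

(** A quadratic bound of the remainder is stable under summation, so it serves to differentiate
    infinite sums. *)
Lemma is_derive_quadratic (f : R -> R) (a l C e : R) : 0 < e ->
  (forall h, `|h| < e -> `|f (a + h) - f a - h * l| <= C * h ^+ 2) ->
  is_derive a (1 : R) f l.
Proof.
move=> e0 H.
have c : (h^-1 *: ((f \o shift a) (h *: (1 : R)) - f a) @[h --> (0 : R)^']) --> l.
  apply/cvgrPdist_le => eps eps0; near=> h.
  have h0 : h != 0 by near: h; exact: nbhs_dnbhs_neq.
  have he : `|h| < e by near: h; apply: dnbhs0_lt.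
  have hc : `|h| < eps / (`|C| + 1) by near: h; apply: dnbhs0_lt; rewrite divr_gt0// ltr_wpDl.
  have := H h he; rewrite /= /shift /= [h *: 1]mulr1 [h + a]addrC => Hh.
  have -> : l - h^-1 *: (f (a + h) - f a) = - (h^-1 * (f (a + h) - f a - h * l)).
    by rewrite /GRing.scale /=; field.
  rewrite normrN normrM normfV ler_pdivrMl ?normr_gt0//.
  apply: le_trans Hh _; apply: (@le_trans _ _ (`|C| * `|h| * `|h|)).
    by rewrite -mulrA -expr2 real_normK ?num_real// ler_wpM2r ?sqr_ge0// ler_norm.
  rewrite mulrC ler_wpM2l//; move: hc; rewrite ltr_pdivlMr ?ltr_wpDl// => hc.
  by apply: le_trans (ltW hc); rewrite mulrC ler_wpM2l// lerDl.
apply: DeriveDef; first by apply/cvg_ex; exists l.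
by rewrite /derive; apply/cvg_lim.
Unshelve. all: by end_near. Qed.

(** * Differentiating a sum of exponentials under an exponential moment *)

Section ExpSum.
Context (T : choiceType) (f w : T -> R) (dl : R).
Hypotheses (f0 : forall x, 0 <= f x) (w0 : forall x, 0 <= w x) (dl0 : 0 < dl).
Hypothesis fin : (\Sum_(x) (f x * expR (dl * w x))%:E < +oo)%E.

Let q x := f x * expR (dl * w x).
Let q0 x : 0 <= q x. Proof. by rewrite mulr_ge0// expR_ge0. Qed.

Let dom (g : T -> R) (c : R) : 0 <= c -> (forall x, 0 <= g x <= c * q x) ->
  (\Sum_(x) (g x)%:E)%E = (fine (\Sum_(x) (g x)%:E)%E)%:E.
Proof.
move=> c0 gq; rewrite fineK// ge0_fin_numE; last first.
  by apply: sum_ge0 => x; rewrite lee_fin; case/andP: (gq x).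
apply: (@le_lt_trans _ _ (c%:E * \Sum_(x) (q x)%:E)%E).
  rewrite -sumZl ?lee_fin//; apply: le_sum => x.
  by rewrite -EFinM lee_fin; case/andP: (gq x).
by apply: lte_mul_pinfty.
Qed.

Let fq x : f x <= q x.
Proof. by rewrite ler_peMr// -expR0 ler_expR mulr_ge0// ltW. Qed.

Lemma exp_sum_fin1 : (\Sum_(x) (f x)%:E)%E = (fine (\Sum_(x) (f x)%:E)%E)%:E.
Proof. by apply: (dom ler01) => x; rewrite f0 mul1r fq. Qed.

Lemma exp_sum_finw :
  (\Sum_(x) (f x * w x)%:E)%E = (fine (\Sum_(x) (f x * w x)%:E)%E)%:E.
Proof.
apply: (@dom _ dl^-1); first by rewrite invr_ge0 ltW.
move=> x; rewrite mulr_ge0//= /q mulrCA ler_wpM2l// ler_pdivlMl//.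
by apply: le_trans (expR_ge1Dx _); rewrite lerDr.
Qed.

(** Each term has a second order expansion whose remainder is dominated, uniformly for [r] below
    [dl / 2] in absolute value, by the summable [q]. *)
Lemma exp_sum_derive : is_derive 0 (1 : R)
  (fun r => fine (\Sum_(x) (f x * expR (- r * w x))%:E)%E)
  (- fine (\Sum_(x) (f x * w x)%:E)%E).
Proof.
set E := fine _; pose Q := fine (\Sum_(x) (q x)%:E)%E.
(* With [y = dl * w x / 2], the inequality [(1 + y / 2) ^+ 2 <= expR y] gives
   [y ^+ 2 <= 4 * expR y], and returning from [y] to [w x] costs another [4 / dl ^+ 2]. *)
pose c := 16 / dl ^+ 2.
have c0 : 0 <= c by rewrite divr_ge0// exprn_ge0// ltW.
have QE : (\Sum_(x) (q x)%:E)%E = Q%:E by apply: (dom ler01) => x; rewrite q0 mul1r /=.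
have wb x r : `|r| < dl / 2 -> w x ^+ 2 * expR (`|r| * w x) <= c * expR (dl * w x).
  move=> rd; set y := dl / 2 * w x.
  have y0 : 0 <= y by rewrite mulr_ge0// divr_ge0// ltW.
  have h : y ^+ 2 <= 4 * expR y.
    have e1 := expR_ge1Dx (y / 2); have -> : expR y = expR (y / 2) ^+ 2.
      by rewrite -expRM_natl; congr expR; field.
    have : (1 + y / 2) ^+ 2 <= expR (y / 2) ^+ 2.
      by rewrite lerXn2r// nnegrE ?expR_ge0//; lra.
    by nra.
  have e2 : expR (`|r| * w x) <= expR y by rewrite ler_expR ler_wpM2r// ltW.
  have -> : expR (dl * w x) = expR y * expR y by rewrite -expRD; congr expR; rewrite /y; field.
  have -> : w x ^+ 2 = 4 / dl ^+ 2 * y ^+ 2 by rewrite /y; field; rewrite gt_eqF.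
  rewrite [leRHS]mulrA; apply: ler_pM => //.
  - by rewrite mulr_ge0 ?sqr_ge0// divr_ge0// exprn_ge0// ltW.
  - have -> : c * expR y = 4 / dl ^+ 2 * (4 * expR y) by rewrite /c; field; rewrite gt_eqF.
    by rewrite ler_wpM2l// divr_ge0// exprn_ge0// ltW.
have up x r : `|r| < dl / 2 -> f x * expR (- r * w x) <= f x - r * (f x * w x) + r ^+ 2 * (c * q x).
  move=> rd; have := expR_bound2 (- r * w x); rewrite normrM normrN (ger0_norm (w0 x)).
  have := wb x r rd => h1 h2.
  have -> : f x - r * (f x * w x) + r ^+ 2 * (c * q x) =
     f x * (1 + - r * w x + r ^+ 2 * (c * expR (dl * w x))) by rewrite /q; ring.
  rewrite ler_wpM2l//; apply: le_trans h2 _; rewrite lerD2l.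
  have -> : (- r * w x) ^+ 2 * expR (`|r| * w x) = r ^+ 2 * (w x ^+ 2 * expR (`|r| * w x)) by ring.
  by rewrite ler_wpM2l// sqr_ge0.
have lo x r : f x - r * (f x * w x) <= f x * expR (- r * w x).
  have -> : f x - r * (f x * w x) = f x * (1 + - r * w x) by ring.
  by rewrite ler_wpM2l// expR_ge1Dx.
have finr r : `|r| < dl / 2 -> (\Sum_(x) (f x * expR (- r * w x))%:E)%E =
    (fine (\Sum_(x) (f x * expR (- r * w x))%:E)%E)%:E.
  move=> rd; apply: (dom ler01) => x; rewrite mulr_ge0 ?expR_ge0//= mul1r.
  rewrite ler_wpM2l// ler_expR ler_wpM2r//.
  by have := ler_norm (- r); rewrite normrN; have := dl0; lra.
have fw0 x : (0 <= (f x * w x)%:E)%E by rewrite lee_fin mulr_ge0.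
have f0' x : (0 <= (f x)%:E)%E by rewrite lee_fin.
have q0' x : (0 <= (q x)%:E)%E by rewrite lee_fin.
have fe0 x r : (0 <= (f x * expR (- r * w x))%:E)%E.
  by rewrite lee_fin mulr_ge0// expR_ge0.
have scale (a : R) (g : T -> R) (G : R) : 0 <= a -> (forall x, 0 <= g x) ->
    (\Sum_(x) (g x)%:E)%E = G%:E -> (\Sum_(x) (a * g x)%:E)%E = (a * G)%:E.
  by move=> a0 g0 gG; rewrite EFinM -gG -sumZl ?lee_fin//; move=> x; rewrite lee_fin.
have sumR (g h : T -> R) (G H : R) : (forall x, 0 <= g x) -> (forall x, 0 <= h x) ->
    (\Sum_(x) (g x)%:E)%E = G%:E -> (\Sum_(x) (h x)%:E)%E = H%:E ->
    (\Sum_(x) (g x + h x)%:E)%E = (G + H)%:E.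
  by move=> g0 h0 gG hH; rewrite EFinD -gG -hH -sumD// => x; rewrite lee_fin.
have leR (g h : T -> R) (G H : R) : (forall x, g x <= h x) ->
    (\Sum_(x) (g x)%:E)%E = G%:E -> (\Sum_(x) (h x)%:E)%E = H%:E -> G <= H.
  by move=> gh gG hH; rewrite -lee_fin -gG -hH; apply: le_sum => x; rewrite lee_fin.
have EE := exp_sum_finw; have FE := exp_sum_fin1; rewrite -/E in EE.
set F := fine (\Sum_(x) (f x)%:E)%E in FE.
have fwx x : 0 <= f x * w x by rewrite mulr_ge0.
have fex x r : 0 <= f x * expR (- r * w x) by rewrite mulr_ge0// expR_ge0.
apply: (@is_derive_quadratic _ _ _ (c * Q) (dl / 2)) => [|r rd]; first by rewrite divr_gt0.
rewrite add0r; have -> : fine (\Sum_(x) (f x * expR (- 0 * w x))%:E)%E = F.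
  by congr fine; apply: eq_sum => x; rewrite oppr0 mul0r expR0 mulr1.
have PE := finr r rd; set Ph := fine _ in PE *.
have r2 : 0 <= r ^+ 2 by apply: sqr_ge0.
have cQ : (\Sum_(x) (r ^+ 2 * (c * q x))%:E)%E = (r ^+ 2 * (c * Q))%:E.
  by apply: (scale) => //; [move=> x; rewrite mulr_ge0|apply: (scale)].
have cq0 x : 0 <= r ^+ 2 * (c * q x) by apply: mulr_ge0 => //; apply: mulr_ge0.
(* The linear term is put on the side where it is nonnegative, since only sums of nonnegative terms
   are added. *)
have [r0|/ltW r0] := leP 0 r.
  have rE := scale _ _ _ r0 fwx EE.
  have rfw x : 0 <= r * (f x * w x) by rewrite mulr_ge0.
  have a1 := sumR _ _ _ _ (fex ^~ r) rfw PE rE.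
  have a2 := sumR _ _ _ _ f0 cq0 FE cQ.
  have l1 : F <= Ph + r * E by apply: leR FE a1 => x; have := lo x r; lra.
  have l2 : Ph + r * E <= F + r ^+ 2 * (c * Q).
    by apply: leR a1 a2 => x; have := up x r rd; lra.
  by rewrite ler_norml; apply/andP; split; lra.
have rE := scale (- r) _ _ _ fwx EE.
have nr0 : 0 <= - r by lra.
have {}rE := rE nr0.
have rfw x : 0 <= - r * (f x * w x) by rewrite mulr_ge0.
have a1 := sumR _ _ _ _ f0 rfw FE rE.
have a10 x : 0 <= f x + - r * (f x * w x) by rewrite addr_ge0.
have a2 := sumR _ _ _ _ a10 cq0 a1 cQ.
have l1 : F + - r * E <= Ph by apply: leR a1 PE => x; have := lo x r; lra.
have l2 : Ph <= F + - r * E + r ^+ 2 * (c * Q).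
  by apply: leR PE a2 => x; have := up x r rd; lra.
by rewrite ler_norml; apply/andP; split; lra.
Qed.

End ExpSum.
End Calculus.

Lemma fine_add1 (R : realType) (S T : \bar R) : (0 <= T)%E -> (S < +oo)%E ->
  S = (1 + T)%E -> 1 + fine T = fine S.
Proof.
move=> T0 Soo SE; have Tfin : T \is a fin_num.
  by rewrite ge0_fin_numE//; apply: le_lt_trans Soo; rewrite SE leeDr.
by rewrite SE fineD.
Qed.

(** * The partial derivatives of [entropy_g] at the point (0, 1) *)

Section Derivatives.
Context {R : realType} {N : nat} {V : 'I_N -> countType} (o : forall i, V i).
Context (p : forall i, V i -> V i -> R) (alpha : 'I_N -> R).
Hypothesis hN : (2 <= N)%N.
Hypothesis hp : forall i, stochastic (@p i).
Hypothesis hreach : forall i x, exists n : nat, 0 < nstep (@p i) n (o i) x.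
Hypothesis hloop : forall i (x : V i), p x x = 0.
Hypothesis hunif : forall i, uniformly_irreducible (@p i).
Hypothesis ha : forall i, 0 < alpha i.
Hypothesis ha1 : \sum_(i < N) alpha i = 1.
Context (d : measure_display) (Omega : measurableType d) (Pr : probability Omega R).
Context (X : nat -> Omega -> free_product o).
Hypothesis hX : markov_chain Pr (fp_trans p alpha) (fp_root o) X.
Hypothesis hR : (1 < green_radius (@fp_trans R N V o p alpha))%E.
Local Notation green_gf := (green_gf o p alpha).
Local Notation greenr := (greenr o p alpha).
Local Notation returnr := (returnr o p alpha).
Local Notation other_returnr := (other_returnr o p alpha).
Local Notation total_returnr := (total_returnr o p alpha).
Local Notation xir := (xir o p alpha).
Local Notation last_sum := (last_sum o p alpha).
Implicit Types (i k : 'I_N) (z : R).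

Let fin1 : (green_gf 1 [::] < +oo)%E. Proof. exact: green_gf1_fin. Qed.

Definition last_weight i (v : V i) := last_visit (@p i) (o i) v (xir 1 i).
(* Since last visit weights can exceed 1, minus their logarithm is shifted by an
   upper bound so as to stay nonnegative. *)
Definition log_bound i := ln (1 - xir 1 i)^-1.
Definition log_deficit i (v : V i) := log_bound i - ln (last_weight v).
Definition log_deficit_sum i := fine (\Sum_(v : V i) (last_weight v * log_deficit v)%:E)%E.
(** This is minus the sum of [last_weight v * ln (last_weight v)] over [V i], as a difference of two
    sums of nonnegative terms. *)
Definition letter_entropy i := log_deficit_sum i - log_bound i * last_sum 1 i.

Lemma xir1_gt0 i : 0 < xir 1 i.
Proof.
by rewrite /xir mulr1 divr_gt0// subr_gt0 other_returnr_lt1.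
Qed.

Lemma xir1_itv i : 0 < xir 1 i < 1.
Proof. by rewrite xir1_gt0 xir1_lt1. Qed.

Let tt i : 0 <= xir 1 i < 1.
Proof. by case/andP: (xir1_itv i) => /ltW -> ->. Qed.

Lemma last_weightE i (v : V i) : (last_weight v)%:E = last_visit_gf (@p i) (o i) v (xir 1 i).
Proof. by apply: last_visitE. Qed.

Lemma last_weight_gt0 i (v : V i) : 0 < last_weight v.
Proof.
by have [? [? [_]]] := last_visit_gf_power_summable (hp i) (xir1_itv i) (hunif i) (@hreach i); apply.
Qed.

Lemma last_weight_le i (v : V i) : ln (last_weight v) <= log_bound i.
Proof.
have t1 : 0 < 1 - xir 1 i by rewrite subr_gt0; case/andP: (tt i).
rewrite ler_ln ?posrE ?last_weight_gt0 ?invr_gt0// -lee_fin last_weightE.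
exact: last_visit_gf_le.
Qed.

Lemma log_deficit_ge0 i (v : V i) : 0 <= log_deficit v.
Proof. by rewrite subr_ge0 last_weight_le. Qed.

Lemma log_bound_ge0 i : 0 <= log_bound i.
Proof.
have /andP[t0 t1] := tt i.
by rewrite ln_ge0// -[leLHS]invr1 lef_pV2 ?posrE ?subr_gt0// gerBl.
Qed.

Lemma last_weight_root i : last_weight (o i) = 1.
Proof.
have /andP[t0 t1] := tt i.
by apply/EFin_inj; rewrite last_weightE last_visit_gf_root.
Qed.

(** Up to the constant [expR (dl * log_bound i)] the summand is [last_weight v] to the power
    [1 - dl], which [last_visit_gf_power_summable] controls. *)
Lemma exp_moment i : exists2 dl : R, 0 < dl &
  (\Sum_(v : V i) (last_weight v * expR (dl * log_deficit v))%:E < +oo)%E.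
Proof.
have [dl [s [[dl0 s01 H] _]]] := last_visit_gf_power_summable (hp i) (xir1_itv i) (hunif i) (@hreach i).
exists dl => //.
apply: (@le_lt_trans _ _ ((expR (dl * log_bound i))%:E * \Sum_(v : V i) last_visit_gf (@p i) (o i) v s)%E).
  have s0 : 0 <= s by case/andP: s01.
  rewrite -sumZl ?lee_fin ?expR_ge0//; last by move=> v; apply: last_visit_gf_ge0.
  apply: le_sum => v; apply: le_trans (lee_wpmul2l _ (H v)); last by rewrite lee_fin expR_ge0.
  rewrite -EFinM lee_fin -/(last_weight v) /powR gt_eqF ?last_weight_gt0// -{1}[last_weight v]lnK ?posrE ?last_weight_gt0//.
  by rewrite -!expRD ler_expR /log_deficit; lra.
apply: lte_mul_pinfty; rewrite ?lee_fin ?expR_ge0//.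
by apply: le_lt_trans (last_visit_gf_sum_le (hp i) (o i) s01) _; rewrite ltry.
Qed.

Lemma last_weight_sum i : (\Sum_(v : V i) (last_weight v)%:E)%E = (last_sum 1 i)%:E.
Proof.
rewrite -(last_sumE hp ha ler01 fin1); last by case/andP: (tt i).
by apply: eq_sum => v; rewrite last_weightE.
Qed.

Lemma log_deficit_sumE i : (\Sum_(v : V i) (last_weight v * log_deficit v)%:E)%E = (log_deficit_sum i)%:E.
Proof.
have [dl dl0 fin] := exp_moment i.
by apply: (exp_sum_finw _ _ dl0 fin) => v; rewrite ?log_deficit_ge0// ltW// last_weight_gt0.
Qed.

Lemma sum_root i (f : V i -> \bar R) : (forall v, (0 <= f v)%E) ->
  (\Sum_(v : V i) f v = f (o i) + \esum_(v in [set v : V i | v != o i]) f v)%E.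
Proof.
move=> f0; rewrite (esumID [set o i])// setTI esum_set1//; congr (_ + _)%E.
rewrite setTI; congr esum.
by apply/seteqP; split => v /= /eqP.
Qed.

(** The added 1 is the term of the root, whose last visit function is 1 at every parameter. *)
Lemma Lplus_sum i r z : xi alpha Pr X i z = xir z i -> 0 <= xir z i < 1 ->
  let S := (\Sum_(v : V i) (last_visit (@p i) (o i) v (xir z i) * last_weight v `^ r)%:E)%E in
  (S < +oo)%E -> 1 + Lplus p alpha Pr X i r z = fine S.
Proof.
move=> xz tz S Soo.
have l0 v : 0 <= last_visit (@p i) (o i) v (xir z i).
  by rewrite -lee_fin last_visitE//; apply: last_visit_gf_ge0 => //; case/andP: tz.
have x1 : xi alpha Pr X i 1 = xir 1 i by apply: xiE.
have f0 v : (0 <= (last_visit (@p i) (o i) v (xir z i) * last_weight v `^ r)%:E)%E.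
  by rewrite lee_fin mulr_ge0// powR_ge0.
have lo : last_visit (@p i) (o i) (o i) (xir z i) = 1.
  by apply/EFin_inj; rewrite last_visitE// last_visit_gf_root//; case/andP: tz.
have SE : S = (1 + \esum_(v in [set v : V i | v != o i])
    (last_visit (@p i) (o i) v (xir z i) * last_weight v `^ r)%:E)%E.
  rewrite [LHS](sum_root f0); congr (_ + _)%E.
  by rewrite last_weight_root powR1 mulr1 lo.
have LE : Lplus p alpha Pr X i r z = fine (\esum_(v in [set v : V i | v != o i])
    (last_visit (@p i) (o i) v (xir z i) * last_weight v `^ r)%:E)%E.
  by rewrite /Lplus xz x1 /last_weight.
rewrite LE; apply: fine_add1 Soo SE; exact: esum_ge0.
Qed.

Lemma Lplus_0 i z : xi alpha Pr X i z = xir z i -> 0 <= xir z i < 1 ->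
  1 + Lplus p alpha Pr X i 0 z = last_sum z i.
Proof.
move=> xz /[dup] tz /andP[t0 t1].
have e : (\Sum_(v : V i) (last_visit (@p i) (o i) v (xir z i) * last_weight v `^ 0)%:E =
    \Sum_(v : V i) last_visit_gf (@p i) (o i) v (xir z i))%E.
  by apply: eq_sum => v; rewrite powRr0 mulr1 last_visitE.
rewrite Lplus_sum// e//.
by apply: le_lt_trans (last_visit_gf_sum_le (hp i) (o i) tz) _; rewrite ltry.
Qed.

Lemma Lplus_ge0 i r z : 0 <= xir z i < 1 -> xi alpha Pr X i z = xir z i ->
  0 <= Lplus p alpha Pr X i r z.
Proof.
move=> tz xz; rewrite /Lplus fine_ge0// esum_ge0// => v _.
rewrite lee_fin mulr_ge0 ?powR_ge0// -lee_fin xz last_visitE//.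
by apply: last_visit_gf_ge0 => //; case/andP: tz.
Qed.

Lemma entropy_gE r z : (forall i, 0 <= xir z i < 1) ->
  (forall i, xi alpha Pr X i z = xir z i) ->
  entropy_g p alpha Pr X r z =
  1 - \sum_(i < N) (1 - (1 + Lplus p alpha Pr X i r z)^-1).
Proof.
move=> tz xz; congr (_ - _); apply: eq_bigr => i _.
have l0 := Lplus_ge0 r (tz i) (xz i).
by field; rewrite gt_eqF// ltr_wpDr.
Qed.

(** By [last_sum_eq] each fraction is [1 - greenr z * (1 - other_returnr i z - alpha i * z)]. Since
    [greenr z * (1 - total_returnr z) = 1], only the sums of [returnr i z] and of [alpha i * z]
    survive, and the latter is [z]. *)
Lemma entropy_g0 z : 0 <= z -> (green_gf z [::] < +oo)%E -> (forall i, xir z i < 1) ->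
  entropy_g p alpha Pr X 0 z = (1 - z) * greenr z.
Proof.
move=> z0 fin t1.
have tz i : 0 <= xir z i < 1 by rewrite t1 xir_ge0.
have xz i : xi alpha Pr X i z = xir z i by apply: xiE.
have u1 := total_returnr_lt1 hp ha z0 fin; have gu := greenr_renewal hp ha z0 fin.
rewrite entropy_gE//.
have e i : 1 - (1 + Lplus p alpha Pr X i 0 z)^-1 = 1 - greenr z * (1 - other_returnr i z - alpha i * z).
  rewrite Lplus_0//; congr (_ - _).
  have l1 := last_sum_ge1 hp ha z0 fin (t1 i).
  have l0 : last_sum z i != 0 by rewrite gt_eqF// (lt_le_trans ltr01).
  apply: (mulfI l0); rewrite divff// mulrCA (last_sum_eq hp ha z0 fin)//.
rewrite (eq_bigr _ (fun i _ => e i)).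
have -> : \sum_(i < N) (1 - greenr z * (1 - other_returnr i z - alpha i * z)) =
   \sum_(i < N) ((1 - greenr z * (1 - total_returnr z)) - greenr z * (returnr i z - alpha i * z)).
  by apply: eq_bigr => i _; rewrite other_returnrE; ring.
rewrite gu subrr big_split /= big1// add0r sumrN -mulr_sumr sumrB -mulr_suml ha1 -/(total_returnr z) mul1r.
by move: gu; lra.
Qed.

Lemma entropy_g_s_derive :
  is_derive 0 (1 : R) (fun s : R => entropy_g p alpha Pr X 0 (expR (- s))) (greenr 1).
Proof.
have [e e0 near1] := xir_lt1_near hN hp hloop ha ha1 hR.
have [C [rho [rho1 frho lip]]] := greenr_lipschitz hp ha ha1 hR.
pose K := expR 1 : R.
have K1 : 1 <= K by rewrite -[leLHS]expR0 ler_expR.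
have K0 : 0 < K by rewrite (lt_le_trans ltr01).
(* For [h] below 1 in absolute value, [expR (- h)] is within [K] times that value of 1; dividing by
   [K] keeps it below [1 + e] and [rho]. *)
pose e' := Num.min 1 (Num.min e (rho - 1) / K).
have e'0 : 0 < e' by rewrite lt_min ltr01 divr_gt0// lt_min e0; lra.
pose f (s : R) := (1 - expR (- s)) * greenr (expR (- s)).
have step h : `|h| < e' ->
    [/\ 0 <= expR (- h) <= rho, expR (- h) < 1 + e, `|h| <= 1 &
        `|expR (- h) - 1| <= K * `|h|].
  rewrite lt_min => /andP[h1]; rewrite ltr_pdivlMr// lt_min => /andP[he returnr].
  have b : `|expR (- h) - 1| <= K * `|h|.
    apply: le_trans (expR_bound1 (- h)) _; rewrite normrN mulrC ler_wpM2r//.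
    by rewrite ler_expR ltW.
  have b' := le_trans (ler_norm _) b.
  split; [|lra|exact: ltW|exact: b].
  by rewrite expR_ge0 /=; lra.
have fE h : `|h| < e' -> entropy_g p alpha Pr X 0 (expR (- h)) = f h.
  move=> /step[/andP[z0 _] ze _ _]; apply: entropy_g0 => //.
    have i0 : 'I_N by exact: Ordinal (leq_trans (ltn0Sn 0) (ltnW hN)).
    by have [] := near1 (expR (- h)) i0; rewrite ?z0.
  by move=> i; have [] := near1 (expR (- h)) i; rewrite ?z0.
have C0 : 0 <= C.
  have := lip rho; rewrite lexx (le_trans ler01 (ltW rho1)) => /(_ isT).
  have := normr_ge0 (greenr rho - greenr 1); have : 0 < `|rho - 1| by rewrite normr_gt0; lra.
  by nra.
apply: (@is_derive_quadratic _ _ _ _ (K * (greenr 1 + C * K) + C * K) e') => // h he.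
rewrite add0r !fE ?normr0// /f oppr0 expR0 subrr mul0r subr0.
have [zr _ h1 zk] := step h he; have lz := lip _ zr.
set z := expR (- h) in zr zk lz *.
have lz' : `|greenr z - greenr 1| <= C * K * `|h|.
  by apply: le_trans lz _; rewrite -mulrA ler_wpM2l.
have gz : `|greenr z| <= greenr 1 + C * K.
  have g1 : 0 <= greenr 1 by apply: (le_trans ler01); apply: greenr_ge1.
  rewrite -[greenr z](subrK (greenr 1)); apply: (le_trans (ler_normD _ _)).
  rewrite addrC (ger0_norm g1) lerD2l; apply: le_trans lz' _.
  by rewrite ler_piMr// mulr_ge0// ltW.
have zb : `|1 - z - h| <= K * h ^+ 2.
  have := expR_bound2 (- h); have := expR_ge1Dx (- h); rewrite -/z sqrrN normrN => lo up.
  have ek : expR `|h| <= K by rewrite ler_expR.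
  have : h ^+ 2 * expR `|h| <= K * h ^+ 2 by rewrite mulrC ler_wpM2r// sqr_ge0.
  by rewrite ler_norml => ?; apply/andP; split; nra.
have -> : (1 - z) * greenr z - h * greenr 1 = (1 - z - h) * greenr z + h * (greenr z - greenr 1) by ring.
apply: (le_trans (ler_normD _ _)); rewrite !normrM mulrDl; apply: lerD.
  rewrite mulrAC; apply: ler_pM => //.
apply: (@le_trans _ _ (`|h| * (C * K * `|h|))); first by rewrite ler_wpM2l.
by rewrite mulrCA -expr2 real_normK ?num_real.
Qed.

(** The power [last_weight v ^ r] is [expR (log_bound i * r)] times an exponential of
    [- r * log_deficit v]. The first factor does not depend on [v], [exp_sum_derive] applies to the
    sum of the others, and the product rule recombines them into [letter_entropy]. *)
Lemma Lplus_derive i : is_derive 0 (1 : R)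
  (fun r : R => 1 + Lplus p alpha Pr X i r 1) (- letter_entropy i).
Proof.
have [dl dl0 fin] := exp_moment i.
have l0 (v : V i) : 0 <= last_weight v by rewrite ltW// last_weight_gt0.
pose Phi (r : R) := fine (\Sum_(v : V i) (last_weight v * expR (- r * log_deficit v))%:E)%E.
have dPhi := exp_sum_derive l0 (@log_deficit_ge0 i) dl0 fin; rewrite -/Phi -/(log_deficit_sum i) in dPhi.
have dE : is_derive 0 (1 : R) (fun r : R => expR (log_bound i * r)) (log_bound i).
  have : is_derive 0 (1 : R) (expR \o (fun r : R => log_bound i *: r)) (expR (log_bound i *: 0) * (log_bound i *: 1)).
    by apply: is_derive1_comp.
  by rewrite scaler0 expR0 mul1r [_ *: 1]mulr1.
have P0 : Phi 0 = last_sum 1 i.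
  rewrite /Phi -[RHS]/(fine (last_sum 1 i)%:E) -last_weight_sum; congr fine.
  by apply: eq_sum => v; rewrite oppr0 mul0r expR0 mulr1.
have := is_deriveM dE dPhi.
rewrite P0 mulr0 expR0 scale1r (_ : - log_deficit_sum i + _ = - letter_entropy i); last first.
  by rewrite /letter_entropy /GRing.scale /=; ring.
apply: near_eq_is_derive; near=> r.
have rd : `|r| < dl.
  by near: r; exists dl => //= y; rewrite /ball_ /= sub0r normrN.
have Pfin : (\Sum_(v : V i) (last_weight v * expR (- r * log_deficit v))%:E < +oo)%E.
  apply: le_lt_trans fin; apply: le_sum => v.
  rewrite lee_fin ler_wpM2l// ler_expR ler_wpM2r ?log_deficit_ge0//.
  by apply: le_trans (ltW rd); rewrite -normrN ler_norm.
have SE : (\Sum_(v : V i) (last_visit (@p i) (o i) v (xir 1 i) * last_weight v `^ r)%:E =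
    (expR (log_bound i * r))%:E * \Sum_(v : V i) (last_weight v * expR (- r * log_deficit v))%:E)%E.
  rewrite -sumZl ?lee_fin ?expR_ge0//; last first.
    by move=> v; rewrite lee_fin mulr_ge0// expR_ge0.
  apply: eq_sum => v; rewrite -EFinM -/(last_weight v) mulrCA -expRD; congr (_ * _)%:E.
  rewrite /powR gt_eqF ?last_weight_gt0//; congr expR; rewrite /log_deficit; ring.
rewrite Lplus_sum//; last 2 first.
- by apply: xiE.
- by rewrite SE lte_mul_pinfty ?lee_fin ?expR_ge0.
rewrite SE fineM// ge0_fin_numE//.
by apply: sum_ge0 => v; rewrite lee_fin mulr_ge0// expR_ge0.
Unshelve. all: by end_near. Qed.

Lemma entropy_g_r_derive :
  is_derive 0 (1 : R) (fun r : R => entropy_g p alpha Pr X r 1)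
    (\sum_(i < N) letter_entropy i / last_sum 1 i ^+ 2).
Proof.
have x1 i : xi alpha Pr X i 1 = xir 1 i by apply: xiE.
have -> : (fun r : R => entropy_g p alpha Pr X r 1) =
    cst 1 - \sum_(i < N) (cst 1 - (fun r => (1 + Lplus p alpha Pr X i r 1)^-1)).
  apply/funext => r; rewrite entropy_gE//=; congr (_ - _).
  by rewrite fct_sumE.
have l1 i : 1 + Lplus p alpha Pr X i 0 1 = last_sum 1 i by apply: Lplus_0.
have D : is_derive 0 (1 : R)
  (cst 1 - \sum_(i < N) (cst 1 - (fun r => (1 + Lplus p alpha Pr X i r 1)^-1)))
  (0 - \sum_(i < N) (0 - (- (last_sum 1 i) ^- 2 *: (- letter_entropy i)))).
  apply: is_deriveB; apply: is_derive_sum => i; apply: is_deriveB.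
  rewrite -(l1 i); apply: is_deriveV; last exact: Lplus_derive.
  by rewrite l1 gt_eqF// (lt_le_trans ltr01)// last_sum_ge1//; case/andP: (tt i).
apply: is_derive_eq D _.
rewrite sub0r -sumrN; apply: eq_bigr => i _.
by rewrite sub0r opprK scaleNr scalerN opprK /GRing.scale /= mulrC.
Qed.

End Derivatives.

(** * Averages of additive functionals *)

Section Cesaro.
Context {R : realType}.
Implicit Types (a b tau psi lam : nat -> R) (L s Q : R).

Definition rconv a b n := \sum_(k < n.+1) a k * b (n - k)%N.

Definition psum a n := \sum_(k < n) a k.

Lemma psumS a n : psum a n.+1 = psum a n + a n.
Proof. by rewrite /psum big_ord_recr. Qed.

Lemma psum_le a n m : (forall k, 0 <= a k) -> (n <= m)%N -> psum a n <= psum a m.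
Proof.
move=> a0 nm; rewrite /psum -!(big_mkord xpredT) (big_cat_nat (leq0n n) nm) /=.
by rewrite lerDl sumr_ge0.
Qed.

Lemma psum_conv a b n : psum (rconv a b) n = \sum_(k < n) a k * psum b (n - k).
Proof.
elim: n => [|n IH]; first by rewrite /psum !big_ord0.
have b1 : psum b 1 = b 0%N by rewrite /psum big_ord1.
rewrite psumS IH [RHS]big_ord_recr/= subSnn b1.
rewrite /rconv big_ord_recr/= subnn addrA -big_split/=; congr (_ + _).
apply: eq_bigr => k _; rewrite -mulrDr; congr (_ * _).
by rewrite (subSn (ltnW (ltn_ord k))) psumS.
Qed.

Lemma psum_conv_le a b n B : (forall k, 0 <= a k) -> (forall k, psum b k <= B) ->
  psum (rconv a b) n <= psum a n * B.
Proof.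
move=> a0 bB; rewrite psum_conv [psum a n]/psum mulr_suml; apply: ler_sum => k _.
by rewrite ler_wpM2l.
Qed.

(** Only the first [K] terms of [b] are kept. They are all available to the indices [k <= n - K],
    and the discarded indices carry at most [K] because [a] is bounded by 1. *)
Lemma psum_conv_ge a b n K : (forall k, 0 <= a k <= 1) -> (forall k, 0 <= b k) ->
  (psum a n - K%:R) * psum b K <= psum (rconv a b) n.
Proof.
move=> a01 b0; have a0 k : 0 <= a k by case/andP: (a01 k).
have pb0 k : 0 <= psum b k by apply: sumr_ge0.
have [nK|Kn] := leqP n K.
  apply: (@le_trans _ _ 0); last first.
    by rewrite psum_conv sumr_ge0// => k _; rewrite mulr_ge0.
  rewrite mulr_le0_ge0// subr_le0; apply: (@le_trans _ _ n%:R); last by rewrite ler_nat.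
  rewrite /psum -[n in n%:R]card_ord -sum1_card natr_sum; apply: ler_sum => k _.
  by case/andP: (a01 k).
have le1 : psum a n - K%:R <= psum a (n - K).
  rewrite lerBlDr /psum -!(big_mkord xpredT) (big_cat_nat (leq0n (n - K)) (leq_subr K n)) /=.
  rewrite lerD2l; apply: (@le_trans _ _ (\sum_(n - K <= i < n) 1)).
    by apply: ler_sum => k _; case/andP: (a01 k).
  by rewrite big_const_nat iter_addr_0 subKn// ltnW.
apply: le_trans (ler_wpM2r (pb0 K) le1) _.
rewrite psum_conv [psum a _]/psum mulr_suml -(big_mkord xpredT (fun k => a k * psum b K)).
rewrite -(big_mkord xpredT (fun k => a k * psum b (n - k))).
rewrite [leRHS](big_cat_nat (leq0n (n - K)) (leq_subr K n)) /=.
rewrite -[leLHS]addr0 lerD//; last by rewrite sumr_ge0// => k _; rewrite mulr_ge0.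
rewrite [leLHS]big_nat_cond [leRHS]big_nat_cond; apply: ler_sum => k /andP[/andP[_ kn] _].
rewrite ler_wpM2l// psum_le// leq_subRL; last by rewrite ltnW// (leq_trans kn)// leq_subr.
by rewrite addnC -leq_subRL ltnW// .
Qed.

Lemma renewal_average tau lam L : (forall k, 0 <= tau k <= 1) ->
  (forall k, 0 <= lam k) -> 0 < L -> psum lam @ \oo --> L ->
  (forall n, rconv tau lam n = 1) ->
  (fun n => psum tau n / n%:R) @ \oo --> L^-1.
Proof.
move=> t01 l0 L0 lL t1.
have ple k : psum lam k <= L.
  rewrite -(cvg_lim (@Rhausdorff R) lL); apply: nondecreasing_cvgn_le.
    by move=> n m nm; apply: psum_le.
  by apply/cvg_ex; exists L.
have t0 k : 0 <= tau k by case/andP: (t01 k).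
have D n : psum (rconv tau lam) n = n%:R.
  rewrite /psum (eq_bigr (fun=> 1)) => [|k _]; last exact: t1.
  by rewrite big_const_ord iter_addr_0.
have lLV : (fun k => (psum lam k)^-1) @ \oo --> L^-1 by apply: cvgV => //; rewrite gt_eqF.
apply/cvgrPdist_le => e e0.
have e2 : 0 < e / 2 by rewrite divr_gt0.
have [K [K0 HK]] : exists K, 0 < psum lam K /\ (psum lam K)^-1 <= L^-1 + e / 2.
  have H1 : \forall k \near \oo, 0 < psum lam k by apply: (cvgr_gt _ lL).
  have H2 : \forall k \near \oo, (psum lam k)^-1 <= L^-1 + e / 2.
    by apply: (cvgr_le _ lLV); rewrite ltrDl.
  have [K _ HK] := filterI H1 H2.
  by exists K; have := HK K; apply => /=.
near=> n.
have n0 : 0 < n%:R :> R by rewrite ltr0n; near: n; exists 1%N.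
have nK : K%:R / (e / 2) <= n%:R by near: n; apply: nbhs_infty_ger.
have up := psum_conv_le n t0 ple; have lo := psum_conv_ge n K t01 l0.
rewrite D in up lo.
have s1 : L^-1 <= psum tau n / n%:R.
  by rewrite ler_pdivlMr// ler_pdivrMl// mulrC.
have s2 : psum tau n / n%:R <= L^-1 + e.
  rewrite ler_pdivrMr//; move: nK; rewrite ler_pdivrMr// => nK.
  have : psum tau n - K%:R <= n%:R * (psum lam K)^-1 by rewrite ler_pdivlMr.
  have : n%:R * (psum lam K)^-1 <= n%:R * (L^-1 + e / 2) by rewrite ler_pM2l.
  lra.
by rewrite ler0_norm; lra.
Unshelve. all: by end_near. Qed.

(** The bounds for convolutions replace [psi] by its total mass [Q], up to its tail and a boundary
    term of order [K]. *)
Lemma conv_average tau psi s Q : (forall k, 0 <= tau k <= 1) ->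
  (forall k, 0 <= psi k) -> psum psi @ \oo --> Q ->
  (fun n => psum tau n / n%:R) @ \oo --> s ->
  (fun n => psum (rconv tau psi) n / n%:R) @ \oo --> s * Q.
Proof.
move=> t01 p0 pQ ts.
have ple k : psum psi k <= Q.
  rewrite -(cvg_lim (@Rhausdorff R) pQ); apply: nondecreasing_cvgn_le.
    by move=> n m nm; apply: psum_le.
  by apply/cvg_ex; exists Q.
have t0 k : 0 <= tau k by case/andP: (t01 k).
have pp k : 0 <= psum psi k by apply: sumr_ge0.
have Q0 : 0 <= Q by apply: le_trans (pp 0%N) (ple 0%N).
have av01 n : 0 <= psum tau n / n%:R <= 1.
  have [->|n0] := eqVneq n 0%N; first by rewrite invr0 mulr0 lexx ler01.
  have nn : 0 < n%:R :> R by rewrite ltr0n lt0n.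
  rewrite divr_ge0 ?sumr_ge0//= ler_pdivrMr// mul1r.
  rewrite /psum -[X in X%:R]card_ord -sum1_card natr_sum; apply: ler_sum => k _.
  by case/andP: (t01 k).
apply/cvgrPdist_le => e e0.
have e3 : 0 < e / 3 by rewrite divr_gt0.
have [K HK] : exists K, Q - e / 3 <= psum psi K.
  have [K _ HK] : \forall k \near \oo, Q - e / 3 <= psum psi k.
    by apply: (cvgr_ge _ pQ); rewrite gtrBl.
  by exists K; apply: HK => /=.
near=> n.
have n0 : 0 < n%:R :> R by rewrite ltr0n; near: n; exists 1%N.
have nK : K%:R * Q / (e / 3) <= n%:R by near: n; apply: nbhs_infty_ger.
(* The denominator is [Q + 1] because [Q] may vanish. *)
have sn : `|s - psum tau n / n%:R| <= e / 3 / (Q + 1).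
  by near: n; move/cvgrPdist_le: ts; apply; rewrite divr_gt0// ltr_wpDl.
have up := psum_conv_le n t0 ple; have lo := psum_conv_ge n K t01 p0.
set c := psum (rconv tau psi) n in up lo *; set t := psum tau n / n%:R in sn.
have tE : psum tau n = t * n%:R by rewrite divfK// gt_eqF.
have /andP[tt0 tt1] := av01 n; rewrite -/t in tt0 tt1.
rewrite tE in up lo.
have cE : c = c / n%:R * n%:R by rewrite divfK// gt_eqF.
set u := c / n%:R in cE *; rewrite cE in up lo.
have u1 : u <= t * Q by rewrite -(ler_pM2r n0); lra.
have u2 : t * Q - 2 * (e / 3) <= u.
  rewrite -(ler_pM2r n0); apply: le_trans lo.
  move: nK; rewrite ler_pdivrMr// => nK.
  have k1 : K%:R * psum psi K <= K%:R * Q by rewrite ler_wpM2l// ler0n.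
  have : t * n%:R * (Q - e / 3) <= t * n%:R * psum psi K by rewrite ler_wpM2l// mulr_ge0// ltW.
  have : t * n%:R * (e / 3) <= n%:R * (e / 3) by rewrite ler_pM2r// ler_piMl// ltW.
  nra.
have s1 : `|s * Q - t * Q| <= e / 3.
  rewrite -mulrBl normrM (ger0_norm Q0).
  apply: (@le_trans _ _ (e / 3 / (Q + 1) * Q)); first by rewrite ler_wpM2r.
  by rewrite mulrAC ler_pdivrMr ?ltr_wpDl// ler_pM2l// lerDl.
move: s1; rewrite !ler_norml => /andP[s1 s2]; apply/andP; split; lra.
Unshelve. all: by end_near. Qed.

End Cesaro.

Lemma econv_EFin (R : realType) (a b : nat -> R) n :
  econv (EFin \o a) (EFin \o b) n = (rconv a b n)%:E.
Proof. by rewrite /econv /rconv -sumEFin; apply: eq_bigr => k _; rewrite EFinM. Qed.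

Lemma sum_psum_cvg (R : realType) (a : nat -> R) (M : R) : (forall n, 0 <= a n) ->
  (\Sum_(n) (a n)%:E)%E = M%:E -> psum a @ \oo --> M.
Proof.
move=> a0 aM; have [|c e] := sum_fin_cvg a0; first by rewrite aM ltry.
have <- : limn (series a) = M by apply/EFin_inj; rewrite -e.
have -> : psum a = series a by apply/funext => n; rewrite /series/= big_mkord.
exact: c.
Qed.

(** * Linear growth of the mean of an additive functional of the word *)

Section Additive.
Context {R : realType} {N : nat} {V : 'I_N -> countType} (o : forall i, V i).
Context (p : forall i, V i -> V i -> R) (alpha : 'I_N -> R).
Hypothesis hN : (2 <= N)%N.
Hypothesis hp : forall i, stochastic (@p i).
Hypothesis hreach : forall i x, exists n : nat, 0 < nstep (@p i) n (o i) x.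
Hypothesis hloop : forall i (x : V i), p x x = 0.
Hypothesis hunif : forall i, uniformly_irreducible (@p i).
Hypothesis ha : forall i, 0 < alpha i.
Hypothesis ha1 : \sum_(i < N) alpha i = 1.
Context (d : measure_display) (Omega : measurableType d) (Pr : probability Omega R).
Context (X : nat -> Omega -> free_product o).
Hypothesis hX : markov_chain Pr (fp_trans p alpha) (fp_root o) X.
Hypothesis hR : (1 < green_radius (@fp_trans R N V o p alpha))%E.
Local Notation green_gf := (green_gf o p alpha).
Local Notation last_gf := (last_gf o p alpha).
Local Notation letter := (letter o).
Local Notation greenr := (greenr o p alpha).
Local Notation other_returnr := (other_returnr o p alpha).
Local Notation xir := (xir o p alpha).
Local Notation last_sum := (last_sum o p alpha).
Implicit Types (i k : 'I_N) (z : R).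
Local Notation W := (seq {i : 'I_N & V i}).
Local Notation FP := (free_product o).
Local Notation P := (@fp_trans R N V o p alpha).
Local Notation walk := (walk o p alpha).
Local Notation walk_taboo := (walk_taboo o p alpha).
Local Notation last_weight := (last_weight o p alpha).
Local Open Scope ereal_scope.

Let fin1 : green_gf 1 [::] < +oo. Proof. exact: green_gf1_fin. Qed.
Let p0 i (x y : V i) : 0 <= (p x y)%:E. Proof. exact: kernel_ge0. Qed.
Let a0 i : 0 <= (alpha i)%:E. Proof. by rewrite lee_fin ltW. Qed.
Let pw0 n (x : W) : 0 <= walk n x. Proof. exact: walk_ge0. Qed.
Let tw0 n (x : W) : 0 <= walk_taboo n x. Proof. exact: walk_taboo_ge0. Qed.
Let P0 x y : 0 <= (P x y)%:E. Proof. exact: fp_trans_ge0. Qed.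
Local Hint Resolve p0 a0 pw0 tw0 P0 : core.

Definition tauE k n := \Sum_(s : FP) (if fp_type s != Some k then walk n (fp_word s) else 0).

Definition psiE k (psi : V k -> \bar R) m := \Sum_(v : V k) (walk_taboo m (letter v) * psi v).

Lemma tauE_ge0 k n : 0 <= tauE k n.
Proof. by apply: sum_ge0 => s; case: ifP. Qed.
Local Hint Resolve tauE_ge0 : core.

Lemma psiE_ge0 k (psi : V k -> \bar R) m : (forall v, 0 <= psi v) -> 0 <= psiE psi m.
Proof. by move=> psi0; apply: sum_ge0 => v; rewrite mule_ge0. Qed.

(** [walk_cat] splits a trajectory to [s v] at its last visit to the stem [s]. The second part does
    not depend on [s], so summing over the stems produces [tauE]. *)
Lemma coord_conv k (psi : V k -> \bar R) n : (forall v, 0 <= psi v) ->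
  \Sum_(y : FP) (walk n (fp_word y) * psi (word_coord o k (fp_word y))) =
  econv (tauE k) (psiE psi) n.
Proof.
move=> psi0; rewrite (sum_fp k); last by move=> y; rewrite mule_ge0.
transitivity (\Sum_(s : FP) \sum_(j < n.+1)
    ((if fp_type s != Some k then walk j (fp_word s) else 0) * psiE psi (n - j))).
  apply: eq_sum => s; case: ifPn => sk; last by rewrite big1// => j _; rewrite mul0e.
  transitivity (\Sum_(v : V k) \sum_(j < n.+1)
      (walk j (fp_word s) * (walk_taboo (n - j) (letter v) * psi v))).
    apply: eq_sum => v; rewrite fp_word_app// word_coord_app// letter_cat walk_cat//.
    rewrite /econv ge0_sume_distrl; last by move=> j _; rewrite mule_ge0.
    by apply: eq_bigr => j _; rewrite muleA.
  rewrite sum_big; last by move=> j v; rewrite !mule_ge0.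
  by apply: eq_bigr => j _; rewrite sumZl// => v; rewrite mule_ge0.
rewrite sum_big; last by move=> j s; rewrite mule_ge0// ?psiE_ge0//; case: ifP.
by apply: eq_bigr => j _; rewrite sumZr ?psiE_ge0// => s; case: ifP.
Qed.

Lemma walk_mass n : \Sum_(y : FP) walk n (fp_word y) = 1.
Proof.
rewrite -[RHS](@probability_setT _ _ _ Pr) (Pr_partition hX n)//.
by apply: eq_sum => y; rewrite setTI (law_walk hp ha ha1 hX).
Qed.

Lemma tauE_le1 k n : tauE k n <= 1.
Proof. by rewrite -(walk_mass n); apply: le_sum => s; case: ifP. Qed.

Lemma psiE_sum k (psi : V k -> \bar R) : (forall v, 0 <= psi v) ->
  \Sum_(m) psiE psi m = \Sum_(v : V k) ((last_weight v)%:E * psi v).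
Proof.
move=> psi0; rewrite sum_exchange; last by move=> m v; rewrite mule_ge0.
apply: eq_sum => v; rewrite sumZr//; congr (_ * _).
rewrite last_weightE// -last_gfE//; by rewrite /last_gf egf1.
Qed.

Lemma coord_average k (psi : V k -> \bar R) (M : R) : (forall v, 0 <= psi v) ->
  \Sum_(v : V k) ((last_weight v)%:E * psi v) = M%:E ->
  exists2 c : nat -> R, forall n,
    \Sum_(y : FP) (walk n (fp_word y) * psi (word_coord o k (fp_word y))) = (c n)%:E &
    (fun n => psum c n / n%:R)%R @ \oo --> ((last_sum 1 k)^-1 * M)%R.
Proof.
have tauF n : tauE k n = (fine (tauE k n))%:E.
  by rewrite fineK// ge0_fin_numE// (le_lt_trans (tauE_le1 k n))// ltry.
pose tau n := fine (tauE k n).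
have tauE' : tauE k = EFin \o tau by apply/funext => n; rewrite tauF.
have t01 n : (0 <= tau n <= 1)%R by rewrite -!lee_fin -tauF tauE_ge0 tauE_le1.
have key (f : V k -> \bar R) (Q : R) : (forall v, 0 <= f v) ->
    \Sum_(v : V k) ((last_weight v)%:E * f v) = Q%:E ->
    exists q : nat -> R, [/\ forall n, (0 <= q n)%R, psum q @ \oo --> Q &
      forall n, \Sum_(y : FP) (walk n (fp_word y) * f (word_coord o k (fp_word y))) =
        (rconv tau q n)%:E].
  move=> f0 fQ; have sQ := psiE_sum f0; rewrite fQ in sQ.
  have F n : psiE f n = (fine (psiE f n))%:E.
    rewrite fineK// ge0_fin_numE ?psiE_ge0//; apply: le_lt_trans (ltry Q).
    by rewrite -sQ; apply: sum_ge_term => m; apply: psiE_ge0.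
  have q0 n : (0 <= fine (psiE f n))%R by rewrite fine_ge0// psiE_ge0.
  exists (fun n => fine (psiE f n)); split => //.
    by apply: sum_psum_cvg => //; rewrite -sQ; apply: eq_sum => n; rewrite F.
  move=> n; rewrite coord_conv// -econv_EFin tauE'; congr (econv _ _ n).
  by apply/funext => m; rewrite /= -F.
move=> psi0 psiM.
have L0 : (0 < last_sum 1 k)%R.
  by rewrite (lt_le_trans ltr01)// last_sum_ge1// xir1_lt1.
(* Testing with the constant 1 gives the total mass of the law, which is the renewal equation for
   [tau]. *)
have [||lam [l0 lL cl]] := key (fun=> 1) (last_sum 1 k).
- by move=> v; rewrite lee_fin.
- by rewrite -last_weight_sum//; apply: eq_sum => v; rewrite mule1.
have lam1 n : rconv tau lam n = 1%R.
  apply/EFin_inj; rewrite -cl -[RHS](walk_mass n).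
  by apply: eq_sum => y; rewrite mule1.
have av := renewal_average t01 l0 L0 lL lam1.
have [q [q0 qM cq]] := key psi M psi0 psiM.
exists (rconv tau q) => //.
exact: conv_average.
Qed.

Section Functional.
Variable phi : forall i, V i -> R.
Hypothesis phi0 : forall i (v : V i), (0 <= phi v)%R.
Hypothesis phio : forall i, phi (o i) = 0%R.

Definition letter_sum (w : W) : R := (\sum_(a <- w) phi (tagged a))%R.

Lemma letter_sum_ge0 w : (0 <= letter_sum w)%R.
Proof. by apply: sumr_ge0 => a _. Qed.

Lemma letter_sum_app w k (u : V k) : letter_sum (word_app o w u) = (letter_sum w + phi u)%R.
Proof.
rewrite /word_app; case: eqP => [->|_]; first by rewrite phio addr0.
by rewrite /letter_sum -cats1 big_cat big_seq1.
Qed.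

Lemma letter_sum_split k (y : FP) : letter_sum (fp_word y) =
  (letter_sum (word_stem k (fp_word y)) + phi (word_coord o k (fp_word y)))%R.
Proof.
have [s [v [sk -> _]]] := fp_decomp y k.
by rewrite fp_word_app// word_stem_app// word_coord_app// letter_sum_app.
Qed.

Definition mean n := \Sum_(y : FP) (walk n (fp_word y) * (letter_sum (fp_word y))%:E).

Definition Pphi k (v : V k) := \Sum_(u : V k) ((p v u)%:E * (phi u)%:E).

Lemma Pphi_ge0 k (v : V k) : 0 <= Pphi v.
Proof. by apply: sum_ge0 => u; rewrite mule_ge0// lee_fin. Qed.

(** A step in factor [k] leaves the stem fixed and replaces the coordinate in [V k]; the decrease is
    put on the left to avoid a subtraction. *)
Lemma letter_sum_drift (y : FP) :
  \Sum_(x : FP) ((P y x)%:E * (letter_sum (fp_word x))%:E) +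
    \sum_(k < N) ((alpha k)%:E * (phi (word_coord o k (fp_word y)))%:E) =
  (letter_sum (fp_word y))%:E +
    \sum_(k < N) ((alpha k)%:E * Pphi (word_coord o k (fp_word y))).
Proof.
have aa w : 0 <= (letter_sum w)%:E by rewrite lee_fin letter_sum_ge0.
have ph i (v : V i) : 0 <= (phi v)%:E by rewrite lee_fin.
rewrite (fp_succ hp ha (F := fun w => (letter_sum w)%:E))//.
rewrite -big_split /=.
transitivity (\sum_(k < N) ((alpha k)%:E * ((letter_sum (fp_word y))%:E +
    Pphi (word_coord o k (fp_word y))))).
  apply: eq_bigr => k _; rewrite -ge0_muleDr//; last first.
    by apply: sum_ge0 => u; rewrite mule_ge0.
  congr (_ * _).
  transitivity (\Sum_(u : V k) ((p (word_coord o k (fp_word y)) u)%:E *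
      (letter_sum (word_stem k (fp_word y)))%:E +
      (p (word_coord o k (fp_word y)) u)%:E * (phi u)%:E) +
      (phi (word_coord o k (fp_word y)))%:E).
    congr (_ + _); apply: eq_sum => u.
    by rewrite letter_sum_app EFinD ge0_muleDr.
  rewrite sumD; [|by move=> u; rewrite mule_ge0|by move=> u; rewrite mule_ge0].
  rewrite sumZr// kernel_sum// mul1e -addeA [X in _ + X]addeC addeA.
  by congr (_ + _); rewrite (letter_sum_split k y) EFinD.
transitivity (\sum_(k < N) ((alpha k)%:E * (letter_sum (fp_word y))%:E +
    (alpha k)%:E * Pphi (word_coord o k (fp_word y)))).
  by apply: eq_bigr => k _; rewrite ge0_muleDr// Pphi_ge0.
rewrite big_split /=; congr (_ + _).
by rewrite -ge0_sume_distrl// sumEFin ha1 mul1e.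
Qed.

Lemma mean_step n :
  mean n.+1 + \sum_(k < N) ((alpha k)%:E *
    \Sum_(y : FP) (walk n (fp_word y) * (phi (word_coord o k (fp_word y)))%:E)) =
  mean n + \sum_(k < N) ((alpha k)%:E *
    \Sum_(y : FP) (walk n (fp_word y) * Pphi (word_coord o k (fp_word y)))).
Proof.
have aa w : 0 <= (letter_sum w)%:E by rewrite lee_fin letter_sum_ge0.
have ph i (v : V i) : 0 <= (phi v)%:E by rewrite lee_fin.
have lin (f : forall k, V k -> \bar R) : (forall k v, 0 <= f k v) ->
   \sum_(k < N) ((alpha k)%:E * \Sum_(y : FP) (walk n (fp_word y) * f k (word_coord o k (fp_word y)))) =
   \Sum_(y : FP) (walk n (fp_word y) * \sum_(k < N) ((alpha k)%:E * f k (word_coord o k (fp_word y)))).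
  move=> f0; transitivity (\Sum_(y : FP) \sum_(k < N) ((alpha k)%:E * (walk n (fp_word y) * f k (word_coord o k (fp_word y))))).
    rewrite sum_big; last by move=> k y; rewrite !mule_ge0.
    by apply: eq_bigr => k _; rewrite sumZl// => y; rewrite mule_ge0.
  apply: eq_sum => y; rewrite ge0_sume_distrr; last by move=> k _; rewrite mule_ge0.
  by apply: eq_bigr => k _; rewrite muleCA.
rewrite (lin (fun k v => (phi v)%:E))// (lin (fun k v => Pphi v)); last by move=> *; exact: Pphi_ge0.
have -> : mean n.+1 = \Sum_(y : FP) (walk n (fp_word y) *
    \Sum_(x : FP) ((P y x)%:E * (letter_sum (fp_word x))%:E)).
  transitivity (\Sum_(x : FP) \Sum_(y : FP) (walk n (fp_word y) * ((P y x)%:E * (letter_sum (fp_word x))%:E))).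
    apply: eq_sum => x; rewrite /= -fp_pred// -sumZr//; last by move=> y; rewrite mule_ge0.
    by apply: eq_sum => y; rewrite muleA.
  rewrite sum_exchange; last by move=> x y; rewrite !mule_ge0.
  by apply: eq_sum => y; rewrite sumZl// => x; rewrite mule_ge0.
have s1 y : 0 <= \Sum_(x : FP) ((P y x)%:E * (letter_sum (fp_word x))%:E).
  by apply: sum_ge0 => x; rewrite mule_ge0.
have s2 (y : FP) : 0 <= \sum_(k < N) ((alpha k)%:E * (phi (word_coord o k (fp_word y)))%:E).
  by apply: sume_ge0 => k _; rewrite mule_ge0.
have s3 (y : FP) : 0 <= \sum_(k < N) ((alpha k)%:E * Pphi (word_coord o k (fp_word y))).
  by apply: sume_ge0 => k _; rewrite mule_ge0// Pphi_ge0.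
rewrite -!sumD; try by move=> y; rewrite mule_ge0.
by apply: eq_sum => y; rewrite -!ge0_muleDr// letter_sum_drift.
Qed.

Variable M : 'I_N -> R.
Hypothesis hM : forall k, \Sum_(v : V k) ((last_weight v)%:E * (phi v)%:E) = (M k)%:E.

(** By [last_visit_gf_eq], applying the kernel to the weights divides them by [xir 1 k] away from
    the root, and [phi] vanishes at the root, where this fails in general. *)
Lemma Pphi_sum k : \Sum_(v : V k) ((last_weight v)%:E * Pphi v) = (M k / xir 1 k)%:E.
Proof.
have t0 : (0 < xir 1 k)%R by apply: xir1_gt0.
have l0 (v : V k) : 0 <= (last_weight v)%:E by rewrite lee_fin ltW// last_weight_gt0.
transitivity (\Sum_(u : V k) ((xir 1 k)^-1%:E * ((last_weight u)%:E * (phi u)%:E))).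
  transitivity (\Sum_(v : V k) \Sum_(u : V k) ((last_weight v)%:E * ((p v u)%:E * (phi u)%:E))).
    by apply: eq_sum => v; rewrite sumZl// => u; rewrite mule_ge0// lee_fin.
  rewrite sum_exchange; last by move=> v u; rewrite !mule_ge0// lee_fin.
  apply: eq_sum => u; have [->|uo] := eqVneq u (o k).
    by rewrite phio !mule0 sum0// => v; rewrite !mule0.
  transitivity ((\Sum_(v : V k) ((last_weight v)%:E * (p v u)%:E)) * (phi u)%:E).
    rewrite -sumZr ?lee_fin//; last by move=> v; rewrite mule_ge0.
    by apply: eq_sum => v; rewrite muleA.
  rewrite muleA; congr (_ * _).
  have := last_visit_gf_eq (hp k) (ltW t0) uo; rewrite -last_weightE// => ->.
  rewrite muleA -EFinM mulVf ?gt_eqF// mul1e.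
  by apply: eq_sum => v; rewrite -last_weightE.
rewrite sumZl ?lee_fin ?invr_ge0 ?(ltW t0)//; last by move=> v; rewrite mule_ge0// lee_fin.
by rewrite hM -EFinM mulrC.
Qed.

(** [mean] starts from 0 and changes at each step by a difference of coordinate averages, so
    [mean n / n] is itself a combination of Cesaro means. *)
Lemma mean_limit : exists2 c : nat -> R, forall n, mean n = (c n)%:E &
  (fun n => c n / n%:R)%R @ \oo --> ((\sum_(k < N) M k / last_sum 1 k ^+ 2) / greenr 1)%R.
Proof.
have ph i (v : V i) : 0 <= (phi v)%:E by rewrite lee_fin.
have A k : exists c : nat -> R, (forall n,
    \Sum_(y : FP) (walk n (fp_word y) * (phi (word_coord o k (fp_word y)))%:E) = (c n)%:E) /\
    (fun n => psum c n / n%:R)%R @ \oo --> ((last_sum 1 k)^-1 * M k)%R.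
  by have [c cE cl] := coord_average (fun v => ph k v) (hM k); exists c.
have B k : exists c : nat -> R, (forall n,
    \Sum_(y : FP) (walk n (fp_word y) * Pphi (word_coord o k (fp_word y))) = (c n)%:E) /\
    (fun n => psum c n / n%:R)%R @ \oo --> ((last_sum 1 k)^-1 * (M k / xir 1 k))%R.
  by have [c cE cl] := coord_average (@Pphi_ge0 k) (Pphi_sum k); exists c.
have [a aP] := choice A; have [b bP] := choice B.
pose c n := (\sum_(k < N) alpha k * (psum (b k) n - psum (a k) n))%R.
exists c.
  elim=> [|n IH].
    rewrite /mean (@sum_delta _ _ (fp_root o)).
    - rewrite /= /letter_sum big_nil mule0 /c big1// => k _.
      by rewrite /psum !big_ord0 subrr mulr0.
    - by rewrite mule_ge0// lee_fin letter_sum_ge0.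
    - by move=> y yo; rewrite /= fp_word_eq0 (negbTE yo) mul0e.
  have := mean_step n; rewrite IH.
  under eq_bigr do rewrite (aP _).1 -EFinM.
  under [in X in _ = X]eq_bigr do rewrite (bP _).1 -EFinM.
  rewrite !sumEFin -EFinD.
  have -> : c n.+1 = (c n + \sum_(k < N) alpha k * b k n - \sum_(k < N) alpha k * a k n)%R.
    rewrite /c -big_split -sumrB /=; apply: eq_bigr => k _.
    by rewrite !psumS; ring.
  move=> e; rewrite EFinB -e addeK//.
have -> : (fun n => c n / n%:R)%R =
    (\sum_(k < N) (fun n => alpha k * (psum (b k) n / n%:R - psum (a k) n / n%:R)))%R.
  apply/funext => n; rewrite fct_sumE /c mulr_suml; apply: eq_bigr => k _.
  by rewrite -mulrBl mulrA.
have -> : ((\sum_(k < N) M k / last_sum 1 k ^+ 2) / greenr 1 =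
    \sum_(k < N) alpha k * ((last_sum 1 k)^-1 * (M k / xir 1 k) - (last_sum 1 k)^-1 * M k))%R.
  rewrite mulr_suml; apply: eq_bigr => k _.
  have t0 : (0 < xir 1 k)%R by apply: xir1_gt0.
  have L0 : (0 < last_sum 1 k)%R by rewrite (lt_le_trans ltr01)// last_sum_ge1// xir1_lt1.
  have g0 : (0 < greenr 1)%R by rewrite (lt_le_trans ltr01)// greenr_ge1.
  have e1 := last_sum_eq hp ha ler01 fin1 (xir1_lt1 hN hp hloop ha ha1 hR k).
  have e2 := greenr_renewal hp ha ler01 fin1; rewrite -e1 in e2.
  have e3 := xirM hp ha ler01 fin1 k.
  rewrite !mulr1 in e2 e3.
  (* With [e5] this gives [alpha k * (1 / xir 1 k - 1) = 1 / (greenr 1 * last_sum 1 k)], the source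
     of the second factor [last_sum 1 k] in the denominator. *)
  have e4 : (alpha k / xir 1 k = 1 - other_returnr k 1)%R by rewrite -e3 mulrAC divff ?mul1r// gt_eqF.
  have e5 : ((greenr 1)^-1 = last_sum 1 k * (1 - other_returnr k 1 - alpha k))%R.
    by apply: (mulfI (lt0r_neq0 g0)); rewrite e2 divff// gt_eqF.
  rewrite e5 -e4; field.
  by rewrite !gt_eqF.
elim/big_ind2: _ => [|f x g y fx gy|k _]; [exact: cvg_cst|exact: cvgD|].
apply: cvgM; first exact: cvg_cst.
by apply: cvgB; [exact: (bP k).2|exact: (aP k).2].
Qed.

End Functional.
End Additive.

(** * Entropy *)

Lemma ln_over_n (R : realType) (K : R) : 0 <= K ->
  (fun n : nat => (K + ln n.+1%:R) / n%:R) @ \oo --> (0 : R).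
Proof.
move=> K0; apply/cvgrPdist_le => e e0; near=> n.
have n0 : 0 < n%:R :> R by rewrite ltr0n; near: n; exists 1%N.
have n1 : 1 <= n%:R :> R by rewrite ler1n; near: n; exists 1%N.
(* The bound comes from [ln x <= x - 1] at [x = e / 4 * (n + 1)]; three quarters of [e * n] then
   remain to absorb the constants. *)
have nK : (K - ln (e / 4)) / (e / 4) <= n%:R by near: n; apply: nbhs_infty_ger.
have e4 : 0 < e / 4 by rewrite divr_gt0.
have y0 : 0 < n.+1%:R :> R by rewrite ltr0n.
have l0 : 0 <= ln n.+1%:R :> R by rewrite ln_ge0// ler1n.
rewrite sub0r normrN ger0_norm; last by rewrite divr_ge0 ?addr_ge0.
rewrite ler_pdivrMr//.
have := le_ln1Dx (_ : -1 < e / 4 * n.+1%:R - 1).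
rewrite addrCA subrr addr0 lnM ?posrE// => /(_ _) h.
have {}h : ln (e / 4) + ln n.+1%:R <= e / 4 * n.+1%:R - 1.
  by apply: h; rewrite ltrBrDr addNr mulr_gt0.
move: nK; rewrite ler_pdivrMr// => nK.
have : n.+1%:R = n%:R + 1 :> R by rewrite -natr1.
move=> nS; rewrite nS in h *; nra.
Unshelve. all: by end_near. Qed.

Section Entropy.
Context {R : realType} {N : nat} {V : 'I_N -> countType} (o : forall i, V i).
Context (p : forall i, V i -> V i -> R) (alpha : 'I_N -> R).
Hypothesis hN : (2 <= N)%N.
Hypothesis hp : forall i, stochastic (@p i).
Hypothesis hreach : forall i x, exists n : nat, 0 < nstep (@p i) n (o i) x.
Hypothesis hloop : forall i (x : V i), p x x = 0.
Hypothesis hunif : forall i, uniformly_irreducible (@p i).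
Hypothesis ha : forall i, 0 < alpha i.
Hypothesis ha1 : \sum_(i < N) alpha i = 1.
Context (d : measure_display) (Omega : measurableType d) (Pr : probability Omega R).
Context (X : nat -> Omega -> free_product o).
Hypothesis hX : markov_chain Pr (fp_trans p alpha) (fp_root o) X.
Hypothesis hR : (1 < green_radius (@fp_trans R N V o p alpha))%E.
Local Notation green_gf := (green_gf o p alpha).
Local Notation last_gf := (last_gf o p alpha).
Local Notation letter := (letter o).
Local Notation greenr := (greenr o p alpha).
Local Notation xir := (xir o p alpha).
Local Notation last_sum := (last_sum o p alpha).
Implicit Types (i k : 'I_N) (z : R).
Local Notation W := (seq {i : 'I_N & V i}).
Local Notation FP := (free_product o).
Local Notation walk := (walk o p alpha).
Local Notation last_weight := (last_weight o p alpha).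

Let fin1 : (green_gf 1 [::] < +oo)%E. Proof. exact: green_gf1_fin. Qed.
Let pw0 n (x : W) : (0 <= walk n x)%E. Proof. exact: walk_ge0. Qed.
Let L0 (x : W) : (0 <= last_gf 1 x)%E. Proof. exact: last_gf_ge0. Qed.
Local Hint Resolve pw0 L0 : core.

Lemma last_gf1_letter i (v : V i) : last_gf 1 (letter v) = (last_weight v)%:E.
Proof. by rewrite last_weightE// last_gfE. Qed.

Lemma last_sum1_ge1 i : 1 <= last_sum 1 i.
Proof. by apply: last_sum_ge1 => //; apply: xir1_lt1. Qed.

Lemma last_sum1_gt0 i : 0 < last_sum 1 i.
Proof. by apply: lt_le_trans (last_sum1_ge1 i). Qed.

(** This is g(0,1) = 0, read off from [entropy_g0]. *)
Lemma sum_last_sum_inv : \sum_(i < N) (1 - (last_sum 1 i)^-1) = 1.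
Proof.
have t1 i : xir 1 i < 1 by apply: xir1_lt1.
have tt i : 0 <= xir 1 i < 1 by rewrite t1 xir_ge0.
have x1 i : xi alpha Pr X i 1 = xir 1 i by apply: xiE.
have : entropy_g p alpha Pr X 0 1 = (1 - 1) * greenr 1 by apply: entropy_g0.
rewrite subrr mul0r entropy_gE//.
move/eqP; rewrite subr_eq0 => /eqP E; rewrite [RHS]E; apply: eq_bigr => i _.
by have -> : 1 + Lplus p alpha Pr X i 0 1 = last_sum 1 i by apply: Lplus_0.
Qed.

(** * Total weight of the words of a given length *)

Section Perron.
Local Open Scope ereal_scope.

Let T j i := \Sum_(x : FP) (if (size (fp_word x) == j) && (fp_type x == Some i)
  then last_gf 1 (fp_word x) else 0).
Let T' j i := \Sum_(x : FP) (if (size (fp_word x) == j) && (fp_type x != Some i)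
  then last_gf 1 (fp_word x) else 0).

(** Removing the last letter leaves a word of another type, and [last_gf] is multiplicative; the
    letters other than the root weigh [last_sum 1 i - 1]. *)
Let TS j i : T j.+1 i = (last_sum 1 i - 1)%:E * T' j i.
Proof.
have l0 (v : V i) : 0 <= (last_weight v)%:E by rewrite lee_fin ltW// last_weight_gt0.
have -> : (last_sum 1 i - 1)%:E = \Sum_(v : V i) (if v == o i then 0 else (last_weight v)%:E).
  have e : \Sum_(v : V i) (if v == o i then 0 else (last_weight v)%:E) + 1 = (last_sum 1 i)%:E.
    rewrite -last_weight_sum// -[X in _ + X](_ : \Sum_(v : V i) (if v == o i then 1 else 0) = 1).
      rewrite -sumD; [|by move=> v; case: ifP|by move=> v; case: ifP].
      by apply: eq_sum => v; case: eqVneq => [->|_]; rewrite ?adde0// add0e last_weight_root.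
    by rewrite (@sum_delta _ _ (o i)) ?eqxx// => v /negbTE ->.
  by rewrite EFinB -e addeK.
rewrite /T (sum_fp i); last by move=> x; case: ifP.
rewrite -sumZl; last 2 first.
- by apply: sum_ge0 => v; case: ifP.
- by move=> x; case: ifP.
apply: eq_sum => s; case: ifPn => si; last by rewrite andbF mule0.
rewrite andbT; case: eqP => [sj|sj]; last first.
  rewrite mule0; apply: sum0 => v; rewrite /fp_type fp_word_app//.
  have [->|vo] := eqVneq v (o i).
    by rewrite /word_app eqxx -/(fp_type s) (negbTE si) andbF.
  by rewrite letter_cat letterE// cats1 size_rcons eqSS (introF eqP sj).
rewrite -sumZr//; last by move=> v; case: ifP.
apply: eq_sum => v; rewrite /fp_type fp_word_app//.
have [->|vo] := eqVneq v (o i).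
  by rewrite /word_app eqxx -/(fp_type s) (negbTE si) andbF mul0e.
rewrite letter_cat last_gf_cat// last_gf1_letter muleC ifT//.
by rewrite letterE// cats1 size_rcons sj word_type_rcons !eqxx.
Qed.

(** Any constant above 1 and all the [last_sum 1 i] would do: it starts the induction in [T_le] and
    bounds the empty word. *)
Let C := (\sum_(i < N) last_sum 1 i)%R.

Let lrC i : (last_sum 1 i <= C)%R.
Proof. by rewrite /C (bigD1 i)//= lerDl sumr_ge0// => k _; rewrite ltW// last_sum1_gt0. Qed.

Let type_some (x : FP) j : size (fp_word x) = j.+1 -> exists k, fp_type x = Some k.
Proof.
rewrite /fp_type; case/lastP: (fp_word x) => // w a _.
by exists (tag a); rewrite word_type_rcons.
Qed.

Let T'S j i : T' j.+1 i = \sum_(k < N | k != i) T j.+1 k.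
Proof.
rewrite /T -sum_big; last by move=> k x; case: ifP.
apply: eq_sum => x; case: eqVneq => [/type_some[k ->]|_]; last first.
  by rewrite big1.
rewrite (inj_eq Some_inj) /=.
transitivity (\sum_(l < N | l != i) (if k == l then last_gf 1 (fp_word x) else 0)).
  have [ki|ki] := eqVneq k i.
    by rewrite big1// => l li; rewrite ki eq_sym (negbTE li).
  rewrite (bigD1 k)//= eqxx big1 ?adde0// => l /andP[_ lk].
  by rewrite eq_sym (negbTE lk).
by apply: eq_bigr => l _; rewrite (inj_eq Some_inj).
Qed.

Let T'0 i : T' 0%N i = 1.
Proof.
rewrite /T' (@sum_delta _ _ (fp_root o)).
- by rewrite /= last_gf_nil.
- by rewrite /= last_gf_nil lee_fin ler01.
- by move=> x xo; rewrite size_eq0 fp_word_eq0 (negbTE xo).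
Qed.

(* The vector [1 - (last_sum 1 i)^-1] is a Perron vector for the eigenvalue 1. *)
Let T_le j i : T j.+1 i <= (C * (1 - (last_sum 1 i)^-1))%:E.
Proof.
have l1 := last_sum1_ge1; have l0 := last_sum1_gt0.
have q0 i' : (0 <= 1 - (last_sum 1 i')^-1)%R.
  by rewrite subr_ge0 invf_le1.
elim: j i => [|j IH] i.
  rewrite TS T'0 mule1 lee_fin.
  have -> : (last_sum 1 i - 1 = last_sum 1 i * (1 - (last_sum 1 i)^-1))%R.
    by rewrite mulrBr mulr1 divff// gt_eqF.
  by rewrite ler_wpM2r.
rewrite TS T'S; apply: (@le_trans _ _ ((last_sum 1 i - 1)%:E *
   (\sum_(k < N | k != i) C * (1 - (last_sum 1 k)^-1))%R%:E)).
  apply: lee_wpmul2l; first by rewrite lee_fin subr_ge0.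
  by rewrite -sumEFin; apply: lee_sum => k _.
rewrite -EFinM lee_fin -mulr_sumr.
have -> : (\sum_(k < N | k != i) (1 - (last_sum 1 k)^-1) = (last_sum 1 i)^-1)%R.
  by have := sum_last_sum_inv; rewrite (bigD1 i)//= => e; lra.
rewrite mulrCA; apply: ler_wpM2l; first by rewrite sumr_ge0// => k _; apply: ltW.
by rewrite mulrBl divff ?gt_eqF// mul1r.
Qed.

Let C1 : (1 <= C)%R.
Proof.
have i0 : 'I_N by exact: Ordinal (leq_trans (ltn0Sn 0) (ltnW hN)).
exact: le_trans (last_sum1_ge1 i0) (lrC i0).
Qed.

(** Each sphere weighs at most [C], because the entries of the Perron vector add up to 1. Linear
    growth of the balls is what leaves only a logarithmic error in the entropy. *)
Lemma last_gf_ball : exists2 C : R, (1 <= C)%R & forall n,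
  \Sum_(x : FP) (if (size (fp_word x) <= n)%N then last_gf 1 (fp_word x) else 0) <=
  (C * n.+1%:R)%:E.
Proof.
exists C => // n.
have sph j : \Sum_(x : FP) (if size (fp_word x) == j then last_gf 1 (fp_word x) else 0) <= C%:E.
  case: j => [|j].
    rewrite (@sum_delta _ _ (fp_root o)).
    - by rewrite /= last_gf_nil lee_fin.
    - by rewrite /= last_gf_nil lee_fin ler01.
    - by move=> x xo; rewrite size_eq0 fp_word_eq0 (negbTE xo).
  apply: (@le_trans _ _ (\sum_(k < N) T j.+1 k)).
    rewrite /T -sum_big; last by move=> k x; case: ifP.
    apply: le_sum => x; case: eqVneq => [/type_some[k xk]|_]; last by rewrite sume_ge0.
    rewrite (bigD1 k)//= xk eqxx /= leeDl// sume_ge0// => l _.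
    by case: ifP.
  apply: (@le_trans _ _ (\sum_(k < N) (C * (1 - (last_sum 1 k)^-1))%:E)).
    by apply: lee_sum => k _; apply: T_le.
  by rewrite sumEFin -mulr_sumr sum_last_sum_inv mulr1.
apply: (@le_trans _ _ (\sum_(j < n.+1)
    \Sum_(x : FP) (if size (fp_word x) == j then last_gf 1 (fp_word x) else 0))).
  rewrite -sum_big; last by move=> j x; case: ifP.
  apply: le_sum => x; case: ifPn => [xn|_]; last by rewrite sume_ge0// => j _; case: ifP.
  rewrite (bigD1 (Ordinal (xn : size (fp_word x) < n.+1)%N))//= eqxx leeDl// sume_ge0// => j _.
  by case: ifP.
apply: (@le_trans _ _ (\sum_(j < n.+1) C%:E)); first by apply: lee_sum.
by rewrite sumEFin lee_fin sumr_const card_ord mulr_natr.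
Qed.

End Perron.
End Entropy.

(* [a - b] is minus the logarithm of the weight to which [q] is compared. *)
Lemma atom_entropy_lower (R : realType) (q g a b : R) : 0 <= q -> 0 < g ->
  q <= g * expR (b - a) -> q * a <= q * - ln q + q * ln g + q * b.
Proof.
move=> q0 g0 h; have [->|qn] := eqVneq q 0; first by rewrite !mul0r !addr0.
have {qn}qp : 0 < q by rewrite lt0r qn.
have : ln q <= ln g + (b - a).
  by rewrite -[b - a]expRK -lnM ?posrE ?expR_gt0// ler_ln ?posrE ?mulr_gt0 ?expR_gt0.
by nra.
Qed.

(** The inequality [ln x <= x - 1] at [x = r / q] with [r = expR (b - a) / c]. The extra [q] on the
    left will sum to 1 and compensate the total mass of [r]. *)
Lemma atom_entropy_upper (R : realType) (q c a b : R) : 0 <= q -> 0 < c ->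
  q * - ln q + q * b + q <= q * a + q * ln c + expR (b - a) / c.
Proof.
move=> q0 c0; have [->|qn] := eqVneq q 0.
  by rewrite !mul0r !add0r divr_ge0 ?expR_ge0// ltW.
have {qn}qp : 0 < q by rewrite lt0r qn.
set r := expR (b - a) / c; have r0 : 0 < r by rewrite divr_gt0 ?expR_gt0.
have := le_ln1Dx (_ : -1 < r / q - 1); rewrite addrCA subrr addr0 => /(_ _) h.
have {}h : ln (r / q) <= r / q - 1 by apply: h; rewrite ltrBrDr addNr divr_gt0.
rewrite lnM ?posrE ?invr_gt0// lnV ?posrE// in h.
rewrite /r lnM ?posrE ?invr_gt0 ?expR_gt0// lnV ?posrE// expRK -/r in h.
have : q * (b - a - ln c - ln q) <= r - q.
  have -> : r - q = q * (r / q - 1) by rewrite mulrBr mulr1 mulrCA divff ?mulr1// gt_eqF.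
  by rewrite ler_wpM2l.
lra.
Qed.

(** * Entropy compared with the mean of -log L, and the limit *)

Section Limit.
Context {R : realType} {N : nat} {V : 'I_N -> countType} (o : forall i, V i).
Context (p : forall i, V i -> V i -> R) (alpha : 'I_N -> R).
Hypothesis hN : (2 <= N)%N.
Hypothesis hp : forall i, stochastic (@p i).
Hypothesis hreach : forall i x, exists n : nat, 0 < nstep (@p i) n (o i) x.
Hypothesis hloop : forall i (x : V i), p x x = 0.
Hypothesis hunif : forall i, uniformly_irreducible (@p i).
Hypothesis ha : forall i, 0 < alpha i.
Hypothesis ha1 : \sum_(i < N) alpha i = 1.
Context (d : measure_display) (Omega : measurableType d) (Pr : probability Omega R).
Context (X : nat -> Omega -> free_product o).
Hypothesis hX : markov_chain Pr (fp_trans p alpha) (fp_root o) X.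
Hypothesis hR : (1 < green_radius (@fp_trans R N V o p alpha))%E.
Local Notation green_gf := (green_gf o p alpha).
Local Notation last_gf := (last_gf o p alpha).
Local Notation letter := (letter o).
Local Notation greenr := (greenr o p alpha).
Local Notation last_sum := (last_sum o p alpha).
Implicit Types (i k : 'I_N) (z : R).
Local Notation W := (seq {i : 'I_N & V i}).
Local Notation FP := (free_product o).
Local Notation walk := (walk o p alpha).
Local Notation last_weight := (last_weight o p alpha).
Local Notation log_deficit := (log_deficit o p alpha).
Local Notation log_bound := (log_bound o p alpha).
Local Notation log_deficit_sum := (log_deficit_sum o p alpha).
Local Notation letter_entropy := (letter_entropy o p alpha).

Let fin1 : (green_gf 1 [::] < +oo)%E. Proof. exact: green_gf1_fin. Qed.
Let pw0 n (x : W) : (0 <= walk n x)%E. Proof. exact: walk_ge0. Qed.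
Local Hint Resolve pw0 : core.

(** [mean_limit] asks for nonnegative functionals vanishing at the root, whereas
    [- ln (last_weight v)] can be negative: it is [phi1 v - phi2 v]. *)
Definition phi1 i (v : V i) : R := if v == o i then 0 else log_deficit v.
Definition phi2 i (v : V i) : R := if v == o i then 0 else log_bound i.

Lemma phi1_ge0 i (v : V i) : 0 <= phi1 v.
Proof. by rewrite /phi1; case: ifP => // _; apply: log_deficit_ge0. Qed.

Lemma phi2_ge0 i (v : V i) : 0 <= phi2 v.
Proof. by rewrite /phi2; case: ifP => // _; apply: log_bound_ge0. Qed.

Lemma phi1_o i : phi1 (o i) = 0. Proof. by rewrite /phi1 eqxx. Qed.
Lemma phi2_o i : phi2 (o i) = 0. Proof. by rewrite /phi2 eqxx. Qed.

Let l0 i (v : V i) : (0 <= (last_weight v)%:E)%E.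
Proof. by rewrite lee_fin ltW// last_weight_gt0. Qed.
Local Hint Resolve l0 : core.

Let sum_but_root i (f : V i -> R) (M : R) : (forall v, 0 <= f v) ->
  (\Sum_(v : V i) (last_weight v * f v)%:E)%E = M%:E ->
  (\Sum_(v : V i) ((last_weight v)%:E * (if v == o i then 0 else f v)%:E))%E = (M - f (o i))%:E.
Proof.
move=> f0 fM; have f0' v : (0 <= (f v)%:E)%E by rewrite lee_fin.
have e : (\Sum_(v : V i) ((last_weight v)%:E * (if v == o i then 0 else f v)%:E) + (f (o i))%:E = M%:E)%E.
  have -> : (f (o i))%:E = (\Sum_(v : V i) (if v == o i then (f v)%:E else 0))%E.
    by rewrite (@sum_delta _ _ (o i)) ?eqxx// => v /negbTE ->.
  rewrite -fM -sumD; [|by move=> v; rewrite mule_ge0//; case: ifP|by move=> v; case: ifP].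
  apply: eq_sum => v; rewrite EFinM; case: eqVneq => [->|_]; last by rewrite adde0.
  by rewrite mule0 add0e last_weight_root// mul1e.
by rewrite EFinB -e addeK.
Qed.

Lemma phi1_sum i : (\Sum_(v : V i) ((last_weight v)%:E * (phi1 v)%:E))%E = (log_deficit_sum i - log_bound i)%:E.
Proof.
have -> : log_bound i = log_deficit (o i) by rewrite /log_deficit last_weight_root// ln1 subr0.
apply: (@sum_but_root i (fun v => log_deficit v)); last exact: log_deficit_sumE.
by move=> v; apply: log_deficit_ge0.
Qed.

Lemma phi2_sum i : (\Sum_(v : V i) ((last_weight v)%:E * (phi2 v)%:E))%E =
  (log_bound i * last_sum 1 i - log_bound i)%:E.
Proof.
have b0 : 0 <= log_bound i by apply: log_bound_ge0.
apply: (@sum_but_root i (fun=> log_bound i)) => //.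
rewrite EFinM -last_weight_sum// -sumZl//.
by apply: eq_sum => v; rewrite EFinM muleC.
Qed.

Lemma last_gf_expR (x : FP) :
  last_gf 1 (fp_word x) = (expR (letter_sum phi2 (fp_word x) - letter_sum phi1 (fp_word x)))%:E.
Proof.
have : all (fun a : {i : 'I_N & V i} => tagged a != o (tag a)) (fp_word x).
  by have := svalP x; rewrite -/(fp_word x) => /andP[].
elim: (fp_word x) => [_|[i v] w IH /= /andP[vo /IH {}IH]].
  by rewrite last_gf_nil /letter_sum !big_nil subrr expR0.
have -> : Tagged (fun i => V i : Type) v :: w = letter v ++ w by rewrite letterE.
rewrite last_gf_cat// IH last_gf1_letter// -EFinM; congr EFin.
rewrite letterE// /letter_sum !big_cons /= /phi1 /phi2 (negbTE vo).
rewrite -[X in X * _]lnK ?posrE ?last_weight_gt0// -expRD; congr expR.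
by rewrite /log_deficit; ring.
Qed.

Definition walk_law n (x : FP) := fine (walk n (fp_word x)).

Lemma walk_lawE n x : walk n (fp_word x) = (walk_law n x)%:E.
Proof.
rewrite fineK// ge0_fin_numE//; apply: le_lt_trans (ltry 1).
rewrite -(walk_mass hp ha ha1 hX n).
by apply: (@sum_ge_term _ _ (fun y : FP => walk n (fp_word y))) => y.
Qed.

Lemma walk_law_ge0 n x : 0 <= walk_law n x. Proof. by rewrite -lee_fin -walk_lawE. Qed.

Lemma walk_law_le1 n x : walk_law n x <= 1.
Proof.
rewrite -lee_fin -walk_lawE -(walk_mass hp ha ha1 hX n).
by apply: (@sum_ge_term _ _ (fun y : FP => walk n (fp_word y))) => y.
Qed.

Lemma walk_law_le n x :
  walk_law n x <= greenr 1 * expR (letter_sum phi2 (fp_word x) - letter_sum phi1 (fp_word x)).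
Proof.
rewrite -lee_fin -walk_lawE EFinM -last_gf_expR -green_gfE// -green_gf_cat// cat0s.
by have := egf_term n (fun m => pw0 m (fp_word x)) ler01; rewrite expr1n mule1.
Qed.

Lemma law_walk_law n x : law Pr X n x = walk_law n x.
Proof. by rewrite /law (law_walk hp ha ha1 hX). Qed.

Lemma oppr_ln_walk_law_ge0 n x : 0 <= - ln (walk_law n x).
Proof.
rewrite oppr_ge0; have [e|e] := eqVneq (walk_law n x) 0; first by rewrite e ln0.
by rewrite ln_le0// walk_law_le1.
Qed.

Lemma expectation_law n :
  ('E_Pr[(fun w => - ln (law Pr X n (X n w)))%R] =
   \Sum_(x : FP) (walk_law n x * - ln (walk_law n x))%:E)%E.
Proof.
rewrite (expectation_X hX n (f := fun x => - ln (law Pr X n x))); last first.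
  by move=> x; rewrite law_walk_law oppr_ln_walk_law_ge0.
by apply: eq_sum => x; rewrite (law_walk hp ha ha1 hX) walk_lawE law_walk_law.
Qed.

Lemma walk_law_mass n : (\Sum_(x : FP) (walk_law n x)%:E)%E = 1%E.
Proof. by rewrite -(walk_mass hp ha ha1 hX n); apply: eq_sum => x; rewrite walk_lawE. Qed.

(** The lower bound compares the law with [greenr 1] times [last_gf]; the upper bound compares it
    with [last_gf] normalised on the ball of radius [n], which supports the law. *)
Lemma entropy_bounds : exists C : R, 1 <= C /\ forall n (c1 c2 : R),
  mean o p alpha phi1 n = c1%:E -> mean o p alpha phi2 n = c2%:E ->
  exists h : R, [/\ ('E_Pr[(fun w => - ln (law Pr X n (X n w)))%R] = h%:E)%E,
    c1 - c2 - ln (greenr 1) <= h & h <= c1 - c2 + (ln C + ln n.+1%:R)].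
Proof.
have [C C1 ball] := last_gf_ball hN hp hreach hloop hunif ha ha1 hX hR.
exists C; split => // n c1 c2 m1 m2.
have C0 : 0 < C by apply: lt_le_trans C1.
have g1 : 1 <= greenr 1 by apply: greenr_ge1.
have g0 : 0 < greenr 1 by apply: lt_le_trans g1.
have lg : 0 <= ln (greenr 1) by apply: ln_ge0.
pose c := C * n.+1%:R; have c0 : 0 < c by rewrite mulr_gt0// ltr0n.
have lc : 0 <= ln c by rewrite ln_ge0// mulr_ege1// ler1n.
pose A1 (x : FP) := letter_sum phi1 (fp_word x).
pose A2 (x : FP) := letter_sum phi2 (fp_word x).
have A10 x : 0 <= A1 x by apply: letter_sum_ge0 => *; exact: phi1_ge0.
have A20 x : 0 <= A2 x by apply: letter_sum_ge0 => *; exact: phi2_ge0.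
have u0 x := walk_law_ge0 n x.
have S1 : (\Sum_(x : FP) (walk_law n x * A1 x)%:E)%E = c1%:E.
  by rewrite -m1; apply: eq_sum => x; rewrite walk_lawE EFinM.
have S2 : (\Sum_(x : FP) (walk_law n x * A2 x)%:E)%E = c2%:E.
  by rewrite -m2; apply: eq_sum => x; rewrite walk_lawE EFinM.
have Sc (a : R) : 0 <= a -> (\Sum_(x : FP) (walk_law n x * a)%:E)%E = a%:E.
  move=> a0; rewrite -[RHS]mul1e -(walk_law_mass n) -sumZr//.
have lo (x : FP) := atom_entropy_lower (u0 x) g0 (walk_law_le n x).
rewrite expectation_law; set H := (\Sum_(x : FP) _)%E.
have h0 x : (0 <= (walk_law n x * - ln (walk_law n x))%:E)%E by rewrite lee_fin mulr_ge0// oppr_ln_walk_law_ge0.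
have H0 : (0 <= H)%E by apply: sum_ge0.
have low : (c1%:E <= H + (ln (greenr 1))%:E + c2%:E)%E.
  rewrite -S1 -S2 -(Sc _ lg) -sumD; [|by []|by move=> x; rewrite lee_fin mulr_ge0].
  rewrite -sumD; last 2 first.
  - by move=> x; rewrite adde_ge0// lee_fin mulr_ge0.
  - by move=> x; rewrite lee_fin mulr_ge0.
  by apply: le_sum => x; rewrite -!EFinD lee_fin lo.
(* A subprobability by [last_gf_ball], as [c] is the bound given there for the weight of the
   ball. *)
pose q (x : FP) := if (size (fp_word x) <= n)%N then expR (A2 x - A1 x) / c else 0.
have q0 x : 0 <= q x by rewrite /q; case: ifP => // _; rewrite divr_ge0 ?expR_ge0// ltW.
have qs : (\Sum_(x : FP) (q x)%:E <= 1)%E.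
  apply: (@le_trans _ _ (c^-1%:E * \Sum_(x : FP) (if (size (fp_word x) <= n)%N then last_gf 1 (fp_word x) else 0))%E).
    rewrite -sumZl ?lee_fin ?invr_ge0 ?(ltW c0)//; last first.
      by move=> x; case: ifP => // _; apply: last_gf_ge0.
    apply: le_sum => x; rewrite /q; case: ifP => _; last by rewrite mule0.
    by rewrite last_gf_expR -EFinM mulrC.
  apply: (le_trans (lee_wpmul2l _ (ball n))); first by rewrite lee_fin invr_ge0 ltW.
  by rewrite -EFinM -/c mulVf// gt_eqF.
have upx (x : FP) : walk_law n x * - ln (walk_law n x) + walk_law n x * A2 x + walk_law n x <=
    walk_law n x * A1 x + walk_law n x * ln c + q x.
  (* Outside the ball [q] is 0, but there the law vanishes too. *)
  rewrite /q; case: ifPn => [_|xn]; first exact: atom_entropy_upper.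
  suff -> : walk_law n x = 0 by rewrite !mul0r !addr0.
  apply: EFin_inj; rewrite -walk_lawE; apply/eqP; apply: contraR xn => /walk_neq0_size.
  by [].
have upp : (H + c2%:E + 1 <= c1%:E + (ln c)%:E + 1)%E.
  apply: (@le_trans _ _ (c1%:E + (ln c)%:E + \Sum_(x : FP) (q x)%:E)%E); last by rewrite leeD2l.
  rewrite -S1 -S2 -(Sc _ lc) -(walk_law_mass n).
  have m0 x : (0 <= (walk_law n x * A1 x)%:E)%E by rewrite lee_fin mulr_ge0.
  have m2' x : (0 <= (walk_law n x * A2 x)%:E)%E by rewrite lee_fin mulr_ge0.
  have m3 x : (0 <= (walk_law n x * ln c)%:E)%E by rewrite lee_fin mulr_ge0.
  rewrite -!sumD//; try by move=> x; rewrite ?adde_ge0// ?lee_fin.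
  by apply: le_sum => x; rewrite -!EFinD lee_fin upx.
(* Finiteness of the entropy is a consequence of the upper bound just obtained in [\bar R]. *)
have Hfin : H \is a fin_num.
  rewrite ge0_fin_numE//; apply: le_lt_trans (ltry (c1 + ln c + 1)).
  apply: le_trans upp; rewrite -addeA leeDl// adde_ge0// lee_fin.
  by rewrite -lee_fin -S2; apply: sum_ge0 => x; rewrite lee_fin mulr_ge0.
exists (fine H); rewrite fineK//; split => //.
  by move: low; rewrite -(fineK Hfin) -!EFinD lee_fin; lra.
have <- : ln c = ln C + ln n.+1%:R by rewrite /c lnM ?posrE ?ltr0n.
by move: upp; rewrite -(fineK Hfin) -!EFinD lee_fin; lra.
Qed.

Lemma entropy_limit :
  (fun n : nat => (n%:R^-1)%:E *
     'E_Pr[(fun omega => - ln (law Pr X n (X n omega)))%R])%E @ \oo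
    --> ((\sum_(i < N) letter_entropy i / last_sum 1 i ^+ 2) / greenr 1)%:E.
Proof.
have [C [C1 bnd]] := entropy_bounds.
have [c1 m1 l1] := mean_limit hN hp hreach hloop hunif ha ha1 hX hR phi1_ge0 phi1_o phi1_sum.
have [c2 m2 l2] := mean_limit hN hp hreach hloop hunif ha ha1 hX hR phi2_ge0 phi2_o phi2_sum.
have [h hP] := choice (fun n => bnd n (c1 n) (c2 n) (m1 n) (m2 n)).
have g1 : 1 <= greenr 1 by apply: greenr_ge1.
(* A single constant that dominates the errors of both bounds. *)
pose K := ln (greenr 1) + ln C.
have K0 : 0 <= K by rewrite addr_ge0// ln_ge0.
have -> : (fun n : nat => (n%:R^-1)%:E *
     'E_Pr[(fun omega => - ln (law Pr X n (X n omega)))%R])%E = EFin \o (fun n => h n / n%:R).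
  by apply/funext => n; have [-> _ _] := hP n; rewrite -EFinM mulrC.
apply: cvg_EFin; first by apply: nearW.
have er := @ln_over_n R K K0.
have -> : (\sum_(i < N) letter_entropy i / last_sum 1 i ^+ 2) / greenr 1 =
  (\sum_(k < N) (log_deficit_sum k - log_bound k) / last_sum 1 k ^+ 2) / greenr 1 -
  (\sum_(k < N) (log_bound k * last_sum 1 k - log_bound k) / last_sum 1 k ^+ 2) / greenr 1.
  rewrite -mulrBl -sumrB; congr (_ / _); apply: eq_bigr => k _.
  by rewrite -mulrBl; congr (_ / _); rewrite /letter_entropy; ring.
set Lm := _ / greenr 1 - _ / greenr 1.
have l12 : (fun n => c1 n / n%:R - c2 n / n%:R) @ \oo --> Lm by apply: cvgB.
clearbody Lm.
have lo : (fun n => c1 n / n%:R - c2 n / n%:R - (K + ln n.+1%:R) / n%:R) @ \oo --> Lm.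
  by rewrite -[Lm]subr0; apply: cvgB.
have up : (fun n => c1 n / n%:R - c2 n / n%:R + (K + ln n.+1%:R) / n%:R) @ \oo --> Lm.
  by rewrite -[Lm]addr0; apply: cvgD.
apply: (squeeze_cvgr _ lo up); near=> n.
have n0 : 0 < n%:R :> R by rewrite ltr0n; near: n; exists 1%N.
have [_ h1 h2] := hP n.
have ln0 : 0 <= ln n.+1%:R :> R by rewrite ln_ge0// ler1n.
have lC : 0 <= ln C by rewrite ln_ge0.
have lg : 0 <= ln (greenr 1) by rewrite ln_ge0.
by rewrite /= -!mulrBl -mulrDl !ler_pM2r ?invr_gt0//; apply/andP; split; rewrite /K; lra.
Unshelve. all: by end_near. Qed.

End Limit.

Theorem corollary4p2 (R : realType) (N : nat) (hN : (2 <= N)%N)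
  (V : 'I_N -> countType) (o : forall i, V i)
  (hV : ~ (N = 2%N /\ forall i, ([set: V i] #= `I_2)%card))
  (p : forall i, V i -> V i -> R)
  (hp : forall i, stochastic (p i))
  (hreach : forall i x, exists n : nat, 0 < nstep (p i) n (o i) x)
  (hloop : forall i x, p i x x = 0)
  (hunif : forall i, uniformly_irreducible (p i))
  (alpha : 'I_N -> R) (halpha : forall i, 0 < alpha i)
  (halpha1 : \sum_(i < N) alpha i = 1)
  (d : measure_display) (Omega : measurableType d) (Pr : probability Omega R)
  (X : nat -> Omega -> free_product o)
  (hX : markov_chain Pr (fp_trans p alpha) (fp_root o) X)
  (hR : (1 < green_radius (@fp_trans R N V o p alpha))%E) :
  let g := entropy_g p alpha Pr X in
  let g_r := fun r : R => g r 1 in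
  let g_s := fun s : R => g 0 (expR (- s)) in
  [/\ derivable g_r 0 1, derivable g_s 0 1, derive1 g_s 0 != 0 &
    (fun n : nat =>
       (n%:R^-1)%:E * 'E_Pr[(fun omega => - ln (law Pr X n (X n omega)))%R])%E @ \oo
      --> (derive1 g_r 0 / derive1 g_s 0)%:E].
Proof.
move=> g g_r g_s.
have ds : is_derive 0 (1 : R) g_s (greenr o p alpha 1) by apply: entropy_g_s_derive.
have dr := @entropy_g_r_derive R N V o p alpha hN hp hreach hloop hunif halpha
  halpha1 d Omega Pr X hX hR.
rewrite -/g -/g_r in dr.
have es : derive1 g_s 0 = greenr o p alpha 1 by rewrite derive1E derive_val.
have er : derive1 g_r 0 = \sum_(i < N) letter_entropy o p alpha i / last_sum o p alpha 1 i ^+ 2.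
  by rewrite derive1E derive_val.
split.
- exact: ex_derive.
- exact: ex_derive.
- rewrite es gt_eqF// (lt_le_trans ltr01)//; apply: greenr_ge1 => //.
  exact: green_gf1_fin.
- by rewrite es er; apply: entropy_limit.
Qed.
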